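(* Let $\mathcal{F}$ be the Farey tesselation of the unit disk and let $\dot{s}:\mathcal{F}\to\mathbb{R}$ be a function on its set of edges. Then $\dot{s}$ is the infinitesimal shear function of a Zygmund vector field $V$ on $S^1$ if and only if there exists a constant $C>0$ such that for every fan $\mathcal{F}_p=\{e_n\}_{n\in\mathbb{Z}}$ of $\mathcal{F}$ and for all $m,k\in\mathbb{Z}$ with $k\geq 0$, $$\Big|\dot{s}(e_m)+\frac{k}{k+1}\big[\dot{s}(e_{m+1})+\dot{s}(e_{m-1})\big]+\frac{k-1}{k+1}\big[\dot{s}(e_{m+2})+\dot{s}(e_{m-2})\big]+\cdots+\frac{1}{k+1}\big[\dot{s}(e_{m+k})+\dot{s}(e_{m-k})\big]\Big|\leq C .$$
   Context: Farey tesselation of the disk: the Farey tesselation of the upper half-plane $\mathbb{H}$ is the set of all hyperbolic geodesics with endpoints $\frac ab,\frac cd\in\mathbb{Q}\cup\{\infty\}$ (in lowest terms, $\infty=\frac10$) with $|ad-bc|=1$; it is an ideal triangulation of $\mathbb{H}$. Let $B(z)=\frac{1+iz}{1-iz}$, the Möbius map from $\mathbb{H}$ onto the unit disk with $B(0)=1$, $B(1)=i$, $B(\infty)=-1$. $\mathcal{F}$ is the image under $B$ of the Farey tesselation of $\mathbb{H}$. Fans: for a vertex $p$ of $\mathcal{F}$ the fan $\mathcal{F}_p$ is the set of all edges of $\mathcal{F}$ with one endpoint $p$, enumerated as $\{e_n\}_{n\in\mathbb{Z}}$ so that $e_n$ and $e_{n+1}$ are adjacent (two sides of a common complementary triangle)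 for all $n$. Vector fields: a (continuous) vector field on $\hat{\mathbb{R}}=\mathbb{R}\cup\{\infty\}$ is a continuous $W:\mathbb{R}\to\mathbb{R}$ such that $\lim_{x\to+\infty}W(x)/x^2=\lim_{x\to-\infty}W(x)/x^2$ exists and is finite. It is Zygmund if there is $C>0$ such that both $W(x)$ and $x^2W(1/x)$ (extended continuously to $x=0$) satisfy $|W(x+t)+W(x-t)-2W(x)|\le Ct$ for $x\in[-2,2]$, $t\in[0,1]$. A vector field $V:S^1\to\mathbb{C}$ (tangent to $S^1$ at each point) is Zygmund if $V=B_*W$, i.e. $V(B(x))=B'(x)W(x)$, for a Zygmund vector field $W$ on $\hat{\mathbb{R}}$. Infinitesimal shear function of $V$: for an edge $e\in\mathcal{F}$ with endpoints $b,d$, let $a,c$ be the third vertices of the two complementary triangles of $\mathcal{F}$ having $e$ as a side, with $a,b,c,d$ in counterclockwise order on $S^1$. Then $$\dot s(e)=\frac{V(c)-V(b)}{c-b}+\frac{V(d)-V(a)}{d-a}-\frac{V(b)-V(a)}{b-a}-\frac{V(d)-V(c)}{d-c},$$ which is the first variation of $\log\frac{(c-b)(d-a)}{(b-a)(d-c)}$ along $V$. (It is unchanged under $(a,b,c,d)\mapsto(c,d,a,b)$.) *)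

(* Defs.v *)
(* Stdlib reals with Coquelicot: R is the real line, C the complex plane. *)
From Stdlib Require Export Reals ZArith Lra.
From Coquelicot Require Export Coquelicot.
Open Scope R_scope.

(** * The Farey tesselation *)

(* The boundary of the upper half-plane; [None] is the point at infinity. *)
Definition ideal : Type := option R.

Definition frac (a b : Z) : ideal :=
  if Z.eq_dec b 0 then None else Some (IZR a / IZR b).

(* Two points of Q u {oo} that span an edge of the Farey tesselation. *)
Definition farey_neighbours (x y : ideal) : Prop :=
  exists a b c d : Z,
    Z.gcd a b = 1%Z /\ Z.gcd c d = 1%Z /\
    x = frac a b /\ y = frac c d /\
    Z.abs (a * d - b * c) = 1%Z.

(* Vanishes exactly on the Euclidean circle with diameter [x, y], or on the
   vertical line through the finite endpoint; its sign tells apart the two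
   sides of the geodesic with endpoints x and y. *)
Definition side (x y : ideal) (z : C) : R :=
  match x, y with
  | Some x, Some y =>
      Cmod (z - RtoC ((x + y) / 2))%C ^ 2 - ((x - y) / 2) ^ 2
  | Some x, None => Re z - x
  | None, Some y => Re z - y
  | None, None => 0
  end.

(* The sign of [side x y] near an ideal point r other than x and y.  If r is
   infinite then x and y are finite, and [side x y] is positive near r. *)
Definition side_at (x y r : ideal) : R :=
  match r with
  | Some r => side x y (RtoC r)
  | None => 1
  end.

Definition geodesic (x y : ideal) (z : C) : Prop :=
  x <> y /\ 0 < Im z /\ side x y z = 0.

(* The interior of the ideal triangle: the points which, for each of the three
   sides, lie on the same side as the opposite vertex. *)
Definition open_ideal_triangle (x y r : ideal) (z : C) : Prop :=
  0 < Im z /\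
  0 < side x y z * side_at x y r /\
  0 < side y r z * side_at y r x /\
  0 < side r x z * side_at r x y.

Definition B (z : C) : C := ((1 + Ci * z) / (1 - Ci * z))%C.

Definition B_ideal (x : ideal) : C :=
  match x with
  | Some x => B (RtoC x)
  | None => (- (1))%C
  end.

(* The set of points E is an edge of the tesselation of the disk, with
   endpoints p and q on the unit circle. *)
Definition edge_between (E : C -> Prop) (p q : C) : Prop :=
  exists x y : ideal,
    farey_neighbours x y /\ p = B_ideal x /\ q = B_ideal y /\
    (forall z : C, E z <-> exists w : C, geodesic x y w /\ z = B w).

Definition farey : Type :=
  { E : C -> Prop | exists p q : C, edge_between E p q }.

Definition joins (e : farey) (p q : C) : Prop := edge_between (proj1_sig e) p q.

Definition farey_vertex (p : C) : Prop := exists (e : farey) (q : C), joins e p q.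

(* The ideal triangle with vertices p, q, r has its three sides in the
   tesselation and no edge enters its interior. *)
Definition complementary_triangle (p q r : C) : Prop :=
  exists x y t : ideal,
    p = B_ideal x /\ q = B_ideal y /\ r = B_ideal t /\
    farey_neighbours x y /\ farey_neighbours y t /\ farey_neighbours t x /\
    (forall (e : farey) (z : C),
        open_ideal_triangle x y t z -> ~ proj1_sig e (B z)).

(** * Fans *)

Definition in_fan (p : C) (e : farey) : Prop := exists q : C, joins e p q.

Definition adjacent (e f : farey) : Prop :=
  e <> f /\
  exists p q r : C,
    complementary_triangle p q r /\ joins e p q /\ joins f p r.

Definition fan_enumeration (p : C) (e : Z -> farey) : Prop :=
  (forall n, in_fan p (e n)) /\
  (forall f, in_fan p f -> exists n, e n = f) /\
  (forall m n, e m = e n -> m = n) /\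
  (forall n, adjacent (e n) (e (n + 1)%Z)).

(* The index j >= 1 carries the weight (k + 1 - j) / (k + 1); the sum is empty
   for k = 0. *)
Definition fan_average (s : farey -> R) (e : Z -> farey) (m : Z) (k : nat) : R :=
  s (e m) +
  sum_n_m (fun j : nat =>
             (INR k + 1 - INR j) / (INR k + 1) *
             (s (e (m + Z.of_nat j)%Z) + s (e (m - Z.of_nat j)%Z)))
          1 k.

(** * Zygmund vector fields *)

Definition line_vector_field (W : R -> R) : Prop :=
  (forall x, continuous W x) /\
  exists L : R,
    is_lim (fun x => W x / x ^ 2) p_infty L /\
    is_lim (fun x => W x / x ^ 2) m_infty L.

Definition zygmund_bound (M : R) (W : R -> R) : Prop :=
  forall x t : R, -2 <= x <= 2 -> 0 <= t <= 1 ->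
    Rabs (W (x + t) + W (x - t) - 2 * W x) <= M * t.

(* [W'] is x^2 W(1/x), extended continuously to x = 0. *)
Definition line_zygmund (W : R -> R) : Prop :=
  line_vector_field W /\
  exists W' : R -> R,
    (forall x, x <> 0 -> W' x = x ^ 2 * W (1 / x)) /\
    continuous W' 0 /\
    exists M : R, 0 < M /\ zygmund_bound M W /\ zygmund_bound M W'.

(* V = B_* W on the unit circle; the value at B(oo) = -1 is the limit of the
   values at B(x) as x tends to infinity. *)
Definition pushforward (W : R -> R) (V : C -> C) : Prop :=
  (forall x : R, V (B (RtoC x)) = (C_derive B (RtoC x) * RtoC (W x))%C) /\
  filterlim (fun x : R => (C_derive B (RtoC x) * RtoC (W x))%C)
    (Rbar_locally p_infty) (locally (V (B_ideal None))) /\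
  filterlim (fun x : R => (C_derive B (RtoC x) * RtoC (W x))%C)
    (Rbar_locally m_infty) (locally (V (B_ideal None))).

Definition tangent_to_circle (V : C -> C) : Prop :=
  forall z : C, Cmod z = 1 -> exists r : R, V z = (Ci * z * RtoC r)%C.

(* Only the values of V on the unit circle matter. *)
Definition circle_zygmund (V : C -> C) : Prop :=
  tangent_to_circle V /\
  exists W : R -> R, line_zygmund W /\ pushforward W V.

(** * Infinitesimal shear functions *)

(* For points of the unit circle: p, q, r are distinct and in counterclockwise
   order (the Euclidean triangle pqr has positive signed area). *)
Definition ccw (p q r : C) : Prop := 0 < Im (Cconj (q - p) * (r - p))%C.

Definition ccw4 (a b c d : C) : Prop := ccw a b c /\ ccw a c d.

Definition infinitesimal_shear (V : C -> C) (s : farey -> R) : Prop :=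
  forall (e : farey) (a b c d : C),
    joins e b d ->
    complementary_triangle a b d -> complementary_triangle b c d ->
    ccw4 a b c d ->
    RtoC (s e) =
      ((V c - V b) / (c - b) + (V d - V a) / (d - a)
       - (V b - V a) / (b - a) - (V d - V c) / (d - c))%C.

(* Main.v *)
(* Write a vector field W on the line as a function F(x, y) = y^2 W(x / y) on the plane,
   homogeneous of degree two.  Adding an infinitesimal Moebius field changes F by a
   quadratic form, so everything is expressed by the defect of the parallelogram law
     P(e, f) = F(e + f) + F(e - f) - 2 F(e) - 2 F(f).
   Lines spanned by e - f, e, e + f, f form a harmonic quadruple; W is Zygmund iff
   |P(e, f)| <= C |det(e, f)| for all e, f.  The shear of the Farey edge spanned by the
   integer vectors u, v is P(u, v), and summation by parts turns the average of the fan
   of u into P(m u + v, (k + 1) u) / (k + 1).  This gives one direction.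

   Conversely, prescribing P(u, v) on all Farey edges determines F up to a quadratic
   form, as in Conway's topograph: along the Euclidean algorithm for a direction
   s u + t v each edge adds its shear times the current s t, and the sum of the products
   s t is at most s^2 + t^2.  Hence in every integer basis F differs from its
   quadratic interpolation by O(s^2 + t^2) on each cone, and the fan condition makes its
   values at integers Zygmund, so P(e, f) is controlled if the harmonic quadruple is large.
   Gauss reduction finds a basis in which a given quadruple is large. *)

Require Import Defs.
From Stdlib Require Import Lia Psatz FunctionalExtensionality PropExtensionality.
From Stdlib Require Import ProofIrrelevance ClassicalEpsilon.
Open Scope R_scope.

(** The Zygmund condition is imposed in two affine charts, for centres in a bounded interval and
    steps at most one, whereas fans sit at all rational points. The bound on P is the same condition
    in a form invariant under every linear change of coordinates of determinant 1; this is why one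
    constant serves all fans, and the forward direction is mainly the passage from the two charts to
    that bound. In the other direction the cone estimate is useless for quadruples that are short in
    the chart at hand, where the error of order s^2 + t^2 dominates. All estimates are uniform over
    SL(2, Z), so a change of chart costs nothing. Edges are sets of points, and complementary
    triangles are defined by avoiding them, so the combinatorics of integer vectors must first be
    recovered from geometry: at an interior point z of a Farey triangle the form |a - b z|^2 has
    positive Selling parameters with respect to the three vertices. *)

Lemma C_eq (z w : C) : Re z = Re w -> Im z = Im w -> z = w.
Proof. destruct z, w; simpl; intros -> ->; reflexivity. Qed.

(** * Ideal triangles *)

(* The inner product [Re ((a - b z) conj (c - d z))] of the vectors (a, b) and
   (c, d): they span a geodesic through z exactly if they are orthogonal. *)
Definition inner (z : C) (a b c d : R) : R :=
  a * c - Re z * (a * d + b * c) + (Re z ^ 2 + Im z ^ 2) * (b * d).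

Definition det (a b c d : Z) : Z := (a * d - b * c)%Z.

Definition unimodular (a b c d : Z) : Prop := Z.abs (det a b c d) = 1%Z.

(** The factor [k] is given explicitly to show that it does not depend on [z]: evaluating [side] at
    a third vertex produces the same factor, so only its square affects signs. *)
Lemma side_frac_nz (a b c d : Z) (z : C) : unimodular a b c d ->
  exists k : R, k <> 0 /\
    side (frac a b) (frac c d) z = k * inner z (IZR a) (IZR b) (IZR c) (IZR d) /\
    (b <> 0%Z -> d <> 0%Z -> k = / (IZR b * IZR d)) /\
    (b = 0%Z -> k = - / (IZR a * IZR d)) /\
    (d = 0%Z -> k = - / (IZR b * IZR c)).
Proof.
  unfold unimodular, det, frac; intros H.
  destruct (Z.eq_dec b 0) as [Hb|Hb]; destruct (Z.eq_dec d 0) as [Hd|Hd].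
  - subst; lia.
  - subst b. assert (a <> 0%Z) by (intros ->; lia).
    exists (- / (IZR a * IZR d)).
    assert (Ha' := not_0_IZR a H0). assert (Hd' := not_0_IZR d Hd).
    split; [|split; [|repeat split; intros; try lia; reflexivity]].
    + apply Ropp_neq_0_compat, Rinv_neq_0_compat, Rmult_integral_contrapositive; auto.
    + simpl. unfold inner. field. auto.
  - subst d. assert (c <> 0%Z) by (intros ->; lia).
    exists (- / (IZR b * IZR c)).
    assert (Hc' := not_0_IZR c H0). assert (Hb' := not_0_IZR b Hb).
    split; [|split; [|repeat split; intros; try lia; reflexivity]].
    + apply Ropp_neq_0_compat, Rinv_neq_0_compat, Rmult_integral_contrapositive; auto.
    + simpl. unfold inner. field. auto.
  - assert (Hd' := not_0_IZR d Hd). assert (Hb' := not_0_IZR b Hb).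
    exists (/ (IZR b * IZR d)).
    split; [|split; [|repeat split; intros; try lia; reflexivity]].
    + apply Rinv_neq_0_compat, Rmult_integral_contrapositive; auto.
    + unfold side. rewrite Cmod2_alt.
      unfold inner. destruct z as [x y]; simpl. field. auto.
Qed.

Lemma frac_neq (a b c d : Z) : unimodular a b c d -> frac a b <> frac c d.
Proof.
  unfold unimodular, det, frac; intros H.
  destruct (Z.eq_dec b 0) as [Hb|Hb]; destruct (Z.eq_dec d 0) as [Hd|Hd];
    try discriminate.
  - subst; lia.
  - intros E; injection E as E.
    assert (Hd' := not_0_IZR d Hd). assert (Hb' := not_0_IZR b Hb).
    assert (IZR a * IZR d = IZR b * IZR c).
    { replace (IZR a) with (IZR a / IZR b * IZR b) by (field; auto).
      rewrite E. field; auto. }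
    rewrite <- !mult_IZR in H0. apply eq_IZR in H0. lia.
Qed.

Lemma geodesic_frac (a b c d : Z) (z : C) : unimodular a b c d ->
  geodesic (frac a b) (frac c d) z <->
  0 < Im z /\ inner z (IZR a) (IZR b) (IZR c) (IZR d) = 0.
Proof.
  intros H. destruct (side_frac_nz a b c d z H) as (k & Hk & E & _).
  unfold geodesic. rewrite E. split.
  - intros (_ & H1 & H2). split; auto. apply Rmult_integral in H2. tauto.
  - intros (H1 & H2). split; [apply frac_neq, H|]. split; auto. rewrite H2. ring.
Qed.

(** At the real point m / n the form [inner] factors as [det a b m n * det c d m n] divided by n^2,
    so an integer product tells on which side of the edge the third vertex lies. *)
Lemma side_side_at_sign (a b c d m n : Z) (z : C) :
  unimodular a b c d -> unimodular c d m n -> unimodular m n a b ->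
  0 < side (frac a b) (frac c d) z * side_at (frac a b) (frac c d) (frac m n) ->
  0 < inner z (IZR a) (IZR b) (IZR c) (IZR d) * IZR (det a b m n * det c d m n).
Proof.
  intros H1 H2 H3.
  destruct (side_frac_nz a b c d z H1) as (k & Hk & E & K1 & K2 & K3).
  rewrite E. set (I := inner z _ _ _ _).
  unfold unimodular, det in *.
  unfold frac at 3. destruct (Z.eq_dec n 0) as [Hn|Hn]; simpl side_at.
  - subst n.
    assert (b <> 0%Z) by (intros ->; lia). assert (d <> 0%Z) by (intros ->; lia).
    assert (m <> 0%Z) by (intros ->; lia).
    rewrite K1 by auto. rewrite Rmult_1_r. intros HH.
    replace (I * _) with (/ (IZR b * IZR d) * I * (IZR b * IZR d * IZR m) ^ 2).
    + apply Rmult_lt_0_compat; auto. apply pow2_gt_0.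
      repeat apply Rmult_integral_contrapositive_currified; apply not_0_IZR; auto.
    + rewrite mult_IZR, !minus_IZR, !mult_IZR. simpl. field. split; apply not_0_IZR; auto.
  - destruct (side_frac_nz a b c d (RtoC (IZR m / IZR n)) H1) as (k' & Hk' & E' & K1' & K2' &
        K3').
    rewrite E'. assert (k' = k).
    { destruct (Z.eq_dec b 0). rewrite K2, K2' by auto; auto.
      destruct (Z.eq_dec d 0). rewrite K3, K3' by auto; auto.
      rewrite K1, K1' by auto; auto. }
    subst k'. intros HH.
    replace (I * _) with ((k * I * (k *
        inner (RtoC (IZR m / IZR n)) (IZR a) (IZR b) (IZR c) (IZR d)))
       * (IZR n / k) ^ 2).
    + apply Rmult_lt_0_compat; auto. apply pow2_gt_0. unfold Rdiv.
      apply Rmult_integral_contrapositive_currified; [apply not_0_IZR;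
          auto|apply Rinv_neq_0_compat; auto].
    + rewrite mult_IZR, !minus_IZR, !mult_IZR. unfold inner; simpl. field.
      split; auto. apply not_0_IZR; auto.
Qed.

Lemma unimodular_sign_pattern (x y x' y' k : Z) :
  Z.abs (x * y' - x' * y) = 1%Z -> (k = 1 \/ k = -1)%Z ->
  (0 <= x * x' /\ 0 <= y * y' /\ 0 <= (x - k * y) * (x' - k * y') /\
     0 < x * x' + y * y' + (x - k * y) * (x' - k * y') \/
   x * x' <= 0 /\ y * y' <= 0 /\ (x - k * y) * (x' - k * y') <= 0 /\
     x * x' + y * y' + (x - k * y) * (x' - k * y') < 0)%Z.
Proof.
  intros H Hk.
  (* Opposite signs of two of the products would force |x y' - x' y| >= 2. *)
  assert (N : forall p q p' q', Z.abs (p * q' - p' * q) = 1%Z ->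
      (0 <= p * p' /\ 0 <= q * q' \/ p * p' <= 0 /\ q * q' <= 0)%Z).
  { intros p q p' q' E.
    destruct (Z.le_gt_cases 0 (p * p')); destruct (Z.le_gt_cases 0 (q * q')); try lia.
    - destruct (Z.eq_dec (p * p') 0); [lia|].
      assert (0 < p * p')%Z by lia.
      assert (((p * q') * (p' * q) < 0)%Z) by nia. exfalso.
      assert (p * q' <> 0 /\ p' * q <> 0)%Z by (split; nia).
      assert ((p * q' < 0 /\ 0 < p' * q) \/ (0 < p * q' /\ p' * q < 0))%Z by nia. lia.
    - destruct (Z.eq_dec (q * q') 0); [lia|].
      assert (0 < q * q')%Z by lia.
      assert (((p * q') * (p' * q) < 0)%Z) by nia. exfalso.
      assert ((p * q' < 0 /\ 0 < p' * q) \/ (0 < p * q' /\ p' * q < 0))%Z by nia. lia. }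
  assert (N1 := N x y x' y' H).
  assert (N2 := N x (x - k * y)%Z x' (x' - k * y')%Z).
  assert (N3 := N y (x - k * y)%Z y' (x' - k * y')%Z).
  assert (E2 : Z.abs (x * (x' - k * y') - x' * (x - k * y)) = 1%Z).
  { replace (x * (x' - k * y') - x' * (x - k * y))%Z with (- k * (x * y' - x' * y))%Z by ring.
    rewrite Z.abs_mul, H. destruct Hk; subst k; reflexivity. }
  assert (E3 : Z.abs (y * (x' - k * y') - y' * (x - k * y)) = 1%Z).
  { rewrite <- H, <- Z.abs_opp; f_equal; ring. }
  specialize (N2 E2). specialize (N3 E3).
  assert (NZ : ~ (x * x' = 0 /\ y * y' = 0 /\ (x - k * y) * (x' - k * y') = 0)%Z).
  { intros (A1 & A2 & A3).
    apply Z.mul_eq_0 in A1, A2, A3.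
    destruct A1; subst; destruct A2; subst; destruct Hk; subst; lia. }
  clear - N1 N2 N3 NZ. lia.
Qed.

(** This is Selling's expression of a symmetric bilinear form with parameters [P], [Q], [T],
    evaluated at two integer vectors spanning an edge. The three coefficients never have opposite
    signs and never all vanish, so positive parameters leave no room for cancellation. *)
Lemma selling_nonzero (x y x' y' k : Z) (P Q T : R) :
  Z.abs (x * y' - x' * y) = 1%Z -> (k = 1 \/ k = -1)%Z ->
  0 < P -> 0 < Q -> 0 < T ->
  IZR (x * x') * P + IZR (y * y') * Q + IZR ((x - k * y) * (x' - k * y')) * T <> 0.
Proof.
  intros H Hk HP HQ HT.
  destruct (unimodular_sign_pattern x y x' y' k H Hk) as [(A1 & A2 & A3 & A4)|(A1 & A2 & A3 &
      A4)];
    apply IZR_le in A1, A2, A3; apply IZR_lt in A4; rewrite !plus_IZR in A4;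
    set (u := IZR (x * x')) in *; set (v := IZR (y * y')) in *;
    set (w := IZR ((x - k * y) * (x' - k * y'))) in *.
  - destruct A1 as [A1|A1]; [nra|]. destruct A2 as [A2|A2]; [nra|]. nra.
  - destruct A1 as [A1|A1]; [nra|]. destruct A2 as [A2|A2]; [nra|]. nra.
Qed.

Lemma no_edge_through_triangle (a b c d m n p q p' q' : Z) (z : C) :
  unimodular a b c d -> unimodular c d m n -> unimodular m n a b ->
  open_ideal_triangle (frac a b) (frac c d) (frac m n) z ->
  unimodular p q p' q' ->
  inner z (IZR p) (IZR q) (IZR p') (IZR q') <> 0.
Proof.
  intros H1 H2 H3 (Hz & T1 & T2 & T3) Hpq.
  apply side_side_at_sign in T1; auto.
  apply side_side_at_sign in T2; auto.
  apply side_side_at_sign in T3; auto.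
  unfold unimodular, det in *.
  set (D := (a * d - b * c)%Z) in *.
  set (ep := (D * (m * d - n * c))%Z). set (et := (D * (a * n - b * m))%Z).
  assert (HD : (D = 1 \/ D = -1)%Z) by lia.
  assert (Hep : (ep = 1 \/ ep = -1)%Z) by (unfold ep; destruct HD as [-> | ->]; lia).
  assert (Het : (et = 1 \/ et = -1)%Z) by (unfold et; destruct HD as [-> | ->]; lia).
  assert (DD : (D * D = 1)%Z) by (destruct HD as [-> | ->]; reflexivity).
  assert (Em : m = (ep * a + et * c)%Z).
  { unfold ep, et. replace m with (D * D * m)%Z at 1 by (rewrite DD; ring). unfold D; ring. }
  assert (En : n = (ep * b + et * d)%Z).
  { unfold ep, et. replace n with (D * D * n)%Z at 1 by (rewrite DD; ring). unfold D; ring. }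
  set (x := (D * (p * d - q * c))%Z). set (y := (D * (a * q - b * p))%Z).
  set (x' := (D * (p' * d - q' * c))%Z). set (y' := (D * (a * q' - b * p'))%Z).
  assert (Ep : p = (x * a + y * c)%Z).
  { unfold x, y. replace p with (D * D * p)%Z at 1 by (rewrite DD; ring). unfold D; ring. }
  assert (Eq : q = (x * b + y * d)%Z).
  { unfold x, y. replace q with (D * D * q)%Z at 1 by (rewrite DD; ring). unfold D; ring. }
  assert (Ep' : p' = (x' * a + y' * c)%Z).
  { unfold x', y'. replace p' with (D * D * p')%Z at 1 by (rewrite DD; ring). unfold D; ring. }
  assert (Eq' : q' = (x' * b + y' * d)%Z).
  { unfold x', y'. replace q' with (D * D * q')%Z at 1 by (rewrite DD; ring). unfold D; ring. }
  assert (Hxy : Z.abs (x * y' - x' * y) = 1%Z).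
  { rewrite <- Hpq. replace (p * q' - q * p')%Z with (D * (x * y' - x' * y))%Z.
    - rewrite Z.abs_mul. destruct HD as [-> | ->]; simpl Z.abs; lia.
    - rewrite Ep, Eq, Ep', Eq'. unfold D; ring. }
  clearbody x y x' y' ep et. subst m n p q p' q'.
  set (X := inner z (IZR a) (IZR b) (IZR c) (IZR d)) in *.
  set (U := inner z (IZR a) (IZR b) (IZR a) (IZR b)).
  set (V := inner z (IZR c) (IZR d) (IZR c) (IZR d)).
  assert (E2 : inner z (IZR c) (IZR d) (IZR (ep * a + et * c)) (IZR (ep * b + et * d)) =
     IZR ep * X + IZR et * V).
  { unfold X, V, inner. rewrite !plus_IZR, !mult_IZR. ring. }
  assert (E3 : inner z (IZR (ep * a + et * c)) (IZR (ep * b + et * d)) (IZR a) (IZR b) =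
     IZR ep * U + IZR et * X).
  { unfold X, U, inner. rewrite !plus_IZR, !mult_IZR. ring. }
  rewrite E2 in T2. rewrite E3 in T3.
  replace ((a * (ep * b + et * d) - b * (ep * a + et * c)) *
           (c * (ep * b + et * d) - d * (ep * a + et * c)))%Z with (- (ep * et) * (D * D))%Z in T1
    by (unfold D; ring).
  replace ((c * b - d * a) * ((ep * a + et * c) * b - (ep * b + et * d) * a))%Z
    with (et * (D * D))%Z in T2 by (unfold D; ring).
  replace (((ep * a + et * c) * d - (ep * b + et * d) * c) * D)%Z
    with (ep * (D * D))%Z in T3 by (unfold D; ring).
  rewrite DD, Z.mul_1_r in T1, T2, T3.
  assert (Hk : ((ep * et = 1) \/ (ep * et = -1))%Z) by (destruct Hep, Het; subst; lia).
  (* With [k = ep * et] the Selling parameters of the form are U + k X, V + k X and - k X; these are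
     the positive quantities in [T3], [T2] and [T1]. *)
  assert (S := selling_nonzero x y x' y' (ep * et)
     ((IZR ep * U + IZR et * X) * IZR ep) ((IZR ep * X + IZR et * V) * IZR et)
     (X * IZR (- (ep * et))) Hxy Hk T3 T2 T1).
  intros E; apply S; rewrite <- E.
  assert (IZR ep * IZR ep = 1) by (destruct Hep; subst; simpl; ring).
  assert (IZR et * IZR et = 1) by (destruct Het; subst; simpl; ring).
  unfold U, V, X, inner.
  destruct Hep, Het; subst ep et;
      rewrite ?plus_IZR, ?mult_IZR, ?minus_IZR, ?opp_IZR, ?plus_IZR, ?mult_IZR; simpl;
          rewrite ?mult_IZR; ring.
Qed.

(** * Edges and fans *)

Lemma unimodular_gcd (a b c d : Z) :
  unimodular a b c d -> Z.gcd a b = 1%Z /\ Z.gcd c d = 1%Z.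
Proof.
  unfold unimodular, det; intros H.
  assert (G : forall x y u v, Z.abs (x * u - y * v) = 1%Z -> Z.gcd x y = 1%Z).
  { intros x y u v E.
    apply Z.divide_1_r_nonneg; [apply Z.gcd_nonneg|].
    destruct (Z.gcd_divide_l x y) as [p Hp]. destruct (Z.gcd_divide_r x y) as [q Hq].
    set (g := Z.gcd x y) in *.
    assert (Z.divide g (x * u - y * v)).
    { exists (p * u - q * v)%Z. rewrite Hp, Hq at 1. ring. }
    apply Z.divide_abs_r in H0. rewrite E in H0. exact H0. }
  split; [eapply G; exact H|].
  apply (G c d b a). rewrite <- H, <- Z.abs_opp. f_equal. ring.
Qed.

Lemma unimodular_neighbours (a b c d : Z) :
  unimodular a b c d -> farey_neighbours (frac a b) (frac c d).
Proof.
  intros H. destruct (unimodular_gcd a b c d H).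
  exists a, b, c, d. repeat split; auto.
Qed.

Lemma frac_opp (a b : Z) : frac (- a) (- b) = frac a b.
Proof.
  unfold frac. destruct (Z.eq_dec (- b) 0), (Z.eq_dec b 0); try lia; auto.
  f_equal. rewrite !opp_IZR. field. apply not_0_IZR; auto.
Qed.

Lemma frac_inj (a b c d : Z) : Z.gcd a b = 1%Z -> Z.gcd c d = 1%Z ->
  frac a b = frac c d -> (c = a /\ d = b \/ c = - a /\ d = - b)%Z.
Proof.
  intros G1 G2. unfold frac.
  destruct (Z.eq_dec b 0) as [Hb|Hb]; destruct (Z.eq_dec d 0) as [Hd|Hd]; try discriminate.
  - subst. rewrite Z.gcd_0_r in G1, G2. lia.
  - intros E; injection E as E.
    assert (Hd' := not_0_IZR d Hd). assert (Hb' := not_0_IZR b Hb).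
    assert (IZR a * IZR d = IZR b * IZR c).
    { replace (IZR a) with (IZR a / IZR b * IZR b) by (field; auto).
      rewrite E. field; auto. }
    rewrite <- !mult_IZR in H. apply eq_IZR in H.
    assert (D1 : Z.divide b d).
    { apply Z.gauss with a; [exists c; lia|]. rewrite Z.gcd_comm; auto. }
    assert (D2 : Z.divide d b).
    { apply Z.gauss with c; [exists a; lia|]. rewrite Z.gcd_comm; auto. }
    assert (d = b \/ d = - b)%Z.
    { apply Z.divide_antisym; auto. }
    destruct H0; subst d; [left|right]; split; auto; nia.
Qed.

Lemma one_minus_iz_nz (z : C) : 0 <= Im z -> (1 - Ci * z)%C <> 0.
Proof.
  intros H E. apply (f_equal Re) in E. destruct z; simpl in *. lra.
Qed.

Lemma B_inj (z w : C) : 0 <= Im z -> 0 <= Im w -> B z = B w -> z = w.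
Proof.
  intros Hz Hw E.
  assert (Nz := one_minus_iz_nz z Hz). assert (Nw := one_minus_iz_nz w Hw).
  unfold B in E.
  assert (E' : ((1 + Ci * z) * (1 - Ci * w) = (1 + Ci * w) * (1 - Ci * z))%C).
  { replace (1 + Ci * z)%C with ((1 + Ci * z) / (1 - Ci * z) * (1 - Ci * z))%C by (field; auto).
    rewrite E. field; auto. }
  destruct z as [x y], w as [x' y'].
  unfold Cmult, Cplus, Cminus, Copp, Ci, RtoC in E'; simpl in E'.
  injection E' as E1 E2. apply C_eq; simpl; lra.
Qed.

Lemma B_neq_minus_one (z : C) : 0 <= Im z -> B z <> (- (1))%C.
Proof.
  intros Hz E. assert (Nz := one_minus_iz_nz z Hz).
  assert (E' : (1 + Ci * z = (- (1)) * (1 - Ci * z))%C).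
  { rewrite <- E. unfold B. field; auto. }
  apply (f_equal Re) in E'. destruct z; simpl in *. lra.
Qed.

Lemma B_ideal_inj (x y : ideal) : B_ideal x = B_ideal y -> x = y.
Proof.
  destruct x as [x|], y as [y|]; simpl; intros E; auto.
  - apply B_inj in E; simpl; try lra. injection E as ->; auto.
  - apply B_neq_minus_one in E; simpl; [tauto|lra].
  - symmetry in E. apply B_neq_minus_one in E; simpl; [tauto|lra].
Qed.

Definition edge_set (x y : ideal) : C -> Prop :=
  fun z => exists w : C, geodesic x y w /\ z = B w.

Definition edge (a b c d : Z) (H : unimodular a b c d) : farey :=
  exist _ (edge_set (frac a b) (frac c d))
    (ex_intro _ _ (ex_intro _ _ (ex_intro _ _ (ex_intro _ _
      (conj (unimodular_neighbours a b c d H)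
        (conj eq_refl (conj eq_refl (fun z => iff_refl _)))))))).

Lemma farey_eq (e f : farey) : (forall z, proj1_sig e z <-> proj1_sig f z) -> e = f.
Proof.
  destruct e as [E HE], f as [F HF]; simpl; intros H.
  assert (E = F) by (apply functional_extensionality; intros z;
      apply propositional_extensionality, H).
  subst F. f_equal. apply proof_irrelevance.
Qed.

Lemma edge_joins (a b c d : Z) (H : unimodular a b c d) :
  joins (edge a b c d H) (B_ideal (frac a b)) (B_ideal (frac c d)).
Proof.
  exists (frac a b), (frac c d). split; [apply unimodular_neighbours, H|].
  split; [reflexivity|]. split; [reflexivity|]. intros z; reflexivity.
Qed.

Lemma joins_inv (e : farey) (p q : C) : joins e p q ->
  exists a b c d (H : unimodular a b c d),
    p = B_ideal (frac a b) /\ q = B_ideal (frac c d) /\ e = edge a b c d H.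
Proof.
  intros (x & y & (a & b & c & d & G1 & G2 & -> & -> & D) & -> & -> & HE).
  exists a, b, c, d, D. split; auto. split; auto.
  apply farey_eq. exact HE.
Qed.

Lemma side_sym (x y : ideal) (z : C) : side x y z = side y x z.
Proof.
  destruct x, y; simpl; auto. rewrite Rplus_comm. f_equal. field.
Qed.

Lemma geodesic_sym (x y : ideal) (z : C) : geodesic x y z <-> geodesic y x z.
Proof.
  unfold geodesic. rewrite side_sym. intuition auto.
Qed.

Lemma edge_eq (a b c d a' b' c' d' : Z) H H' :
  frac a b = frac a' b' -> frac c d = frac c' d' ->
  edge a b c d H = edge a' b' c' d' H'.
Proof.
  intros E1 E2. apply farey_eq. intros z. simpl. rewrite E1, E2. reflexivity.
Qed.

Lemma edge_swap (a b c d : Z) H H' : edge a b c d H = edge c d a b H'.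
Proof.
  apply farey_eq. intros z. simpl. unfold edge_set.
  split; intros (w & Hw & ->); exists w; split; auto; apply geodesic_sym; auto.
Qed.

(** A total function of four integers, with default value 0 off the edges: bounds and symmetries
    then hold without side conditions, and the Euclidean series need not carry proofs of
    unimodularity. *)
Definition edge_value (s : farey -> R) (a b c d : Z) : R :=
  match Z.eq_dec (Z.abs (det a b c d)) 1 with
  | left H => s (edge a b c d H)
  | right _ => 0
  end.

Lemma edge_value_edge (s : farey -> R) (a b c d : Z) H :
  edge_value s a b c d = s (edge a b c d H).
Proof.
  unfold edge_value. destruct Z.eq_dec; [|tauto]. f_equal. apply edge_eq; auto.
Qed.

Lemma edge_value_swap (s : farey -> R) (a b c d : Z) :
  edge_value s a b c d = edge_value s c d a b.
Proof.
  unfold edge_value, det. destruct Z.eq_dec, Z.eq_dec; try lia; auto.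
  f_equal. apply edge_swap.
Qed.

Lemma edge_value_opp_l (s : farey -> R) (a b c d : Z) :
  edge_value s (- a) (- b) c d = edge_value s a b c d.
Proof.
  unfold edge_value, det. destruct Z.eq_dec, Z.eq_dec; try lia; auto.
  f_equal. apply edge_eq; auto. apply frac_opp.
Qed.

Lemma edge_value_opp_r (s : farey -> R) (a b c d : Z) :
  edge_value s a b (- c) (- d) = edge_value s a b c d.
Proof.
  rewrite edge_value_swap, edge_value_opp_l. apply edge_value_swap.
Qed.

Lemma complementary_triangle_frac (a b c d m n : Z) :
  unimodular a b c d -> unimodular c d m n -> unimodular m n a b ->
  complementary_triangle (B_ideal (frac a b)) (B_ideal (frac c d)) (B_ideal (frac m n)).
Proof.
  intros H1 H2 H3. exists (frac a b), (frac c d), (frac m n).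
  do 3 (split; [reflexivity|]). do 3 (split; [apply unimodular_neighbours; auto|]).
  intros [E HE] z Hz Hzz. simpl in Hzz.
  destruct HE as (p & q & x & y & (u1 & u2 & v1 & v2 & _ & _ & -> & -> & D) & _ & _ & HE).
  apply HE in Hzz. destruct Hzz as (w & Hw & Ezw).
  assert (z = w).
  { apply B_inj; auto. apply Rlt_le, Hz. apply Rlt_le, Hw. }
  subst w. apply geodesic_frac in Hw; auto.
  apply (no_edge_through_triangle a b c d m n u1 u2 v1 v2 z); auto. tauto.
Qed.

Lemma complementary_triangle_sides (p q r : C) : complementary_triangle p q r ->
  exists x y t, p = B_ideal x /\ q = B_ideal y /\ r = B_ideal t /\
    farey_neighbours x y /\ farey_neighbours y t /\ farey_neighbours t x.
Proof.
  intros (x & y & t & H). exists x, y, t. tauto.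
Qed.

Lemma neighbours_frac (a b : Z) (y : ideal) : Z.gcd a b = 1%Z ->
  farey_neighbours (frac a b) y -> exists c d, unimodular a b c d /\ y = frac c d.
Proof.
  intros G (a' & b' & c & d & G1 & G2 & E & -> & D).
  exists c, d. split; auto. apply frac_inj in E; auto.
  unfold unimodular, det. destruct E as [[-> ->]|[-> ->]]; rewrite <- D; auto.
  rewrite <- Z.abs_opp. f_equal. ring.
Qed.

Lemma neighbours_frac_frac (a b c d : Z) : Z.gcd a b = 1%Z -> Z.gcd c d = 1%Z ->
  farey_neighbours (frac a b) (frac c d) -> unimodular a b c d.
Proof.
  intros G G' H. destruct (neighbours_frac a b _ G H) as (c' & d' & H' & E).
  apply frac_inj in E; auto; [|eapply unimodular_gcd; eauto].
  unfold unimodular, det in *. destruct E as [[-> ->]|[-> ->]]; auto. lia.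
Qed.

(* The point is the image of [l i] under the Moebius map with columns (a, b) and (c, d). *)
Lemma geodesic_point (a b c d : Z) (l : R) : unimodular a b c d -> 0 < l ->
  exists z, 0 < Im z /\ inner z (IZR a) (IZR b) (IZR c) (IZR d) = 0 /\
    0 < inner z (IZR a) (IZR b) (IZR a) (IZR b) /\
    inner z (IZR c) (IZR d) (IZR c) (IZR d) = l ^ 2 * inner z (IZR a) (IZR b) (IZR a) (IZR b).
Proof.
  intros H Hl.
  assert (N : 0 < l ^ 2 * IZR b ^ 2 + IZR d ^ 2).
  { unfold unimodular, det in H.
    destruct (Z.eq_dec b 0) as [->|Hb].
    - assert (d <> 0%Z) by (intros ->; lia). apply not_0_IZR in H0.
      assert (0 < IZR d ^ 2) by (apply pow2_gt_0; auto). lra.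
    - apply not_0_IZR in Hb.
      assert (0 < IZR b ^ 2) by (apply pow2_gt_0; auto).
      assert (0 < l ^ 2) by (apply pow_lt; auto).
      assert (0 < l ^ 2 * IZR b ^ 2) by (apply Rmult_lt_0_compat; auto).
      assert (0 <= IZR d ^ 2) by apply pow2_ge_0. lra. }
  assert (E : (IZR a * IZR d - IZR b * IZR c) ^ 2 = 1).
  { rewrite <- !mult_IZR, <- minus_IZR. unfold unimodular, det in H.
    assert (K : (a * d - b * c = 1 \/ a * d - b * c = -1)%Z) by lia.
    destruct K as [-> | ->]; simpl; ring. }
  set (A := IZR a) in *; set (B := IZR b) in *; set (C' := IZR c) in *; set (D := IZR d) in *.
  set (S := l ^ 2 * B ^ 2 + D ^ 2) in *.
  exists ((l ^ 2 * A * B + C' * D) / S, l / S).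
  assert (EU : inner ((l ^ 2 * A * B + C' * D) / S, l / S) A B A B = / S).
  { transitivity ((D ^ 2 * (A * D - B * C') ^ 2 + l ^ 2 * B ^ 2) / S ^ 2).
    - unfold inner; simpl; unfold S in *; field; lra.
    - rewrite E. unfold S in *; field; lra. }
  assert (EV : inner ((l ^ 2 * A * B + C' * D) / S, l / S) C' D C' D = l ^ 2 * / S).
  { transitivity (l ^ 2 * (l ^ 2 * B ^ 2 * (A * D - B * C') ^ 2 + D ^ 2) / S ^ 2).
    - unfold inner; simpl; unfold S in *; field; lra.
    - rewrite E. unfold S in *; field; lra. }
  assert (EX : inner ((l ^ 2 * A * B + C' * D) / S, l / S) A B C' D = 0).
  { transitivity ((1 - (A * D - B * C') ^ 2) * (l ^ 2 * B * D) / S ^ 2).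
    - unfold inner; simpl; unfold S in *; field; lra.
    - rewrite E. unfold Rdiv; ring. }
  split; [simpl; apply Rdiv_lt_0_compat; auto|]. split; [exact EX|].
  rewrite EU, EV. split; auto. apply Rinv_0_lt_compat; auto.
Qed.

(** In the basis given by the first edge, and on that edge, the equation of the second edge reads x
    x' U + y y' V = 0, where U and V are the values of the form at the basis vectors. The points
    with V = U and V = 4 U force x x' = y y' = 0. *)
Lemma edge_endpoints (a b c d a' b' c' d' : Z) H H' :
  edge a b c d H = edge a' b' c' d' H' ->
  frac a b = frac a' b' /\ frac c d = frac c' d' \/
  frac a b = frac c' d' /\ frac c d = frac a' b'.
Proof.
  intros E.
  assert (T : forall z, 0 < Im z -> inner z (IZR a) (IZR b) (IZR c) (IZR d) = 0 ->
     inner z (IZR a') (IZR b') (IZR c') (IZR d') = 0).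
  { intros z Hz I.
    assert (K : proj1_sig (edge a b c d H) (B z)).
    { exists z; split; auto. apply geodesic_frac; auto. }
    rewrite E in K. destruct K as (w & Hw & Ezw).
    apply B_inj in Ezw; [|apply Rlt_le, Hz|apply Rlt_le, Hw]. subst w.
    apply geodesic_frac in Hw; tauto. }
  destruct (geodesic_point a b c d 1 H) as (z1 & P1 & P2 & P3 & P4); [lra|].
  destruct (geodesic_point a b c d 2 H) as (z2 & Q1 & Q2 & Q3 & Q4); [lra|].
  assert (T1 := T z1 P1 P2). assert (T2 := T z2 Q1 Q2).
  clear E T. pose proof H as H0. pose proof H' as H0'.
  unfold unimodular, det in H, H'.
  set (D := (a * d - b * c)%Z) in *.
  assert (DD : (D * D = 1)%Z).
  { assert (K : (D = 1 \/ D = -1)%Z) by lia. destruct K as [-> | ->]; reflexivity. }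
  set (x := (D * (a' * d - b' * c))%Z). set (y := (D * (a * b' - b * a'))%Z).
  set (x' := (D * (c' * d - d' * c))%Z). set (y' := (D * (a * d' - b * c'))%Z).
  assert (Ea : a' = (x * a + y * c)%Z).
  { unfold x, y. replace a' with (D * D * a')%Z at 1 by (rewrite DD; ring). unfold D; ring. }
  assert (Eb : b' = (x * b + y * d)%Z).
  { unfold x, y. replace b' with (D * D * b')%Z at 1 by (rewrite DD; ring). unfold D; ring. }
  assert (Ec : c' = (x' * a + y' * c)%Z).
  { unfold x', y'. replace c' with (D * D * c')%Z at 1 by (rewrite DD; ring). unfold D; ring. }
  assert (Ed : d' = (x' * b + y' * d)%Z).
  { unfold x', y'. replace d' with (D * D * d')%Z at 1 by (rewrite DD; ring). unfold D; ring. }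
  assert (Hx : Z.abs (x * y' - x' * y) = 1%Z).
  { rewrite <- H'. replace (a' * d' - b' * c')%Z with (D * (x * y' - x' * y))%Z.
    - rewrite Z.abs_mul, H. lia.
    - rewrite Ea, Eb, Ec, Ed. unfold D; ring. }
  clearbody x y x' y'.
  assert (X : forall z, inner z (IZR a) (IZR b) (IZR c) (IZR d) = 0 ->
     inner z (IZR a') (IZR b') (IZR c') (IZR d') =
     IZR (x * x') * inner z (IZR a) (IZR b) (IZR a) (IZR b) +
     IZR (y * y') * inner z (IZR c) (IZR d) (IZR c) (IZR d)).
  { intros z I.
    transitivity (IZR (x * x') * inner z (IZR a) (IZR b) (IZR a) (IZR b) +
     IZR (y * y') * inner z (IZR c) (IZR d) (IZR c) (IZR d) +
     (IZR x * IZR y' + IZR x' * IZR y) * inner z (IZR a) (IZR b) (IZR c) (IZR d)).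
    - rewrite Ea, Eb, Ec, Ed, !plus_IZR, !mult_IZR. unfold inner. ring.
    - rewrite I. ring. }
  rewrite X, P4 in T1 by auto. rewrite X, Q4 in T2 by auto.
  assert (R1 : IZR (x * x') + IZR (y * y') = 0).
  { apply Rmult_eq_reg_r with (inner z1 (IZR a) (IZR b) (IZR a) (IZR b)); lra. }
  assert (R2 : IZR (x * x') + 4 * IZR (y * y') = 0).
  { apply Rmult_eq_reg_r with (inner z2 (IZR a) (IZR b) (IZR a) (IZR b)); lra. }
  assert (S1 : (x * x' = 0)%Z) by (apply eq_IZR; lra).
  assert (S2 : (y * y' = 0)%Z) by (apply eq_IZR; lra).
  apply Z.mul_eq_0 in S1, S2.
  assert (F : forall k m n m' n' : Z, Z.abs k = 1%Z -> m' = (k * m)%Z -> n' = (k * n)%Z ->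
     frac m n = frac m' n').
  { intros k m n m' n' K -> ->.
    assert (K' : (k = 1 \/ k = -1)%Z) by lia.
    destruct K' as [-> | ->]; [f_equal; ring|].
    rewrite <- frac_opp. f_equal; ring. }
  assert (M : forall m n, Z.abs (m * n) = 1%Z -> Z.abs m = 1%Z /\ Z.abs n = 1%Z).
  { intros m n K. rewrite Z.abs_mul in K. apply Z.eq_mul_1_nonneg; [apply Z.abs_nonneg|exact K]. }
  destruct S1 as [-> | ->], S2 as [-> | ->]; try lia.
  - right. destruct (M x' y) as (M1 & M2); [lia|]. split; [apply (F x') | apply (F y)]; lia.
  - left. destruct (M x y') as (M1 & M2); [lia|]. split; [apply (F x) | apply (F y')]; lia.
Qed.

(** * Enumerations of a fan *)

Definition fan_unimodular (a b c d : Z) (H : det a b c d = 1%Z) (n : Z) :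
  unimodular a b (n * a + c) (n * b + d).
Proof. unfold unimodular, det in *.
rewrite <- H, <- (Z.abs_eq (a * d - b * c)); [f_equal; ring|lia]. Defined.

Definition fan_edge (a b c d : Z) (H : det a b c d = 1%Z) (n : Z) : farey :=
  edge a b (n * a + c) (n * b + d) (fan_unimodular a b c d H n).

Lemma fan_edge_inj (a b c d : Z) (H : det a b c d = 1%Z) (m n : Z) :
  fan_edge a b c d H m = fan_edge a b c d H n -> m = n.
Proof.
  intros E.
  assert (U := fan_unimodular a b c d H m). assert (U' := fan_unimodular a b c d H n).
  apply edge_endpoints in E. destruct E as [[_ E]|[E _]].
  - apply frac_inj in E; [|eapply unimodular_gcd; eauto|eapply unimodular_gcd; eauto].
    unfold unimodular, det in *. destruct E as [[E1 E2]|[E1 E2]].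
    + assert (((n - m) * a = 0)%Z /\ ((n - m) * b = 0)%Z) by lia.
      destruct H0 as (A1 & A2). apply Z.mul_eq_0 in A1, A2.
      destruct A1; [lia|]. destruct A2; [lia|]. subst; lia.
    + exfalso.
      assert (a * (n * b + d) - b * (n * a + c) = - (a * (m * b + d) - b * (m * a + c)))%Z
          by (rewrite E1, E2; ring).
      lia.
  - apply frac_neq in U'. tauto.
Qed.

Lemma fan_member (a b c d c' d' : Z) (H : det a b c d = 1%Z) (H' : unimodular a b c' d') :
  exists n, frac c' d' = frac (n * a + c) (n * b + d).
Proof.
  unfold unimodular in H'. unfold det in *.
  assert (K : (a * d' - b * c' = 1 \/ a * d' - b * c' = -1)%Z) by lia.
  destruct K as [K|K].
  - exists (c' * d - d' * c)%Z. f_equal.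
    + replace ((c' * d - d' * c) * a + c)%Z
          with (c' * (a * d - b * c) - c * (a * d' - b * c') + c)%Z by ring.
      rewrite H, K. ring.
    + replace ((c' * d - d' * c) * b + d)%Z
          with (d' * (a * d - b * c) - d * (a * d' - b * c') + d)%Z by ring.
      rewrite H, K. ring.
  - exists (d' * c - c' * d)%Z. rewrite <- (frac_opp c' d'). f_equal.
    + replace ((d' * c - c' * d) * a + c)%Z
          with (- (c' * (a * d - b * c)) + c * (a * d' - b * c') + c)%Z by ring.
      rewrite H, K. ring.
    + replace ((d' * c - c' * d) * b + d)%Z
          with (- (d' * (a * d - b * c)) + d * (a * d' - b * c') + d)%Z by ring.
      rewrite H, K. ring.
Qed.

Lemma in_fan_inv (a b c d : Z) (H : det a b c d = 1%Z) (e : farey) (q : C) :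
  joins e (B_ideal (frac a b)) q ->
  exists n, e = fan_edge a b c d H n /\ q = B_ideal (frac (n * a + c) (n * b + d)).
Proof.
  intros J. destruct (joins_inv _ _ _ J) as (a' & b' & c' & d' & H' & E1 & -> & ->).
  apply B_ideal_inj in E1. destruct (unimodular_gcd _ _ _ _ H') as (G & G').
  destruct (neighbours_frac a b (frac c' d')) as (c'' & d'' & U & E).
  - apply (unimodular_gcd a b c d). unfold unimodular. rewrite H; reflexivity.
  - rewrite E1. apply unimodular_neighbours; auto.
  - destruct (fan_member a b c d c'' d'' H U) as (n & En). exists n.
    split; [|congruence]. apply edge_eq; congruence.
Qed.

Lemma fan_edge_enumeration (a b c d : Z) (H : det a b c d = 1%Z) :
  fan_enumeration (B_ideal (frac a b)) (fan_edge a b c d H).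
Proof.
  split; [|split; [|split]].
  - intros n. eexists. apply edge_joins.
  - intros f (q & J). destruct (in_fan_inv a b c d H f q J) as (n & -> & _). exists n; auto.
  - intros m n. apply fan_edge_inj.
  - intros n. split.
    + intros E. apply fan_edge_inj in E. lia.
    + exists (B_ideal (frac a b)). do 2 eexists. split; [|split; apply edge_joins].
      unfold det in H.
      apply complementary_triangle_frac; unfold unimodular, det.
      * replace (a * _ - _)%Z with (a * d - b * c)%Z by ring. rewrite H; auto.
      * replace ((n * a + c) * _ - _)%Z with (- (a * d - b * c))%Z by ring. rewrite H; auto.
      * replace (_ * b - _)%Z with (- (a * d - b * c))%Z by ring. rewrite H; auto.
Qed.

Lemma vertex_basis (p : C) : farey_vertex p ->
  exists a b c d, det a b c d = 1%Z /\ p = B_ideal (frac a b).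
Proof.
  intros (e & q & J). destruct (joins_inv _ _ _ J) as (a & b & c & d & H & -> & _).
  unfold unimodular, det in *.
  destruct (Z.eq_dec (a * d - b * c) 1) as [K|K].
  - exists a, b, c, d; auto.
  - exists a, b, (- c)%Z, (- d)%Z. split; auto. lia.
Qed.

Lemma basis_vertex (a b c d : Z) : det a b c d = 1%Z -> farey_vertex (B_ideal (frac a b)).
Proof.
  intros H. exists (fan_edge a b c d H 0). eexists. apply edge_joins.
Qed.

(** Injectivity excludes [g (n + 1 + 1) = g n], so consecutive unit steps have the same sign. *)
Lemma Z_unit_steps (g : Z -> Z) : (forall m n, g m = g n -> m = n) ->
  (forall n, Z.abs (g (n + 1) - g n) = 1)%Z ->
  exists k, (k = 1 \/ k = -1)%Z /\ forall n, g n = (g 0 + k * n)%Z.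
Proof.
  intros I S. exists (g 1 - g 0)%Z.
  assert (S0 := S 0%Z). simpl in S0.
  assert (K : forall n, (g (n + 1 + 1) - g (n + 1) = g (n + 1) - g n)%Z).
  { intros n. assert (A := S n). assert (A' := S (n + 1)%Z).
    assert (g (n + 1 + 1) <> g n)%Z by (intros E; apply I in E; lia). lia. }
  split; [lia|].
  assert (T : forall n, (g (n + 1) - g n = g 1 - g 0)%Z).
  { intros n. induction n using Z.peano_ind.
    - reflexivity.
    - rewrite <- IHn. replace (Z.succ n) with (n + 1)%Z by lia. apply K.
    - rewrite <- IHn. symmetry.
      replace n with (Z.pred n + 1)%Z at 1 2 by lia. apply K. }
  intros n. induction n using Z.peano_ind.
  - lia.
  - assert (A := T n). replace (Z.succ n) with (n + 1)%Z by lia. lia.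
  - assert (A := T (Z.pred n)). replace (Z.pred n + 1)%Z with n in A by lia. lia.
Qed.

(** Adjacency makes the far endpoints of consecutive edges Farey neighbours, and the determinant of
    two fan vectors is, up to sign, the difference of their indices. Hence an enumeration is unique
    up to shift and reversal. *)
Lemma fan_enumeration_inv (p : C) (e : Z -> farey) : farey_vertex p -> fan_enumeration p e ->
  exists a b c d (H : det a b c d = 1%Z) k n0, (k = 1 \/ k = -1)%Z /\
    forall n, e n = fan_edge a b c d H (n0 + k * n).
Proof.
  intros V (E1 & E2 & E3 & E4).
  destruct (vertex_basis p V) as (a & b & c & d & H & ->).
  exists a, b, c, d, H.
  assert (X : forall n, exists g, e n = fan_edge a b c d H g).
  { intros n. destruct (E1 n) as (q & J).
    destruct (in_fan_inv a b c d H _ _ J) as (g & Hg & _). exists g; auto. }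
  set (g := fun n => proj1_sig (constructive_indefinite_description _ (X n))).
  assert (Hg : forall n, e n = fan_edge a b c d H (g n)).
  { intros n. apply (proj2_sig (constructive_indefinite_description _ (X n))). }
  destruct (Z_unit_steps g) as (k & Hk & K).
  - intros m n E. apply E3. rewrite !Hg, E. reflexivity.
  - intros n. destruct (E4 n) as (_ & p & q & r & T & J1 & J2).
    destruct (complementary_triangle_sides _ _ _ T) as (x & y & t & -> & -> & -> & N1 & N2 & N3).
    assert (U := fan_unimodular a b c d H (g n)).
    assert (U' := fan_unimodular a b c d H (g (n + 1)%Z)).
    destruct (joins_inv _ _ _ J1) as (a1 & b1 & c1 & d1 & V1 & F1 & F2 & F3).
    destruct (joins_inv _ _ _ J2) as (a2 & b2 & c2 & d2 & V2 & F4 & F5 & F6).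
    apply B_ideal_inj in F1, F2, F4, F5. subst x y t.
    rewrite Hg in F3, F6.
    apply edge_endpoints in F3. apply edge_endpoints in F6.
    assert (NE : frac (g n * a + c) (g n * b + d) <> frac (g (n + 1)%Z * a + c) (g (n +
        1)%Z * b + d)).
    { intros EQ. assert (n = n + 1)%Z; [|lia]. apply E3. rewrite !Hg. apply edge_eq; auto. }
    apply frac_neq in U as W. apply frac_neq in U' as W'.
    assert (Y : frac c1 d1 = frac (g n * a + c) (g n * b + d) /\
                frac c2 d2 = frac (g (n + 1)%Z * a + c) (g (n + 1)%Z * b + d)).
    { destruct F3 as [[? ?]|[? ?]], F6 as [[? ?]|[? ?]]; split; congruence. }
    destruct Y as (Y1 & Y2). rewrite Y1, Y2 in N2.
    apply neighbours_frac_frac in N2; [|eapply unimodular_gcd; eauto|eapply unimodular_gcd;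
        eauto].
    unfold unimodular, det in N2, H.
    replace (_ - _)%Z with ((g n - g (n + 1)) * (a * d - b * c))%Z in N2 by ring.
    rewrite H in N2. lia.
  - exists k, (g 0%Z). split; auto. intros n. rewrite Hg, K. reflexivity.
Qed.

(** * Fan averages and summation by parts *)

Definition average (A : Z -> R) (m : Z) (k : nat) : R :=
  A m +
  sum_n_m (fun j : nat =>
             (INR k + 1 - INR j) / (INR k + 1) *
             (A (m + Z.of_nat j)%Z + A (m - Z.of_nat j)%Z))
          1 k.

(** The weights are symmetric about the centre, so the average does not see the direction in which a
    fan is enumerated. *)
Lemma average_ext (A A' : Z -> R) (m m' k' : Z) (k : nat) : (k' = 1 \/ k' = -1)%Z ->
  (forall n, A (m + n)%Z = A' (m' + k' * n)%Z) -> average A m k = average A' m' k.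
Proof.
  intros Hk E. unfold average. f_equal.
  - rewrite <- (Z.add_0_r m), E. f_equal; lia.
  - apply sum_n_m_ext. intros j. f_equal. unfold Z.sub. rewrite !E.
    destruct Hk as [-> | ->].
    + f_equal; f_equal; lia.
    + rewrite Rplus_comm. f_equal; f_equal; lia.
Qed.

(** The weights are those of a Fejer mean: [(INR k + 1) * average A m k] is the sum, over all radii
    from 0 to k, of unweighted symmetric sums, and each of these telescopes. In the applications [L]
    is the value of F at the common vector of the fan. *)
Lemma average_second_difference (A G : Z -> R) (L : R) (m : Z) (k : nat) :
  (forall n, A n = G (n + 1)%Z + G (n - 1)%Z - 2 * G n - 2 * L) ->
  (INR k + 1) * average A m k =
  G (m + Z.of_nat k + 1)%Z + G (m - Z.of_nat k - 1)%Z - 2 * G m - 2 * L * (INR k + 1) ^ 2.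
Proof.
  intros E.
  assert (U : forall k : nat, A m + sum_n_m (fun j : nat => A (m + Z.of_nat j)%Z +
      A (m - Z.of_nat j)%Z) 1 k =
     G (m + Z.of_nat k + 1)%Z - G (m +
         Z.of_nat k)%Z - (G (m - Z.of_nat k)%Z - G (m - Z.of_nat k - 1)%Z)
      - 2 * (2 * INR k + 1) * L).
  { clear k. induction k as [|k IH].
    - rewrite sum_n_m_zero by auto. unfold zero; simpl. rewrite E, Z.add_0_r, Z.sub_0_r. ring.
    - rewrite sum_n_Sm by auto with arith. change (@plus R_AbelianMonoid) with Rplus.
      rewrite <- Rplus_assoc. change (A m + ?x + ?y) with ((A m + x) + y). rewrite IH.
      rewrite !E, S_INR, Nat2Z.inj_succ.
      replace (m + Z.succ (Z.of_nat k) - 1)%Z with (m + Z.of_nat k)%Z by lia.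
      replace (m - Z.succ (Z.of_nat k) + 1)%Z with (m - Z.of_nat k)%Z by lia.
      replace (m + Z.succ (Z.of_nat k))%Z with (m + Z.of_nat k + 1)%Z by lia.
      replace (m - Z.succ (Z.of_nat k))%Z with (m - Z.of_nat k - 1)%Z by lia.
      ring. }
  assert (W : forall k : nat, (INR k + 1) * average A m k = (INR k + 1) * A m +
     sum_n_m (fun j : nat => (INR k + 1 - INR j) * (A (m + Z.of_nat j)%Z +
         A (m - Z.of_nat j)%Z)) 1 k).
  { intros k'. unfold average. rewrite Rmult_plus_distr_l. f_equal.
    rewrite <- (sum_n_m_mult_l (K := R_Ring)). apply sum_n_m_ext. intros j. unfold mult; simpl.
    field. assert (0 <= INR k') by apply pos_INR. lra. }
  rewrite W. clear W.
  induction k as [|k IH].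
  - rewrite sum_n_m_zero by auto. unfold zero; simpl. rewrite E, Z.add_0_r, Z.sub_0_r. ring.
  - rewrite sum_n_Sm by auto with arith. change (@plus R_AbelianMonoid) with Rplus.
    (* Raising the radius by one raises every weight by one, so exactly one unweighted sum is
       added. *)
    rewrite (sum_n_m_ext_loc _ (fun j : nat =>
      plus ((INR k + 1 - INR j) * (A (m + Z.of_nat j)%Z + A (m - Z.of_nat j)%Z))
           (A (m + Z.of_nat j)%Z + A (m - Z.of_nat j)%Z))).
    2: { intros j _. rewrite S_INR. unfold plus; simpl. ring. }
    rewrite sum_n_m_plus. change (@plus R_AbelianMonoid) with Rplus.
    assert (U1 := U k). assert (U2 := U (S k)).
    rewrite sum_n_Sm in U2 by auto with arith. change (@plus R_AbelianMonoid) with Rplus in U2.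
    rewrite S_INR in *. rewrite Nat2Z.inj_succ in *.
    replace (m + Z.succ (Z.of_nat k))%Z with (m + Z.of_nat k + 1)%Z in * by lia.
    replace (m - Z.succ (Z.of_nat k))%Z with (m - Z.of_nat k - 1)%Z in * by lia.
    set (P := sum_n_m _ 1 k) in IH |- *.
    set (Q := sum_n_m (fun j : nat => A (m + Z.of_nat j)%Z + A (m - Z.of_nat j)%Z) 1 k) in *.
    change (AbelianMonoid.sort R_AbelianMonoid) with R in *. lra.
Qed.

(** * Second differences and chords *)

(** The deviation from the chord multiplied by [r - p]; up to sign it is the determinant with rows
    (1, x, g x) for x = p, q, r. In this form it needs no division and is meaningful for any order
    of the points. *)
Definition chord_dev (g : R -> R) (p q r : R) : R :=
  g q * (r - p) - g p * (r - q) - g r * (q - p).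

Definition second_diff (g : R -> R) (x t : R) : R := g (x + t) + g (x - t) - 2 * g x.

Lemma Rabs_le_iff (x b : R) : Rabs x <= b <-> - b <= x <= b.
Proof. split; [apply Rabs_le_between|apply Rabs_le]. Qed.

(* At a point where the deviation from the chord is nearly maximal, the second
   difference that reaches one endpoint of the chord bounds the maximum.  The set D
   is used for the real line and for the integers. *)
Lemma chord_dev_bound (D : R -> Prop) (g : R -> R) (p r M : R) : p < r -> 0 <= M -> D p -> D r ->
  (forall x, D x -> p <= x <= r -> D (2 * x - p) /\ D (2 * x - r)) ->
  (exists K, forall x, D x -> p <= x <= r -> Rabs (g x) <= K) ->
  (forall x t, D x -> 0 <= t -> p <= x - t -> x + t <= r -> D (x + t) -> D (x - t) ->
     Rabs (second_diff g x t) <= M * t) ->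
  forall q, D q -> p <= q <= r -> Rabs (chord_dev g p q r) <= M / 2 * (r - p) ^ 2.
Proof.
  intros Hpr HM0 Dp Dr Drefl [K HK] HM.
  set (h := fun q => chord_dev g p q r).
  set (S := fun y => exists q, D q /\ p <= q <= r /\ y = Rabs (h q)).
  destruct (completeness S) as (m & Hm1 & Hm2).
  - exists (3 * (K * (r - p))). intros y (q & Dq & Hq & ->).
    assert (A1 := HK q Dq Hq). assert (A2 := HK p Dp ltac:(lra)).
    assert (A3 := HK r Dr ltac:(lra)).
    apply Rabs_le_iff in A1, A2, A3.
    apply Rabs_le_iff. unfold h, chord_dev.
    assert (B1 : - (K * (r - p)) <= g q * (r - p) <= K * (r - p)) by (split; nra).
    assert (B2 : - (K * (r - p)) <= g p * (r - q) <= K * (r - p)) by (split; nra).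
    assert (B3 : - (K * (r - p)) <= g r * (q - p) <= K * (r - p)) by (split; nra).
    lra.
  - exists (Rabs (h p)), p. repeat split; auto; lra.
  - assert (Hm : forall q, D q -> p <= q <= r -> Rabs (h q) <= m).
    { intros q Dq Hq. apply Hm1. exists q; auto. }
    (* [h] vanishes at both endpoints, so reflecting the nearer one in [q] expresses [2 * h q] by
       one value of [h] and one second difference. Working with the supremum [m] avoids any
       continuity of [g]. *)
    assert (Half : m <= (m + M / 2 * (r - p) ^ 2) / 2).
    { apply Hm2. intros y (q & Dq & Hq & ->).
      destruct (Drefl q Dq Hq) as (D1 & D2).
      assert (hp : h p = 0) by (unfold h, chord_dev; ring).
      assert (hr : h r = 0) by (unfold h, chord_dev; ring).
      destruct (Rle_dec q ((p + r) / 2)).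
      - assert (A := HM q (q - p) Dq ltac:(lra) ltac:(lra) ltac:(lra)).
        replace (q + (q - p)) with (2 * q - p) in A by ring.
        replace (q - (q - p)) with p in A by ring.
        specialize (A D1 Dp). assert (B := Hm (2 * q - p) D1 ltac:(lra)).
        apply Rabs_le_iff in A, B. apply Rabs_le_iff.
        assert (E : 2 * h q = h (2 * q - p) - (r - p) * second_diff g q (q - p)).
        { unfold h, chord_dev, second_diff.
          replace (q + (q - p)) with (2 * q - p) by ring. replace (q - (q - p)) with p by ring.
          ring. }
        assert (M * (q - p) <= M * ((r - p) / 2)) by (apply Rmult_le_compat_l; lra).
        assert (- (M / 2 * (r - p) ^ 2) <= (r - p) * second_diff g q (q - p) <=
            M / 2 * (r - p) ^ 2) by (split; nra).
        lra.
      - assert (A := HM q (r - q) Dq ltac:(lra) ltac:(lra) ltac:(lra)).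
        replace (q - (r - q)) with (2 * q - r) in A by ring.
        replace (q + (r - q)) with r in A by ring.
        specialize (A Dr D2). assert (B := Hm (2 * q - r) D2 ltac:(lra)).
        apply Rabs_le_iff in A, B. apply Rabs_le_iff.
        assert (E : 2 * h q = h (2 * q - r) - (r - p) * second_diff g q (r - q)).
        { unfold h, chord_dev, second_diff.
          replace (q - (r - q)) with (2 * q - r) by ring. replace (q + (r - q)) with r by ring.
          ring. }
        assert (M * (r - q) <= M * ((r - p) / 2)) by (apply Rmult_le_compat_l; lra).
        assert (- (M / 2 * (r - p) ^ 2) <= (r - p) * second_diff g q (r - q) <=
            M / 2 * (r - p) ^ 2) by (split; nra).
        lra. }
    intros q Dq Hq. eapply Rle_trans; [apply Hm; auto|]. lra.
Qed.

(** * Homogeneous functions of degree two *)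

Definition homogeneous2 (F : R -> R -> R) : Prop :=
  forall l x y, F (l * x) (l * y) = l ^ 2 * F x y.

Definition parallelogram (F : R -> R -> R) (e1 e2 f1 f2 : R) : R :=
  F (e1 + f1) (e2 + f2) + F (e1 - f1) (e2 - f2) - 2 * F e1 e2 - 2 * F f1 f2.

Definition rdet (e1 e2 f1 f2 : R) : R := e1 * f2 - e2 * f1.

(** The cut-off [delta] serves two situations: [delta = 0] when all scales are controlled, and
    [delta = 1] for charts in which only chords of length at least one are. *)
Definition chord_bound (delta K : R) (g : R -> R) : Prop :=
  forall p q r, 0 <= (q - p) * (r - q) -> delta <= Rabs (r - p) ->
    Rabs (chord_dev g p q r) <= K * (r - p) ^ 2.

Lemma homogeneous2_slope (F : R -> R -> R) (x y : R) : homogeneous2 F -> y <> 0 ->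
  F x y = y ^ 2 * F (x / y) 1.
Proof.
  intros H Hy. rewrite <- H. f_equal; field; auto.
Qed.

(** In the chart y = 1 the defect is a combination of two chord deviations: that of [e1 / e2] from
    the chord over [r], [p], and that of [p] from the chord over [r], [f1 / f2]. The assumption
    [2 * f2 <= e2] bounds the two contributions by 16/3 and 3 times [K * Rabs D], whence the
    constant 9. *)
Lemma parallelogram_core (F : R -> R -> R) (K e1 e2 f1 f2 : R) :
  homogeneous2 F -> (f2 = 0 -> F 1 0 = 0) -> 0 < e2 -> 0 <= f2 -> 2 * f2 <= e2 ->
      rdet e1 e2 f1 f2 <> 0 ->
  let w x := F x 1 in
  let p := (e1 + f1) / (e2 + f2) in let r := (e1 - f1) / (e2 - f2) in
  Rabs (chord_dev w r (e1 / e2) p) <= K * (p - r) ^ 2 ->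
  (0 < f2 -> Rabs (chord_dev w r p (f1 / f2)) <= K * (f1 / f2 - r) ^ 2) ->
  Rabs (parallelogram F e1 e2 f1 f2) <= 9 * K * Rabs (rdet e1 e2 f1 f2).
Proof.
  intros Hh H0 He Hf Hfe HD w p r D1 D2.
  set (D := rdet e1 e2 f1 f2) in *.
  assert (Epr : p - r = -2 * D / (e2 ^ 2 - f2 ^ 2)).
  { unfold p, r, D, rdet. field. split; [nra|split; lra]. }
  assert (Hsq : 0 < e2 ^ 2 - f2 ^ 2) by nra.
  assert (HD2 : 0 < Rabs D) by (apply Rabs_pos_lt; auto).
  assert (Apr : Rabs (p - r) = 2 * Rabs D / (e2 ^ 2 - f2 ^ 2)).
  { rewrite Epr. unfold Rdiv.
    rewrite !Rabs_mult, Rabs_inv, (Rabs_left (-2)), (Rabs_right (_ - _)) by lra. ring. }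
  assert (Hpr0 : p - r <> 0).
  { intros Z. rewrite Z, Rabs_R0 in Apr. symmetry in Apr. revert Apr. apply Rgt_not_eq.
    apply Rdiv_lt_0_compat; lra. }
  assert (K0 : 0 <= K).
  { assert (0 <= K * (p - r) ^ 2) by (eapply Rle_trans; [apply Rabs_pos|exact D1]).
    assert (0 < (p - r) ^ 2) by (apply pow2_gt_0; auto). nra. }
  assert (F1 : F (e1 + f1) (e2 + f2) = (e2 + f2) ^ 2 * w p)
      by (apply homogeneous2_slope; auto; lra).
  assert (F2 : F (e1 - f1) (e2 - f2) = (e2 - f2) ^ 2 * w r)
      by (apply homogeneous2_slope; auto; lra).
  assert (F3 : F e1 e2 = e2 ^ 2 * w (e1 / e2)) by (apply homogeneous2_slope; auto; lra).
  assert (B1 : 2 * e2 ^ 2 / Rabs (p - r) * Rabs (chord_dev w r (e1 / e2) p) <=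
      16 / 3 * K * Rabs D).
  { apply Rle_trans with (2 * e2 ^ 2 / Rabs (p - r) * (K * (p - r) ^ 2)).
    - apply Rmult_le_compat_l; auto.
      apply Rlt_le, Rdiv_lt_0_compat; [nra|apply Rabs_pos_lt; auto].
    - rewrite <- (pow2_abs (p - r)).
      replace (_ * _) with (2 * K * e2 ^ 2 * Rabs (p - r)) by (field; apply Rabs_no_R0; auto).
      rewrite Apr.
      replace (_ * _) with (K * Rabs D * (4 * e2 ^ 2 / (e2 ^ 2 - f2 ^ 2))) by (field; lra).
      replace (16 / 3 * K * Rabs D) with (K * Rabs D * (16 / 3)) by ring.
      apply Rmult_le_compat_l; [apply Rmult_le_pos; lra|].
      apply Rle_div_l; nra. }
  assert (B1' : Rabs (2 * e2 ^ 2 / (p - r) * chord_dev w r (e1 / e2) p) <= 16 / 3 * K * Rabs D).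
  { rewrite Rabs_mult. unfold Rdiv at 1.
    rewrite Rabs_mult, Rabs_inv, (Rabs_right (2 * e2 ^ 2)) by nra. exact B1. }
  destruct Hf as [Hf|Hf].
  - assert (F4 : F f1 f2 = f2 ^ 2 * w (f1 / f2)) by (apply homogeneous2_slope; auto; lra).
    specialize (D2 Hf).
    assert (AX : (f1 / f2 - r) ^ 2 = D ^ 2 / (f2 ^ 2 * (e2 - f2) ^ 2)).
    { unfold r, D, rdet. field. split; lra. }
    assert (B2 : Rabs (2 * f2 ^ 2 / (p - r) * chord_dev w r p (f1 / f2)) <= 3 * K * Rabs D).
    { rewrite Rabs_mult. unfold Rdiv at 1.
      rewrite Rabs_mult, Rabs_inv, (Rabs_right (2 * f2 ^ 2)) by nra.
      apply Rle_trans with (2 * f2 ^ 2 * / Rabs (p - r) * (K * (f1 / f2 - r) ^ 2)).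
      - apply Rmult_le_compat_l; auto.
        apply Rlt_le, Rdiv_lt_0_compat; [nra|apply Rabs_pos_lt; auto].
      - rewrite AX, Apr, <- (pow2_abs D).
        replace (_ * _) with (K * Rabs D * ((e2 + f2) / (e2 - f2))).
        2: { field. repeat split; lra. }
        replace (3 * K * Rabs D) with (K * Rabs D * 3) by ring.
        apply Rmult_le_compat_l; [apply Rmult_le_pos; lra|].
        apply Rle_div_l; lra. }
    replace (parallelogram F e1 e2 f1 f2) with
      (- (2 * e2 ^ 2 / (p - r) * chord_dev w r (e1 / e2) p) +
          2 * f2 ^ 2 / (p - r) * chord_dev w r p (f1 / f2)).
    + eapply Rle_trans; [apply Rabs_triang|]. rewrite Rabs_Ropp.
      assert (0 <= K * Rabs D) by (apply Rmult_le_pos; lra). lra.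
    + unfold parallelogram. rewrite F1, F2, F3, F4. unfold chord_dev.
      set (wp := w p). set (wr := w r). set (wq := w (e1 / e2)). set (wX := w (f1 / f2)).
      clear - Hpr0 He Hf Hfe HD Hsq. unfold p, r in *. unfold D, rdet in HD.
      field. repeat split; try lra; intros Z; apply HD; lra.
  (* The fourth line is now the point at infinity of the chart, and the normalization at [(1, 0)]
     removes its term. *)
  - assert (F4 : F f1 f2 = 0).
    { rewrite <- Hf. replace f1 with (f1 * 1) by ring. replace 0 with (f1 * 0) at 1 by ring.
      rewrite Hh, H0 by auto. ring. }
    replace (parallelogram F e1 e2 f1 f2) with
      (- (2 * e2 ^ 2 / (p - r) * chord_dev w r (e1 / e2) p)).
    + rewrite Rabs_Ropp. assert (0 <= K * Rabs D) by (apply Rmult_le_pos; lra). lra.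
    + unfold parallelogram. rewrite F1, F2, F3, F4. unfold chord_dev.
      set (wp := w p). set (wr := w r). set (wq := w (e1 / e2)).
      clear - Hpr0 He Hf HD Hsq. unfold p, r in *. unfold D, rdet in HD. rewrite <- Hf in *.
      field. split; [lra|]. intros Z. apply HD. replace f1 with 0 by lra. ring.
Qed.

Lemma parallelogram_swap (F : R -> R -> R) (e1 e2 f1 f2 : R) : homogeneous2 F ->
  parallelogram F f1 f2 e1 e2 = parallelogram F e1 e2 f1 f2.
Proof.
  intros H. unfold parallelogram.
  replace (f1 - e1) with (-1 * (e1 - f1)) by ring.
  replace (f2 - e2) with (-1 * (e2 - f2)) by ring.
  rewrite H, (Rplus_comm f1), (Rplus_comm f2). ring.
Qed.

Lemma parallelogram_opp (F : R -> R -> R) (e1 e2 f1 f2 : R) : homogeneous2 F ->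
  parallelogram F e1 e2 (- f1) (- f2) = parallelogram F e1 e2 f1 f2.
Proof.
  intros H. unfold parallelogram.
  replace (F (- f1) (- f2)) with (F f1 f2).
  - unfold Rminus. rewrite !Ropp_involutive. ring.
  - replace (- f1) with (-1 * f1) by ring. replace (- f2) with (-1 * f2) by ring. rewrite H. ring.
Qed.

Lemma parallelogram_opp_l (F : R -> R -> R) (e1 e2 f1 f2 : R) : homogeneous2 F ->
  parallelogram F (- e1) (- e2) f1 f2 = parallelogram F e1 e2 f1 f2.
Proof.
  intros H. rewrite parallelogram_swap, parallelogram_opp, parallelogram_swap; auto.
Qed.

(** Sum and difference exchange the two pairs of the harmonic quadruple. The determinant is
    multiplied by -2 as well, so the ratio to be bounded is unchanged. *)
Lemma parallelogram_rotate (F : R -> R -> R) (e1 e2 f1 f2 : R) : homogeneous2 F ->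
  parallelogram F (e1 + f1) (e2 + f2) (e1 - f1) (e2 - f2) = -2 * parallelogram F e1 e2 f1 f2.
Proof.
  intros H. unfold parallelogram.
  replace (e1 + f1 + (e1 - f1)) with (2 * e1) by ring.
  replace (e2 + f2 + (e2 - f2)) with (2 * e2) by ring.
  replace (e1 + f1 - (e1 - f1)) with (2 * f1) by ring.
  replace (e2 + f2 - (e2 - f2)) with (2 * f2) by ring.
  rewrite !H. ring.
Qed.

(* The eight symmetries of a harmonic quadruple reduce to [parallelogram_core]. *)
Lemma parallelogram_bound (F : R -> R -> R) (delta K : R) : homogeneous2 F -> F 1 0 = 0 ->
  0 <= delta -> chord_bound delta K (fun x => F x 1) ->
  forall e1 e2 f1 f2, rdet e1 e2 f1 f2 <> 0 ->
    delta * (e2 ^ 2 + f2 ^ 2) <= 2 * Rabs (rdet e1 e2 f1 f2) ->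
    Rabs (parallelogram F e1 e2 f1 f2) <= 9 * K * Rabs (rdet e1 e2 f1 f2).
Proof.
  intros Hh H0 Hd HK.
  assert (Core : forall e1 e2 f1 f2, 0 < e2 -> 0 <= f2 -> 2 * f2 <= e2 -> rdet e1 e2 f1 f2 <> 0 ->
    delta * (e2 ^ 2 + f2 ^ 2) <= 2 * Rabs (rdet e1 e2 f1 f2) ->
    Rabs (parallelogram F e1 e2 f1 f2) <= 9 * K * Rabs (rdet e1 e2 f1 f2)).
  { intros e1 e2 f1 f2 He Hf Hfe HD Hdel.
    set (D := rdet e1 e2 f1 f2) in *.
    assert (Hsq : 0 < e2 ^ 2 - f2 ^ 2) by nra.
    assert (Epr : (e1 + f1) / (e2 + f2) - (e1 - f1) / (e2 - f2) = -2 * D / (e2 ^ 2 - f2 ^ 2)).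
    { unfold D, rdet. field. split; [nra|split; lra]. }
    (* The chord has length 2 |D| / (e2^2 - f2^2). The hypothesis uses the sum of squares instead
       because it is respected by all symmetries: passing to sum and difference doubles it, just as
       it doubles |D|. *)
    assert (Apr : delta <= Rabs ((e1 + f1) / (e2 + f2) - (e1 - f1) / (e2 - f2))).
    { rewrite Epr. unfold Rdiv.
      rewrite !Rabs_mult, Rabs_inv, (Rabs_left (-2)), (Rabs_right (_ - _)) by lra.
      apply Rle_trans with (2 * Rabs D / (e2 ^ 2 - f2 ^ 2)); [|apply Req_le; unfold Rdiv; ring].
      apply Rle_div_r; auto. eapply Rle_trans; [|exact Hdel]. apply Rmult_le_compat_l; nra. }
    apply parallelogram_core; auto.
    - apply HK; auto.
      replace (_ * _) with (D ^ 2 / (e2 ^ 2 * (e2 ^ 2 - f2 ^ 2))).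
      + apply Rlt_le, Rdiv_lt_0_compat; [apply pow2_gt_0; auto|]. apply Rmult_lt_0_compat; nra.
      + unfold D, rdet. field. repeat split; nra.
    - intros Hf'.
      assert (E1 : f1 / f2 - (e1 - f1) / (e2 - f2) = - D / (f2 * (e2 - f2))).
      { unfold D, rdet. field. lra. }
      apply HK.
      + replace (_ * _) with (2 * D ^ 2 / (f2 * (e2 + f2) * (e2 ^ 2 - f2 ^ 2))).
        * apply Rlt_le, Rdiv_lt_0_compat; [assert (0 < D ^ 2) by (apply pow2_gt_0; auto); lra|].
          apply Rmult_lt_0_compat; nra.
        * unfold D, rdet. field. repeat split; nra.
      + eapply Rle_trans; [exact Apr|]. rewrite Epr, E1.
        unfold Rdiv. rewrite !Rabs_mult, !Rabs_inv, Rabs_Ropp, (Rabs_left (-2)),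
            (Rabs_right (_ - _)), (Rabs_right (_ * _)) by nra.
        replace (- -2 * Rabs D * _) with (Rabs D * (2 * / (e2 ^ 2 - f2 ^ 2))) by ring.
        apply Rmult_le_compat_l; [apply Rabs_pos|].
        apply Rmult_le_reg_r with (e2 ^ 2 - f2 ^ 2); auto.
        replace (2 * _ * _) with 2 by (field; lra).
        replace (_ * _) with ((e2 + f2) / f2) by (field; lra).
        apply Rle_div_r; lra. }
  assert (Quadrant : forall e1 e2 f1 f2, 0 <= f2 -> f2 <= e2 -> rdet e1 e2 f1 f2 <> 0 ->
    delta * (e2 ^ 2 + f2 ^ 2) <= 2 * Rabs (rdet e1 e2 f1 f2) ->
    Rabs (parallelogram F e1 e2 f1 f2) <= 9 * K * Rabs (rdet e1 e2 f1 f2)).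
  { intros e1 e2 f1 f2 Hf Hfe HD Hdel.
    assert (0 < e2).
    { destruct (Rle_lt_dec e2 0); auto. assert (e2 = 0) by lra. assert (f2 = 0) by lra.
      subst. exfalso. apply HD. unfold rdet; ring. }
    destruct (Rle_dec (2 * f2) e2); [apply Core; auto|].
    (* In the remaining range e2 < 2 f2, hence 2 (e2 - f2) <= e2 + f2, and the core case applies to
       sum and difference. *)
    assert (A : rdet (e1 + f1) (e2 + f2) (e1 - f1) (e2 - f2) = -2 * rdet e1 e2 f1 f2)
        by (unfold rdet; ring).
    assert (B : Rabs (rdet (e1 + f1) (e2 +
        f2) (e1 - f1) (e2 - f2)) = 2 * Rabs (rdet e1 e2 f1 f2)).
    { rewrite A, Rabs_mult, (Rabs_left (-2)) by lra. ring. }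
    assert (G : Rabs (parallelogram F (e1 + f1) (e2 + f2) (e1 - f1) (e2 - f2)) <= 
       9 * K * Rabs (rdet (e1 + f1) (e2 + f2) (e1 - f1) (e2 - f2))).
    { apply Core; try lra. }
    rewrite B, parallelogram_rotate, Rabs_mult, (Rabs_left (-2)) in G; [lra|lra|auto]. }
  assert (Half : forall e1 e2 f1 f2, 0 <= f2 -> 0 <= e2 -> rdet e1 e2 f1 f2 <> 0 ->
    delta * (e2 ^ 2 + f2 ^ 2) <= 2 * Rabs (rdet e1 e2 f1 f2) ->
    Rabs (parallelogram F e1 e2 f1 f2) <= 9 * K * Rabs (rdet e1 e2 f1 f2)).
  { intros e1 e2 f1 f2 Hf He HD Hdel.
    destruct (Rle_dec f2 e2); [apply Quadrant; auto|].
    rewrite <- parallelogram_swap by auto.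
    assert (A : rdet e1 e2 f1 f2 = - rdet f1 f2 e1 e2) by (unfold rdet; ring).
    rewrite A, Rabs_Ropp in *. apply Quadrant; try lra. }
  intros e1 e2 f1 f2 HD Hdel.
  assert (A1 : rdet (- e1) (- e2) f1 f2 = - rdet e1 e2 f1 f2) by (unfold rdet; ring).
  assert (A2 : rdet e1 e2 (- f1) (- f2) = - rdet e1 e2 f1 f2) by (unfold rdet; ring).
  assert (A3 : rdet (- e1) (- e2) (- f1) (- f2) = rdet e1 e2 f1 f2) by (unfold rdet; ring).
  destruct (Rle_dec 0 e2), (Rle_dec 0 f2).
  - apply Half; auto.
  - rewrite <- parallelogram_opp, <- (Rabs_Ropp (rdet _ _ _ _)), <- A2 by auto.
    apply Half; try lra. rewrite A2, Rabs_Ropp. lra.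
  - rewrite <- parallelogram_opp_l, <- (Rabs_Ropp (rdet _ _ _ _)), <- A1 by auto.
    apply Half; try lra. rewrite A1, Rabs_Ropp. lra.
  - rewrite <- parallelogram_opp_l, <- parallelogram_opp, <- A3 by auto.
    apply Half; try lra. rewrite A3. lra.
Qed.

(** * Zygmund fields on the line *)

Lemma chord_dev_rev (g : R -> R) (p q r : R) : chord_dev g r q p = - chord_dev g p q r.
Proof. unfold chord_dev; ring. Qed.

Lemma chord_bound_of_second_diff (g : R -> R) (M : R) : 0 <= M ->
  (forall p r, exists K, forall x, p <= x <= r -> Rabs (g x) <= K) ->
  (forall x t, 0 <= t -> Rabs (second_diff g x t) <= M * t) ->
  chord_bound 0 (M / 2) g.
Proof.
  intros HM Hb H2.
  assert (A : forall p q r, p < r -> p <= q <= r ->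
      Rabs (chord_dev g p q r) <= M / 2 * (r - p) ^ 2).
  { intros p q r Hpr Hq. apply (chord_dev_bound (fun _ => True)); auto.
    destruct (Hb p r) as (K & HK). exists K; auto. }
  intros p q r Hq _. destruct (Rtotal_order p r) as [L|[E|L]].
  - apply A; auto. split; nra.
  - subst r. assert (q = p) by nra. subst q. unfold chord_dev.
    replace (_ - _) with 0 by ring. rewrite Rabs_R0. nra.
  - rewrite chord_dev_rev, Rabs_Ropp. replace ((r - p) ^ 2) with ((p - r) ^ 2) by ring.
    apply A; auto. split; nra.
Qed.

Lemma homogeneous2_extension (w : R -> R) (L : R) :
  homogeneous2 (fun x y => if Req_EM_T y 0 then L * x ^ 2 else y ^ 2 * w (x / y)).
Proof.
  intros l x y. destruct (Req_EM_T l 0) as [->|Hl].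
  - rewrite !Rmult_0_l. destruct Req_EM_T; [|tauto]. ring.
  - destruct (Req_EM_T y 0) as [->|Hy].
    + rewrite Rmult_0_r. destruct Req_EM_T; [|tauto]. ring.
    + destruct Req_EM_T as [E|_].
      * apply Rmult_integral in E. tauto.
      * replace (l * x / (l * y)) with (x / y) by (field; auto). ring.
Qed.

(** Inversion exchanges the coordinates, so the second difference of [f] is the defect of the
    homogeneous extension of [g] at [(1, x)] and [(0, t)]. All four slopes lie in [0, 1], where
    chords of [g] are controlled. *)
Lemma second_diff_inversion_far (f g : R -> R) (K x t : R) :
  g 0 = 0 -> (forall u, u <> 0 -> f u = u ^ 2 * g (1 / u)) ->
  (forall p q r, -1 <= p -> p < r -> r <= 1 -> p <= q <= r ->
     Rabs (chord_dev g p q r) <= K * (r - p) ^ 2) ->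
  0 < t -> 2 * t <= x -> 1 <= x - t ->
  Rabs (second_diff f x t) <= 9 * K * t.
Proof.
  intros g0 Hfg HK Ht Htx H1.
  set (G := fun a b => if Req_EM_T b 0 then 0 * a ^ 2 else b ^ 2 * g (a / b)).
  assert (HG : homogeneous2 G) by apply homogeneous2_extension.
  assert (E : second_diff f x t = parallelogram G 1 x 0 t).
  { unfold second_diff, parallelogram, G.
    repeat (destruct Req_EM_T; [lra|]). rewrite !Hfg by lra.
    replace (1 + 0) with 1 by ring. replace (1 - 0) with 1 by ring.
    replace (0 / t) with 0 by (field; lra). rewrite g0. ring. }
  assert (Gg : forall y, G y 1 = g y).
  { intros y. unfold G. destruct Req_EM_T; [lra|]. replace (y / 1) with y by field. ring. }
  rewrite E.
  assert (ED : rdet 1 x 0 t = t) by (unfold rdet; ring).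
  replace t with (Rabs (rdet 1 x 0 t)) at 2 by (rewrite ED; apply Rabs_right; lra).
  assert (O1 : 1 / (x + t) < 1 / x)
      by (apply Rmult_lt_compat_l; [lra|]; apply Rinv_lt_contravar; nra).
  assert (O2 : 1 / x < 1 / (x - t))
      by (apply Rmult_lt_compat_l; [lra|]; apply Rinv_lt_contravar; nra).
  assert (O3 : 0 < 1 / (x + t)) by (apply Rdiv_lt_0_compat; lra).
  assert (O4 : 1 / (x - t) <= 1) by (apply Rle_div_l; lra).
  apply parallelogram_core; auto; try lra; unfold rdet.
  - rewrite chord_dev_rev, Rabs_Ropp. unfold chord_dev. rewrite !Gg.
    replace ((1 + 0) / (x + t)) with (1 / (x + t)) by (field; lra).
    replace ((1 - 0) / (x - t)) with (1 / (x - t)) by (field; lra).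
    replace ((_ - _) ^ 2) with ((1 / (x - t) - 1 / (x + t)) ^ 2) by ring.
    apply HK; lra.
  - intros _. rewrite chord_dev_rev, Rabs_Ropp. unfold chord_dev. rewrite !Gg.
    replace ((1 + 0) / (x + t)) with (1 / (x + t)) by (field; lra).
    replace ((1 - 0) / (x - t)) with (1 / (x - t)) by (field; lra).
    replace (0 / t) with 0 by (field; lra).
    replace ((0 - _) ^ 2) with ((1 / (x - t) - 0) ^ 2) by ring.
    apply HK; lra.
Qed.

(* Subtracting a linear function from f makes g vanish at 1 / t. *)
Lemma second_diff_inversion_near (f g : R -> R) (K K' M x t : R) :
  g 0 = 0 -> (forall u, u <> 0 -> f u = u ^ 2 * g (1 / u)) ->
  0 <= K -> 0 <= K' -> 0 <= M ->
  (forall p q r, -1 <= p -> p < r -> r <= 1 -> p <= q <= r ->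
     Rabs (chord_dev g p q r) <= K * (r - p) ^ 2) ->
  (forall q, -1 <= q <= 1 -> Rabs (chord_dev f (-1) q 1) <= K') ->
  (forall y, 0 <= y <= 1 -> Rabs (g y + g (- y)) <= M * y) ->
  1 <= t -> Rabs x <= 2 * t ->
  Rabs (second_diff f x t) <= 4 * (9 * K + 3 * M + K') * t.
Proof.
  intros g0 Hfg K0 K0' M0 HK HK' HM Ht Hx.
  set (lam := t * g (1 / t)). set (h := fun u => f u - lam * u).
  assert (Hpos : forall u, 1 <= u -> u <= 3 * t -> Rabs (h u) <= 9 * K * t).
  { intros u Hu1 Hu2.
    assert (E : h u = u ^ 2 * t * (g (1 / u) * (1 / t) - g (1 / t) * (1 / u))).
    { unfold h, lam. rewrite Hfg by lra. field. lra. }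
    assert (P : 0 <= u ^ 2 * t) by nra.
    rewrite E, Rabs_mult, (Rabs_right (u ^ 2 * t)) by lra.
    assert (0 < 1 / u) by (apply Rdiv_lt_0_compat; lra).
    assert (0 < 1 / t) by (apply Rdiv_lt_0_compat; lra).
    assert (1 / u <= 1) by (apply Rle_div_l; lra).
    assert (1 / t <= 1) by (apply Rle_div_l; lra).
    destruct (Rle_dec t u) as [Htu|Htu].
    - assert (1 / u <= 1 / t) by (apply Rmult_le_compat_l; [lra|apply Rinv_le_contravar; lra]).
      assert (A := HK 0 (1 / u) (1 / t) ltac:(lra) ltac:(lra) ltac:(lra) ltac:(lra)).
      unfold chord_dev in A. rewrite g0 in A.
      replace (g (1 / u) * (1 / t) - _) with
        (g (1 / u) * (1 / t - 0) - 0 * (1 / t - 1 / u) - g (1 / t) * (1 / u - 0)) by ring.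
      eapply Rle_trans; [apply Rmult_le_compat_l; [exact P|exact A]|].
      replace (u ^ 2 * t * _) with (K * (u ^ 2 / t)) by (field; lra).
      replace (9 * K * t) with (K * (9 * t)) by ring. apply Rmult_le_compat_l; auto.
      apply Rle_div_l; nra.
    - assert (1 / t <= 1 / u) by (apply Rmult_le_compat_l; [lra|apply Rinv_le_contravar; lra]).
      assert (A := HK 0 (1 / t) (1 / u) ltac:(lra) ltac:(lra) ltac:(lra) ltac:(lra)).
      unfold chord_dev in A. rewrite g0 in A.
      rewrite <- Rabs_Ropp.
      replace (- (g (1 / u) * (1 / t) - _)) with
        (g (1 / t) * (1 / u - 0) - 0 * (1 / u - 1 / t) - g (1 / u) * (1 / t - 0)) by ring.
      eapply Rle_trans; [apply Rmult_le_compat_l; [exact P|exact A]|].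
      replace (u ^ 2 * t * _) with (K * t) by (field; lra). nra. }
  assert (Hneg : forall u, 1 <= u -> u <= 3 * t -> Rabs (h (- u)) <= (9 * K + 3 * M) * t).
  { intros u Hu1 Hu2. assert (A := Hpos u Hu1 Hu2).
    assert (0 < 1 / u) by (apply Rdiv_lt_0_compat; lra).
    assert (1 / u <= 1) by (apply Rle_div_l; lra).
    assert (B := HM (1 / u) ltac:(lra)).
    assert (E : h (- u) = - h u + u ^ 2 * (g (1 / u) + g (- (1 / u)))).
    { unfold h. rewrite !Hfg by lra. replace (1 / - u) with (- (1 / u)) by (field; lra). ring. }
    rewrite E. eapply Rle_trans; [apply Rabs_triang|].
    rewrite Rabs_Ropp, Rabs_mult, (Rabs_right (u ^ 2)) by nra.
    assert (u ^ 2 * Rabs (g (1 / u) + g (- (1 / u))) <= M * u).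
    { eapply Rle_trans; [apply Rmult_le_compat_l; [nra|exact B]|]. apply Req_le. field. lra. }
    nra. }
  (* Between -1 and 1 inversion gives no control; there the chord of [f] over [-1, 1] is used, whose
     end values are covered by [Hpos] and [Hneg]. The final factor 4 counts the three values in a
     second difference, the middle one twice. *)
  assert (Hall : forall u, Rabs u <= 3 * t -> Rabs (h u) <= (9 * K + 3 * M + K') * t).
  { intros u Hu. apply Rabs_le_iff in Hu.
    destruct (Rle_dec 1 u) as [U|U].
    - eapply Rle_trans; [apply Hpos; lra|]. nra.
    - destruct (Rle_dec u (-1)) as [V|V].
      + rewrite <- (Ropp_involutive u). eapply Rle_trans; [apply Hneg; lra|]. nra.
      + assert (A := HK' u ltac:(lra)).
        assert (A1 := Hpos 1 ltac:(lra) ltac:(lra)). assert (A2 := Hneg 1 ltac:(lra) ltac:(lra)).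
        replace (- (1)) with (-1) in A2 by lra.
        assert (E : 2 * h u = chord_dev f (-1) u 1 + h (-1) * (1 - u) + h 1 * (1 + u)).
        { unfold h, chord_dev. ring. }
        apply Rabs_le_iff in A, A1, A2. apply Rabs_le_iff.
        set (Q := (9 * K + 3 * M) * t) in *.
        assert (9 * K * t <= Q) by (unfold Q; nra).
        assert (- (Q * (1 - u)) <= h (-1) * (1 - u) <= Q * (1 - u)) by (split; nra).
        assert (- (Q * (1 + u)) <= h 1 * (1 + u) <= Q * (1 + u)) by (split; nra).
        assert (K' <= K' * t) by nra.
        replace ((9 * K + 3 * M + K') * t) with (Q + K' * t) by (unfold Q; ring). lra. }
  apply Rabs_le_iff in Hx.
  assert (B1 := Hall (x + t) ltac:(apply Rabs_le_iff; lra)).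
  assert (B2 := Hall (x - t) ltac:(apply Rabs_le_iff; lra)).
  assert (B3 := Hall x ltac:(apply Rabs_le_iff; lra)).
  replace (second_diff f x t) with (h (x + t) + h (x - t) - 2 * h x)
      by (unfold h, second_diff; ring).
  apply Rabs_le_iff in B1, B2, B3. apply Rabs_le_iff. lra.
Qed.

Lemma continuous_bounded (f : R -> R) (p r : R) : (forall x, continuous f x) ->
  exists K, forall x, p <= x <= r -> Rabs (f x) <= K.
Proof.
  intros Hf. destruct (Rle_dec p r) as [H|H].
  - assert (C : forall c, p <= c <= r -> continuity_pt f c).
    { intros c _. apply continuity_pt_filterlim, Hf. }
    destruct (continuity_ab_maj f p r H C) as (a & Ha & _).
    destruct (continuity_ab_min f p r H C) as (b & Hb & _).
    exists (Rmax (f a) (- f b)). intros x Hx. specialize (Ha x Hx). specialize (Hb x Hx).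
    assert (A := Rmax_l (f a) (- f b)). assert (B := Rmax_r (f a) (- f b)).
    apply Rabs_le_iff. lra.
  - exists 0. intros; lra.
Qed.

(** Subtracting [L * x ^ 2] makes the field vanish at infinity without changing the defect. The task
    is then to turn the bounds near 0 and near infinity into one bound [Glob] on second differences
    over the whole line, from which chord bounds at every scale follow. *)
Lemma line_zygmund_parallelogram (W : R -> R) (L : R) : line_zygmund W ->
  is_lim (fun x => W x / x ^ 2) p_infty L ->
  exists F K, homogeneous2 F /\ (forall x, F x 1 = W x) /\ F 1 0 = L /\ 0 < K /\
    forall e1 e2 f1 f2, rdet e1 e2 f1 f2 <> 0 ->
      Rabs (parallelogram F e1 e2 f1 f2) <= K * Rabs (rdet e1 e2 f1 f2).
Proof.
  intros ((HWc & _) & W' & HW' & HW'0 & M & HM0 & HM & HM') HL.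
  set (f := fun x => W x - L * x ^ 2). set (g := fun y => W' y - L).
  assert (EL : W' 0 = L).
  { assert (H1 : is_lim (fun x => W' (/ x)) p_infty (W' 0)).
    { apply is_lim_comp with 0.
      - apply is_lim_continuity, continuity_pt_filterlim, HW'0.
      - apply (is_lim_inv (fun x => x) p_infty p_infty); [apply is_lim_id|discriminate].
      - exists 1. intros x Hx E. injection E; apply Rinv_neq_0_compat; lra. }
    assert (H2 : is_lim (fun x => W x / x ^ 2) p_infty (W' 0)).
    { apply is_lim_ext_loc with (2 := H1). exists 1. intros x Hx. rewrite HW'.
      - replace (1 / / x) with x by (field; lra). field. lra.
      - apply Rinv_neq_0_compat; lra. }
    apply is_lim_unique in H2. apply is_lim_unique in HL. rewrite HL in H2. injection H2; auto. }
  assert (g0 : g 0 = 0) by (unfold g; lra).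
  assert (Hfg : forall u, u <> 0 -> f u = u ^ 2 * g (1 / u)).
  { intros u Hu. unfold f, g. rewrite HW'.
    - replace (1 / (1 / u)) with u by (field; auto). field; auto.
    - unfold Rdiv. rewrite Rmult_1_l. apply Rinv_neq_0_compat; auto. }
  assert (Hfc : forall x, continuous f x).
  { intros x. apply (continuous_minus W (fun x => L * x ^ 2)); auto.
    apply (ex_derive_continuous (fun x => L * x ^ 2)). auto_derive; auto. }
  assert (Hfb : forall p r, exists K, forall x, p <= x <= r -> Rabs (f x) <= K).
  { intros p r. apply continuous_bounded; auto. }
  (* Near 0 the continuity of [W'] gives a bound; away from 0 the bound on [f] is transported by
     inversion. *)
  assert (Hgb : forall p r, exists K, forall x, p <= x <= r -> Rabs (g x) <= K).
  { intros p r.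
    assert (C0 : continuity_pt W' 0) by apply continuity_pt_filterlim, HW'0.
    destruct (C0 1) as (al & Hal & C1); [lra|].
    destruct (Hfb (- / al) (/ al)) as (K & HK).
    assert (K0 : 0 <= K).
    { eapply Rle_trans; [apply Rabs_pos|apply (HK 0)]. apply Rinv_0_lt_compat in Hal. lra. }
    set (m := Rmax (Rabs p) (Rabs r)).
    exists (1 + m ^ 2 * K). intros x Hx.
    assert (Hxm : Rabs x <= m).
    { unfold m. destruct (Rle_dec 0 x).
      - eapply Rle_trans; [|apply Rmax_r]. rewrite !Rabs_right; lra.
      - eapply Rle_trans; [|apply Rmax_l]. rewrite !Rabs_left; lra. }
    assert (0 <= m ^ 2 * K) by (apply Rmult_le_pos; nra).
    destruct (Rlt_dec (Rabs x) al) as [A|A].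
    - destruct (Req_EM_T x 0) as [->|Hx0].
      + rewrite g0, Rabs_R0. lra.
      + assert (B : Rabs (W' x - W' 0) < 1).
        { apply C1. split; [split; [exact I|auto]|]. simpl. unfold Rdist. rewrite Rminus_0_r.
          exact A. }
        unfold g. rewrite <- EL. lra.
    - assert (Hx0 : x <> 0) by (intros ->; rewrite Rabs_R0 in A; lra).
      assert (E : g x = x ^ 2 * f (1 / x)).
      { rewrite Hfg; [replace (1 / (1 / x)) with x by (field; auto); field; auto|].
        unfold Rdiv. rewrite Rmult_1_l. apply Rinv_neq_0_compat; auto. }
      rewrite E, Rabs_mult, (Rabs_right (x ^ 2)) by nra.
      assert (x ^ 2 <= m ^ 2) by (rewrite <- (pow2_abs x); apply pow_incr; split;
          [apply Rabs_pos|auto]).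
      assert (Rabs (f (1 / x)) <= K).
      { apply HK. apply Rabs_le_iff. unfold Rdiv. rewrite Rmult_1_l, Rabs_inv.
        apply Rinv_le_contravar; lra. }
      assert (0 <= Rabs (f (1 / x))) by apply Rabs_pos.
      assert (x ^ 2 * Rabs (f (1 / x)) <= m ^ 2 * K) by (apply Rmult_le_compat; nra).
      lra. }
  (* The subtracted square has second difference 2 L t^2, at most 2 |L| t in absolute value for t <=
     1. *)
  set (Mf := M + 2 * Rabs L).
  assert (Mf0 : 0 < Mf) by (unfold Mf; assert (0 <= Rabs L) by apply Rabs_pos; lra).
  assert (Hf2 : forall x t, -2 <= x <= 2 -> 0 <= t <= 1 -> Rabs (second_diff f x t) <= Mf * t).
  { intros x t Hx Ht. replace (second_diff f x t)
        with (second_diff W x t + - (2 * L * t ^ 2)) by (unfold f, second_diff; ring).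
    eapply Rle_trans; [apply Rabs_triang|].
    rewrite Rabs_Ropp, !Rabs_mult, (Rabs_right 2), (Rabs_right (t ^ 2)) by nra.
    assert (A := HM x t Hx Ht). unfold second_diff, Mf.
    assert (0 <= Rabs L) by apply Rabs_pos.
    assert (Rabs L * t ^ 2 <= Rabs L * t) by (apply Rmult_le_compat_l; nra). lra. }
  assert (Hg2 : forall x t, -2 <= x <= 2 -> 0 <= t <= 1 -> Rabs (second_diff g x t) <= M * t).
  { intros x t Hx Ht. replace (second_diff g x t)
        with (second_diff W' x t) by (unfold g, second_diff; ring).
    apply HM'; auto. }
  assert (Local : forall w N, 0 <= N -> (forall p r, exists K, forall x,
      p <= x <= r -> Rabs (w x) <= K) ->
     (forall x t, -2 <= x <= 2 -> 0 <= t <= 1 -> Rabs (second_diff w x t) <= N * t) ->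
     (forall p q r, -1 <= p -> p < r -> r <= 1 -> p <= q <= r ->
     Rabs (chord_dev w p q r) <= N / 2 * (r - p) ^ 2)).
  { intros w N HN Hb H2 p q r Hp Hpr Hr Hq.
    apply (chord_dev_bound (fun _ => True)); auto.
    - destruct (Hb p r) as (K & HK). exists K; auto.
    - intros x t _ Ht Hx1 Hx2 _ _. apply H2; lra. }
  assert (Kg := Local g M ltac:(lra) Hgb Hg2).
  assert (Kf := Local f Mf ltac:(lra) Hfb Hf2).
  set (N := Mf + 9 * (M / 2) + 4 * (9 * (M / 2) + 3 * M + Mf / 2 * 4)).
  (* Three regimes: the segment from x - t to x + t stays away from 0 and is short relative to x, so
     inversion applies directly; [x] and [t] are both bounded, so the local condition applies; or
     the step is large and comparable to its distance from 0. [N] adds up the three constants. *)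
  assert (Glob : forall x t, 0 <= t -> Rabs (second_diff f x t) <= N * t).
  { assert (Fin : forall x t c, 0 <= t -> c <= N -> Rabs (second_diff f x t) <= c * t ->
       Rabs (second_diff f x t) <= N * t) by (intros; nra).
    intros x t Ht.
    destruct (Req_EM_T t 0) as [->|Ht0].
    { replace (second_diff f x 0) with 0
          by (unfold second_diff; rewrite Rplus_0_r, Rminus_0_r; ring).
      rewrite Rabs_R0. lra. }
    destruct (Rle_dec (2 * t) (Rabs x)) as [A|A]; [destruct (Rle_dec 1 (Rabs x - t)) as [B|B]|].
    - apply Fin with (9 * (M / 2)); auto; [unfold N; lra|].
      destruct (Rle_dec 0 x) as [X|X].
      + rewrite Rabs_right in A, B by lra.
        apply (second_diff_inversion_far f g); auto; lra.
      + rewrite Rabs_left in A, B by lra.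
        replace (second_diff f x t) with (second_diff (fun u => f (- u)) (- x) t).
        2: { unfold second_diff. replace (- (- x + t)) with (x - t) by ring.
             replace (- (- x - t)) with (x + t) by ring. rewrite Ropp_involutive. ring. }
        apply (second_diff_inversion_far _ (fun y => g (- y))); auto; try lra.
        * rewrite Ropp_0; auto.
        * intros u Hu. rewrite Hfg by lra. replace (1 / - u) with (- (1 / u)) by (field; auto).
          ring.
        * intros p q r P1 P2 P3 P4.
          replace (chord_dev (fun y => g (- y)) p q r)
              with (chord_dev g (- r) (- q) (- p)) by (unfold chord_dev; ring).
          replace ((r - p) ^ 2) with ((- p - - r) ^ 2) by ring. apply Kg; lra.
    - apply Fin with Mf; auto; [unfold N; lra|]. apply Hf2; [|lra].
      apply Rabs_le_iff. lra.
    - destruct (Rle_dec t 1) as [T|T].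
      + apply Fin with Mf; auto; [unfold N; lra|]. apply Hf2; [|lra]. apply Rabs_le_iff. lra.
      + apply Fin with (4 * (9 * (M / 2) + 3 * M + Mf / 2 * 4)); auto; [unfold N; lra|].
        apply (second_diff_inversion_near f g); auto; try lra.
        * intros q Hq. replace (Mf / 2 * 4) with (Mf / 2 * (1 - -1) ^ 2) by ring. apply Kf; lra.
        * intros y Hy. assert (Q := Hg2 0 y ltac:(lra) Hy). unfold second_diff in Q.
          rewrite Rplus_0_l, Rminus_0_l, g0 in Q.
          replace (g y + g (- y)) with (g y + g (- y) - 2 * 0) by ring. exact Q. }
  assert (CB : chord_bound 0 (N / 2) f)
      by (apply chord_bound_of_second_diff; auto; unfold N; lra).
  set (F0 := fun x y => if Req_EM_T y 0 then 0 * x ^ 2 else y ^ 2 * f (x / y)).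
  assert (HF0 : homogeneous2 F0) by apply homogeneous2_extension.
  exists (fun x y => F0 x y + L * x ^ 2), (9 * (N / 2)). split; [|split; [|split; [|split]]].
  - intros l x y. rewrite HF0. ring.
  - intros x. unfold F0. destruct Req_EM_T; [lra|]. replace (x / 1) with x by field. unfold f.
    ring.
  - unfold F0. destruct Req_EM_T; [ring|lra].
  - unfold N. lra.
  - intros e1 e2 f1 f2 HD.
    replace (parallelogram _ e1 e2 f1 f2)
        with (parallelogram F0 e1 e2 f1 f2) by (unfold parallelogram; ring).
    apply parallelogram_bound with 0; auto.
    + unfold F0. destruct Req_EM_T; [ring|lra].
    + lra.
    + replace (fun x => F0 x 1) with f; auto. apply functional_extensionality.
      intros x. unfold F0. destruct Req_EM_T; [lra|]. replace (x / 1) with x by field. ring.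
    + assert (0 <= Rabs (rdet e1 e2 f1 f2)) by apply Rabs_pos. lra.
Qed.

(** * The Euclidean series *)

(* Along the path of Farey edges (u, v) towards the direction [s u + t v], the edge
   contributes its value times the current [s t]. *)
Fixpoint euclid (sg : Z -> Z -> Z -> Z -> R) (n : nat) (a b c d : Z) (s t : R) : R :=
  match n with
  | O => 0
  | S n =>
      sg a b c d * (s * t) +
      if Rle_dec t s then euclid sg n a b (a + c) (b + d) (s - t) t
      else euclid sg n (a + c) (b + d) c d s (t - s)
  end.

(* The subtractive algorithm cuts squares off an s x t rectangle, and s^2 + t^2
   drops by at least s t in every step. *)
Lemma euclid_bound (sg : Z -> Z -> Z -> Z -> R) (K : R) :
  (forall a b c d, Rabs (sg a b c d) <= K) ->
  forall n a b c d s t, 0 <= s -> 0 <= t -> Rabs (euclid sg n a b c d s t) <= K * (s ^ 2 + t ^ 2).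
Proof.
  intros HK. assert (K0 : 0 <= K) by (eapply Rle_trans; [apply Rabs_pos|apply (HK 0 0 0 0)%Z]).
  induction n as [|n IH]; intros a b c d s t Hs Ht; simpl euclid.
  - rewrite Rabs_R0. nra.
  - eapply Rle_trans; [apply Rabs_triang|]. rewrite Rabs_mult, (Rabs_right (s * t)) by nra.
    assert (A : Rabs (sg a b c d) * (s * t) <= K * (s * t))
        by (apply Rmult_le_compat_r; [nra|apply HK]).
    destruct Rle_dec as [H|H].
    + assert (B := IH a b (a + c)%Z (b + d)%Z (s - t) t ltac:(lra) Ht).
      assert (K * (s * t + (s - t) ^ 2 + t ^ 2) <= K * (s ^ 2 + t ^ 2))
          by (apply Rmult_le_compat_l; nra).
      lra.
    + assert (B := IH (a + c)%Z (b + d)%Z c d s (t - s) Hs ltac:(lra)).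
      assert (K * (s * t + s ^ 2 + (t - s) ^ 2) <= K * (s ^ 2 + t ^ 2))
          by (apply Rmult_le_compat_l; nra).
      lra.
Qed.

Lemma euclid_incr (sg : Z -> Z -> Z -> Z -> R) : (forall a b c d, 0 <= sg a b c d) ->
  forall n a b c d s t, 0 <= s -> 0 <= t ->
      euclid sg n a b c d s t <= euclid sg (S n) a b c d s t.
Proof.
  intros H0. induction n as [|n IH]; intros a b c d s t Hs Ht.
  - simpl. assert (0 <= sg a b c d * (s * t)) by (apply Rmult_le_pos; [auto|nra]).
    destruct Rle_dec; lra.
  - change (euclid sg (S (S n)) a b c d s t) with (sg a b c d * (s * t) +
      if Rle_dec t s then euclid sg (S n) a b (a + c) (b + d) (s - t) t
      else euclid sg (S n) (a + c) (b + d) c d s (t - s)).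
    change (euclid sg (S n) a b c d s t) with (sg a b c d * (s * t) +
      if Rle_dec t s then euclid sg n a b (a + c) (b + d) (s - t) t
      else euclid sg n (a + c) (b + d) c d s (t - s)).
    apply Rplus_le_compat_l. destruct Rle_dec; apply IH; lra.
Qed.

Lemma euclid_plus (sg sg' : Z -> Z -> Z -> Z -> R) (n : nat) : forall a b c d s t,
  euclid (fun a b c d => sg a b c d + sg' a b c d) n a b c d s t =
  euclid sg n a b c d s t + euclid sg' n a b c d s t.
Proof.
  induction n as [|n IH]; intros; simpl; [ring|]. destruct Rle_dec; rewrite IH; ring.
Qed.

Lemma euclid_cv_pos (sg : Z -> Z -> Z -> Z -> R) (K : R) :
  (forall a b c d, 0 <= sg a b c d <= K) ->
  forall a b c d s t, 0 <= s -> 0 <= t -> ex_finite_lim_seq (fun n => euclid sg n a b c d s t).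
Proof.
  intros H a b c d s t Hs Ht. apply ex_finite_lim_seq_incr with (K * (s ^ 2 + t ^ 2)).
  - intros n. apply euclid_incr; auto. intros; apply H.
  - intros n. eapply Rle_trans; [apply Rle_abs|]. apply euclid_bound; auto.
    intros a' b' c' d'. destruct (H a' b' c' d'). rewrite Rabs_right; lra.
Qed.

(** The series for [sg + K] and for the constant [K] have nonnegative terms and bounded partial
    sums; the wanted series is their difference. *)
Lemma euclid_cv (sg : Z -> Z -> Z -> Z -> R) (K : R) :
  (forall a b c d, Rabs (sg a b c d) <= K) ->
  forall a b c d s t, 0 <= s -> 0 <= t -> ex_finite_lim_seq (fun n => euclid sg n a b c d s t).
Proof.
  intros HK a b c d s t Hs Ht.
  assert (K0 : 0 <= K) by (eapply Rle_trans; [apply Rabs_pos|apply (HK 0 0 0 0)%Z]).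
  destruct (euclid_cv_pos (fun a b c d => sg a b c d + K) (2 * K))
      with a b c d s t as (l & Hl); auto.
  { intros a' b' c' d'. specialize (HK a' b' c' d'). apply Rabs_le_iff in HK. lra. }
  destruct (euclid_cv_pos (fun a b c d => K) K) with a b c d s t as (l' & Hl'); auto.
  { intros; lra. }
  exists (l - l'). apply is_lim_seq_ext with (2 := is_lim_seq_minus' _ _ _ _ Hl Hl').
  intros n. rewrite euclid_plus. ring.
Qed.

Definition euclid_sum (sg : Z -> Z -> Z -> Z -> R) (a b c d : Z) (s t : R) : R :=
  real (Lim_seq (fun n => euclid sg n a b c d s t)).

Section Euclid.

Variables (sg : Z -> Z -> Z -> Z -> R) (K : R).
Hypothesis HK : forall a b c d, Rabs (sg a b c d) <= K.
Hypothesis Hswap : forall a b c d, sg a b c d = sg c d a b.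
Hypothesis Hopp : forall a b c d, sg (- a) (- b) c d = sg a b c d.

Lemma sg_opp_r a b c d : sg a b (- c) (- d) = sg a b c d.
Proof. rewrite Hswap, Hopp. apply Hswap. Qed.

Lemma sg_K_pos : 0 <= K.
Proof. eapply Rle_trans; [apply Rabs_pos|apply (HK 0 0 0 0)%Z]. Qed.

Lemma euclid_sum_lim a b c d s t : 0 <= s -> 0 <= t ->
  is_lim_seq (fun n => euclid sg n a b c d s t) (euclid_sum sg a b c d s t).
Proof. intros. apply Lim_seq_correct'. apply euclid_cv with K; auto. Qed.

Lemma euclid_sum_unique a b c d s t l :
  is_lim_seq (fun n => euclid sg n a b c d s t) (Finite l) -> euclid_sum sg a b c d s t = l.
Proof. intros H. unfold euclid_sum. apply is_lim_seq_unique in H. rewrite H. reflexivity. Qed.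

Lemma euclid_sum_bound a b c d s t : 0 <= s -> 0 <= t ->
  Rabs (euclid_sum sg a b c d s t) <= K * (s ^ 2 + t ^ 2).
Proof.
  intros Hs Ht.
  assert (L := is_lim_seq_abs _ _ (euclid_sum_lim a b c d s t Hs Ht)).
  apply (is_lim_seq_le _ (fun _ => K * (s ^ 2 +
      t ^ 2)) (Rabs (euclid_sum sg a b c d s t)) (K * (s ^ 2 + t ^ 2)))
    with (2 := L) (3 := is_lim_seq_const _).
  intros n. apply euclid_bound; auto.
Qed.

Lemma euclid_axis n : forall a b c d r, 0 <= r ->
  euclid sg n a b c d r 0 = 0 /\ euclid sg n a b c d 0 r = 0.
Proof.
  induction n as [|n IH]; intros a b c d r Hr; simpl; [lra|].
  split.
  - destruct Rle_dec; [|lra]. rewrite Rminus_0_r.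
    destruct (IH a b (a + c)%Z (b + d)%Z r Hr) as (-> & _). ring.
  - destruct Rle_dec.
    + assert (r = 0) by lra. subst r. rewrite Rminus_0_r.
      destruct (IH a b (a + c)%Z (b + d)%Z 0 Hr) as (-> & _). ring.
    + rewrite Rminus_0_r. destruct (IH (a + c)%Z (b + d)%Z c d r Hr) as (_ & ->). ring.
Qed.

Lemma euclid_sum_axis_l a b c d r : 0 <= r -> euclid_sum sg a b c d r 0 = 0.
Proof.
  intros Hr. apply euclid_sum_unique. apply is_lim_seq_ext with (2 := is_lim_seq_const 0).
  intros n. symmetry. apply euclid_axis; auto.
Qed.

Lemma euclid_sum_axis_r a b c d r : 0 <= r -> euclid_sum sg a b c d 0 r = 0.
Proof.
  intros Hr. apply euclid_sum_unique. apply is_lim_seq_ext with (2 := is_lim_seq_const 0).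
  intros n. symmetry. apply euclid_axis; auto.
Qed.

Lemma euclid_sum_step_l a b c d s t : 0 <= s -> 0 <= t ->
  euclid_sum sg a b c d (s + t) t =
  sg a b c d * ((s + t) * t) + euclid_sum sg a b (a + c) (b + d) s t.
Proof.
  intros Hs Ht. apply euclid_sum_unique. apply is_lim_seq_incr_1.
  apply is_lim_seq_ext with (fun n => sg a b c d * ((s + t) * t) + euclid sg n a b (a + c) (b +
      d) s t).
  - intros n. simpl. destruct Rle_dec; [|lra]. replace (s + t - t) with s by ring. ring.
  - apply is_lim_seq_plus'; [apply is_lim_seq_const|apply euclid_sum_lim; auto].
Qed.

Lemma euclid_sum_step_r a b c d s t : 0 <= s -> 0 <= t ->
  euclid_sum sg a b c d s (s + t) =
  sg a b c d * (s * (s + t)) + euclid_sum sg (a + c) (b + d) c d s t.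
Proof.
  intros Hs Ht. destruct Ht as [Ht|<-].
  - apply euclid_sum_unique. apply is_lim_seq_incr_1.
    apply is_lim_seq_ext with (fun n => sg a b c d * (s * (s + t)) + euclid sg n (a + c) (b +
        d) c d s t).
    + intros n. simpl. destruct Rle_dec; [lra|]. replace (s + t - s) with t by ring. ring.
    + apply is_lim_seq_plus'; [apply is_lim_seq_const|apply euclid_sum_lim; lra].
  (* For equal coordinates the algorithm takes the left branch, so the right rule is not literal
     here; both remainders lie on an axis and vanish. *)
  - rewrite Rplus_0_r. rewrite euclid_sum_axis_l by auto.
    replace s with (0 + s) at 1 by ring. rewrite euclid_sum_step_l by lra.
    rewrite euclid_sum_axis_r by auto. ring.
Qed.

Lemma euclid_scale n : forall a b c d s t l, 0 < l ->
  euclid sg n a b c d (l * s) (l * t) = l ^ 2 * euclid sg n a b c d s t.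
Proof.
  induction n as [|n IH]; intros a b c d s t l Hl; simpl euclid; [ring|].
  destruct (Rle_dec t s), (Rle_dec (l * t) (l * s)); try (exfalso; nra);
    rewrite <- Rmult_minus_distr_l, IH by auto; ring.
Qed.

Lemma euclid_sum_scale a b c d s t l : 0 < l -> 0 <= s -> 0 <= t ->
  euclid_sum sg a b c d (l * s) (l * t) = l ^ 2 * euclid_sum sg a b c d s t.
Proof.
  intros Hl Hs Ht. apply euclid_sum_unique.
  apply is_lim_seq_ext with (fun n => l ^ 2 * euclid sg n a b c d s t).
  - intros n. symmetry. apply euclid_scale; auto.
  - apply (is_lim_seq_scal_l _ (l ^ 2) (euclid_sum sg a b c d s t)), euclid_sum_lim; auto.
Qed.

Lemma euclid_opp n : forall a b c d s t,
  euclid sg n (- a) (- b) (- c) (- d) s t = euclid sg n a b c d s t.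
Proof.
  induction n as [|n IH]; intros a b c d s t; simpl euclid; auto.
  rewrite Hopp, sg_opp_r, <- !Z.opp_add_distr, !IH. reflexivity.
Qed.

Lemma euclid_sum_opp a b c d s t :
  euclid_sum sg (- a) (- b) (- c) (- d) s t = euclid_sum sg a b c d s t.
Proof.
  unfold euclid_sum. f_equal. apply Lim_seq_ext. intros n. apply euclid_opp.
Qed.

Lemma euclid_sum_diag a b c d : euclid_sum sg a b c d 1 1 = sg a b c d.
Proof.
  replace 1 with (0 + 1) at 1 by ring. rewrite euclid_sum_step_l by lra.
  rewrite euclid_sum_axis_r by lra. ring.
Qed.

(** * The topograph with prescribed parallelogram defects *)

(* Normalized to vanish at (1, 0), (0, 1) and (1, -1). *)
Definition topograph (x y : R) : R :=
  if Rle_dec 0 (x * y) then euclid_sum sg 1 0 0 1 (Rabs x) (Rabs y)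
  else euclid_sum sg 0 1 (-1) 0 (Rabs y) (Rabs x) - sg 1 0 0 1 * (Rabs x * Rabs y).

Lemma topograph_homogeneous2 : homogeneous2 topograph.
Proof.
  intros l x y. destruct (Req_EM_T l 0) as [->|Hl].
  - rewrite !Rmult_0_l. unfold topograph. rewrite Rmult_0_l, Rabs_R0.
    destruct Rle_dec; [|lra]. rewrite euclid_sum_axis_l by lra. ring.
  - assert (Hl' : 0 < Rabs l) by (apply Rabs_pos_lt; auto).
    assert (Hx := Rabs_pos x). assert (Hy := Rabs_pos y).
    assert (0 < l ^ 2) by (apply pow2_gt_0; auto).
    assert (E : l * x * (l * y) = l ^ 2 * (x * y)) by ring.
    unfold topograph. rewrite E, !Rabs_mult, !euclid_sum_scale, pow2_abs by auto.
    destruct (Rle_dec 0 (x * y)), (Rle_dec 0 (l ^ 2 * (x * y))); try (exfalso; nra).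
    + ring.
    + rewrite <- (pow2_abs l). ring.
Qed.

Lemma topograph_bound x y : Rabs (topograph x y) <= 2 * K * (x ^ 2 + y ^ 2).
Proof.
  assert (Hx := Rabs_pos x). assert (Hy := Rabs_pos y). assert (K0 := sg_K_pos).
  assert (Ex := pow2_abs x). assert (Ey := pow2_abs y).
  unfold topograph. destruct Rle_dec.
  - eapply Rle_trans; [apply euclid_sum_bound; auto|]. rewrite Ex, Ey. nra.
  - eapply Rle_trans; [apply Rabs_triang|]. rewrite Rabs_Ropp, Rabs_mult.
    assert (A := euclid_sum_bound 0 1 (-1) 0 (Rabs y) (Rabs x) Hy Hx). rewrite Ex, Ey in A.
    assert (B := HK 1 0 0 1). rewrite (Rabs_right (Rabs x * Rabs y)) by nra.
    assert (Rabs (sg 1 0 0 1) * (Rabs x * Rabs y) <= K * (Rabs x * Rabs y))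
        by (apply Rmult_le_compat_r; [nra|auto]).
    assert (K * (Rabs x * Rabs y) <= K * (x ^ 2 + y ^ 2)) by (apply Rmult_le_compat_l; nra).
    lra.
Qed.

Notation F a b := (topograph (IZR a) (IZR b)).

Lemma topograph_opp x y : topograph (- x) (- y) = topograph x y.
Proof.
  replace (- x) with (-1 * x) by ring. replace (- y) with (-1 * y) by ring.
  rewrite topograph_homogeneous2. ring.
Qed.

(* The quadratic form takes the values of F at u = (a, b), v = (c, d) and u - v. *)
Definition expansion (a b c d : Z) : Prop := forall s t, 0 <= s -> 0 <= t ->
  topograph (s * IZR a + t * IZR c) (s * IZR b + t * IZR d) =
  F a b * s ^ 2 + F c d * t ^ 2 + (F a b + F c d - F (a - c) (b - d)) * (s * t) +
  euclid_sum sg a b c d s t.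

Lemma expansion_defect a b c d : expansion a b c d ->
  F (a + c) (b + d) = 2 * F a b + 2 * F c d - F (a - c) (b - d) + sg a b c d.
Proof.
  intros H. assert (A := H 1 1 ltac:(lra) ltac:(lra)).
  rewrite euclid_sum_diag, !Rmult_1_l, <- !plus_IZR in A.
  rewrite A. ring.
Qed.

Lemma expansion_opp a b c d : expansion a b c d -> expansion (- a) (- b) (- c) (- d).
Proof.
  intros H s t Hs Ht. rewrite euclid_sum_opp.
  replace (- a - - c)%Z with (- (a - c))%Z by ring.
  replace (- b - - d)%Z with (- (b - d))%Z by ring.
  rewrite !opp_IZR, !topograph_opp.
  replace (s * - IZR a + t * - IZR c) with (- (s * IZR a + t * IZR c)) by ring.
  replace (s * - IZR b + t * - IZR d) with (- (s * IZR b + t * IZR d)) by ring.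
  rewrite topograph_opp. apply H; auto.
Qed.

(** The quadratic forms attached to the old and the new basis agree at u = (a, b) and v = (c, d) and
    differ at u + v by [sg a b c d]. So they differ by this number times the product of the old
    coordinates, which is the term split off the series. *)
Lemma expansion_left a b c d : expansion a b c d -> expansion a b (a + c) (b + d).
Proof.
  intros H s t Hs Ht.
  replace (s * IZR a + t * IZR (a + c))
      with ((s + t) * IZR a + t * IZR c) by (rewrite plus_IZR; ring).
  replace (s * IZR b + t * IZR (b + d))
      with ((s + t) * IZR b + t * IZR d) by (rewrite plus_IZR; ring).
  rewrite H, euclid_sum_step_l by lra.
  replace (a - (a + c))%Z with (- c)%Z by ring. replace (b - (b + d))%Z with (- d)%Z by ring.
  rewrite !opp_IZR, topograph_opp, (expansion_defect a b c d H). ring.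
Qed.

Lemma expansion_right a b c d : expansion a b c d -> expansion (a + c) (b + d) c d.
Proof.
  intros H s t Hs Ht.
  replace (s * IZR (a + c) + t * IZR c)
      with (s * IZR a + (s + t) * IZR c) by (rewrite plus_IZR; ring).
  replace (s * IZR (b + d) + t * IZR d)
      with (s * IZR b + (s + t) * IZR d) by (rewrite plus_IZR; ring).
  rewrite H, euclid_sum_step_r by lra.
  replace (a + c - c)%Z with a by ring. replace (b + d - d)%Z with b by ring.
  rewrite (expansion_defect a b c d H). ring.
Qed.

(* The cone beyond an edge is the union of the cones beyond the two other sides of
   the next triangle. *)
Lemma expansion_merge a b c d :
  expansion a b (a + c) (b + d) -> expansion (a + c) (b + d) c d ->
  F (a + c) (b + d) = 2 * F a b + 2 * F c d - F (a - c) (b - d) + sg a b c d ->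
  expansion a b c d.
Proof.
  intros H1 H2 E s t Hs Ht. destruct (Rle_dec t s) as [L|L].
  - replace s with ((s - t) + t) by ring. rewrite euclid_sum_step_l by lra.
    assert (A := H1 (s - t) t ltac:(lra) Ht).
    replace (a - (a + c))%Z with (- c)%Z in A by ring.
    replace (b - (b + d))%Z with (- d)%Z in A by ring.
    rewrite !opp_IZR, topograph_opp, E in A.
    replace ((s - t) * IZR a + t * IZR (a + c))
        with ((s - t + t) * IZR a + t * IZR c) in A by (rewrite plus_IZR; ring).
    replace ((s - t) * IZR b + t * IZR (b + d))
        with ((s - t + t) * IZR b + t * IZR d) in A by (rewrite plus_IZR; ring).
    rewrite A. ring.
  - replace t with (s + (t - s)) by ring. rewrite euclid_sum_step_r by lra.
    assert (A := H2 s (t - s) Hs ltac:(lra)).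
    replace (a + c - c)%Z with a in A by ring. replace (b + d - d)%Z with b in A by ring.
    rewrite E in A.
    replace (s * IZR (a + c) + (t - s) * IZR c)
        with (s * IZR a + (s + (t - s)) * IZR c) in A by (rewrite plus_IZR; ring).
    replace (s * IZR (b + d) + (t - s) * IZR d)
        with (s * IZR b + (s + (t - s)) * IZR d) in A by (rewrite plus_IZR; ring).
    rewrite A. ring.
Qed.

(** The two cones together with their negatives cover the plane. Both are needed for invariance
    under SL(2, Z): replacing u, v by u, u + v shrinks one cone and enlarges the other. *)
Definition expansions (a b c d : Z) : Prop :=
  expansion a b c d /\ expansion c d (- a) (- b).

Lemma expansions_quarter a b c d : expansions a b c d -> expansions c d (- a) (- b).
Proof. intros (H1 & H2). split; auto. apply expansion_opp; auto. Qed.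

Lemma expansions_opp a b c d : expansions a b c d -> expansions (- a) (- b) (- c) (- d).
Proof. intros (H1 & H2). split; apply expansion_opp; auto. Qed.

Lemma expansions_left a b c d : expansions a b c d -> expansions a b (a + c) (b + d).
Proof.
  intros (H1 & H2). split; [apply expansion_left; auto|].
  (* The vector v cuts the enlarged cone over u + v and -u into a part of the first old cone and the
     whole second one. *)
  apply expansion_merge.
  - replace (a + c + - a)%Z with c by ring. replace (b + d + - b)%Z with d by ring.
    apply expansion_right; auto.
  - replace (a + c + - a)%Z with c by ring. replace (b + d + - b)%Z with d by ring. auto.
  - assert (A := expansion_defect _ _ _ _ (expansion_left _ _ _ _ H1)).
    replace (a + c + - a)%Z with c by ring. replace (b + d + - b)%Z with d by ring.
    replace (a + c - - a)%Z with (a + (a + c))%Z by ring.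
    replace (b + d - - b)%Z with (b + (b + d))%Z by ring.
    replace (a - (a + c))%Z with (- c)%Z in A by ring.
    replace (b - (b + d))%Z with (- d)%Z in A by ring.
    rewrite sg_opp_r, Hswap, A, !opp_IZR, !topograph_opp. ring.
Qed.

Lemma expansions_right a b c d : expansions a b c d -> expansions (a + c) (b + d) c d.
Proof.
  intros (H1 & H2). split; [apply expansion_right; auto|].
  apply expansion_merge.
  - replace (c + - (a + c))%Z with (- a)%Z by ring.
    replace (d + - (b + d))%Z with (- b)%Z by ring. auto.
  - replace (c + - (a + c))%Z with (- a)%Z by ring.
    replace (d + - (b + d))%Z with (- b)%Z by ring.
    apply expansion_opp, expansion_left; auto.
  - assert (A := expansion_defect _ _ _ _ (expansion_right _ _ _ _ H1)).
    replace (c + - (a + c))%Z with (- a)%Z by ring.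
    replace (d + - (b + d))%Z with (- b)%Z by ring.
    replace (c - - (a + c))%Z with (a + c + c)%Z by ring.
    replace (d - - (b + d))%Z with (b + d + d)%Z by ring.
    replace (a + c - c)%Z with a in A by ring. replace (b + d - d)%Z with b in A by ring.
    rewrite sg_opp_r, Hswap, A, !opp_IZR, !topograph_opp. ring.
Qed.

(** The inverse of the right shear is the left shear conjugated by a quarter turn. *)
Lemma expansions_right_inv a b c d : expansions a b c d -> expansions (a - c) (b - d) c d.
Proof.
  intros H. apply expansions_quarter, expansions_left, expansions_quarter, expansions_opp in H.
  replace (a - c)%Z with (- (c + - a))%Z by ring. replace (b - d)%Z with (- (d + - b))%Z by ring.
  rewrite !Z.opp_involutive in H. exact H.
Qed.

Lemma expansions_shear a b c d k : expansions a b c d -> expansions (a + k * c) (b + k * d) c d.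
Proof.
  intros H. induction k using Z.peano_ind.
  - replace (a + 0 * c)%Z with a by ring. replace (b + 0 * d)%Z with b by ring. auto.
  - apply expansions_right in IHk.
    replace (a + Z.succ k * c)%Z with (a + k * c + c)%Z by lia.
    replace (b + Z.succ k * d)%Z with (b + k * d + d)%Z by lia. auto.
  - apply expansions_right_inv in IHk.
    replace (a + Z.pred k * c)%Z with (a + k * c - c)%Z by lia.
    replace (b + Z.pred k * d)%Z with (b + k * d - d)%Z by lia. auto.
Qed.

Lemma topograph_axis_l x : topograph x 0 = 0.
Proof.
  unfold topograph. rewrite Rmult_0_r, Rabs_R0. destruct Rle_dec; [|lra].
  apply euclid_sum_axis_l, Rabs_pos.
Qed.

Lemma topograph_axis_r x : topograph 0 x = 0.
Proof.
  unfold topograph. rewrite Rmult_0_l, Rabs_R0. destruct Rle_dec; [|lra].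
  apply euclid_sum_axis_r, Rabs_pos.
Qed.

Lemma expansions_standard : expansions 1 0 0 1.
Proof.
  assert (S0 : sg 0 1 (-1) 0 = sg 1 0 0 1).
  { rewrite Hswap. apply (Hopp 1 0 0 1). }
  split; intros s t Hs Ht.
  - change (1 - 0)%Z with 1%Z. change (0 - 1)%Z with (-1)%Z.
    rewrite topograph_axis_l, topograph_axis_r.
    replace (topograph 1 (-1)) with 0.
    + rewrite !Rmult_1_r, !Rmult_0_r, Rplus_0_l, Rplus_0_r.
      unfold topograph. destruct Rle_dec; [|nra]. rewrite !Rabs_right by lra. ring.
    + unfold topograph. destruct Rle_dec; [lra|].
      rewrite Rabs_R1, Rabs_left by lra. replace (- -1) with 1 by ring.
      rewrite euclid_sum_diag, S0. ring.
  - change (- (1))%Z with (-1)%Z. change (- 0)%Z with 0%Z. change (0 - -1)%Z with 1%Z.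
    change (1 - 0)%Z with 1%Z.
    rewrite topograph_axis_l, topograph_axis_r.
    replace (topograph 1 1) with (sg 1 0 0 1).
    + replace (s * 0 + t * -1) with (- t) by ring. replace (s * 1 + t * 0) with s by ring.
      unfold topograph. rewrite Rabs_Ropp, !Rabs_right by lra. destruct Rle_dec; [|ring].
      destruct Hs as [Hs|<-].
      * assert (t = 0) by nra. subst t. rewrite euclid_sum_axis_r, euclid_sum_axis_l by lra. ring.
      * rewrite euclid_sum_axis_r, euclid_sum_axis_l by lra. ring.
    + unfold topograph. destruct Rle_dec; [|lra]. rewrite Rabs_R1, euclid_sum_diag. reflexivity.
Qed.

(** Shears and quarter turns generate SL(2, Z): division of [a] by [c], followed by a quarter turn,
    decreases |c| until the basis is a shear of the standard one up to sign. *)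
Lemma expansions_all a b c d : det a b c d = 1%Z -> expansions a b c d.
Proof.
  remember (Z.to_nat (Z.abs c)) as n eqn:En. revert a b c d En.
  induction n as [n IH] using lt_wf_ind. intros a b c d En H.
  destruct (Z.eq_dec c 0) as [->|Hc].
  - unfold det in H. assert (U : expansions 1 (a * b) 0 1).
    { replace 1%Z with (1 + a * b * 0)%Z at 1 by ring.
      replace (a * b)%Z with (0 + a * b * 1)%Z at 2 by ring.
      apply expansions_shear, expansions_standard. }
    assert (K' : (a = 1 /\ d = 1 \/ a = -1 /\ d = -1)%Z).
    { rewrite Z.mul_0_r, Z.sub_0_r in H. destruct (Z.mul_eq_1 _ _ H) as [-> | ->]; lia. }
    destruct K' as [(-> & ->)|(-> & ->)].
    + replace (1 * b)%Z with b in U by ring. exact U.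
    + apply expansions_opp in U. replace (- (-1 * b))%Z with b in U by ring. exact U.
  - set (k := (a / c)%Z). set (r := (a mod c)%Z).
    assert (Er : a = (r + k * c)%Z)
        by (unfold r, k; rewrite Z.add_comm, Z.mul_comm; apply Z.div_mod; auto).
    assert (Hr : (Z.abs r < Z.abs c)%Z) by (apply Z.mod_bound_abs; auto).
    assert (U : expansions c d (- r) (- (b - k * d))).
    { apply (IH (Z.to_nat (Z.abs (- r)))); [lia|reflexivity|].
      unfold det in *. rewrite <- H, Er. ring. }
    apply expansions_quarter, expansions_opp in U. rewrite !Z.opp_involutive in U.
    apply (expansions_shear _ _ _ _ k) in U. rewrite <- Er in U.
    replace (b - k * d + k * d)%Z with b in U by ring. exact U.
Qed.

End Euclid.

(** * From integers to the line *)

Lemma IZR_floor (x : R) : exists n : Z, IZR n <= x < IZR n + 1.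
Proof.
  exists (Int_part x). destruct (base_Int_part x). lra.
Qed.

(** The chord is enlarged to integer endpoints at distance D <= 3 (r - p), which is where [r - p]
    being at least 1 enters. Deviations from the large chord are at most 3/2 K D^2, and comparing
    the two chords gives 3 K D (r - p) <= 9 K (r - p)^2. *)
Lemma chord_bound_of_integers (g : R -> R) (K : R) : 0 <= K ->
  (forall p r, exists B, forall x, p <= x <= r -> Rabs (g x) <= B) ->
  (forall m j : Z, (0 <= j)%Z -> Rabs (second_diff g (IZR m) (IZR j)) <= K * IZR j) ->
  (forall (n : Z) x, IZR n <= x <= IZR n + 1 -> Rabs (chord_dev g (IZR n) x (IZR n + 1)) <= K) ->
  chord_bound 1 (9 * K) g.
Proof.
  intros K0 Hb Hint Hunit.
  assert (Z1 : forall p q r : Z, (p < r)%Z -> (p <= q <= r)%Z ->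
     Rabs (chord_dev g (IZR p) (IZR q) (IZR r)) <= K / 2 * (IZR r - IZR p) ^ 2).
  { intros p q r Hpr Hq.
    apply (chord_dev_bound (fun x => exists n, x = IZR n)); eauto.
    - apply IZR_lt; auto.
    - intros x (n & ->) _. split; [exists (2 * n - p)%Z|exists (2 * n - r)%Z];
          rewrite minus_IZR, mult_IZR; ring.
    - destruct (Hb (IZR p) (IZR r)) as (B & HB). exists B. auto.
    - intros x t (n & ->) Ht _ _ (n' & E) _.
      assert (Et : t = IZR (n' - n)) by (rewrite minus_IZR, <- E; ring).
      rewrite Et in *. apply Hint. apply le_IZR; auto.
    - destruct Hq; split; apply IZR_le; auto. }
  assert (Pos : forall p q r, 1 <= r - p -> p <= q <= r ->
      Rabs (chord_dev g p q r) <= 9 * K * (r - p) ^ 2).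
  { intros p q r Hpr Hq.
    destruct (IZR_floor p) as (P & HP). destruct (IZR_floor r) as (R0 & HR).
    set (D := IZR R0 + 1 - IZR P).
    assert (HD : 1 <= D <= 3 * (r - p)) by (unfold D; lra).
    assert (E1 : IZR (R0 + 1) = IZR R0 + 1) by (rewrite plus_IZR; auto).
    set (dev := fun x => chord_dev g (IZR P) x (IZR (R0 + 1))).
    assert (Hdev : forall x, p <= x <= r -> Rabs (dev x) <= 3 / 2 * K * D ^ 2).
    { intros x Hx. destruct (IZR_floor x) as (n & Hn).
      assert (Pn : (P <= n)%Z). { apply Z.lt_succ_r, lt_IZR. rewrite succ_IZR. lra. }
      assert (nR : (n <= R0)%Z). { apply Z.lt_succ_r, lt_IZR. rewrite succ_IZR. lra. }
      assert (A1 := Z1 P n (R0 + 1)%Z ltac:(lia) ltac:(lia)).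
      assert (A2 := Z1 P (n + 1)%Z (R0 + 1)%Z ltac:(lia) ltac:(lia)).
      assert (A3 := Hunit n x ltac:(lra)).
      fold (dev (IZR n)) in A1. fold (dev (IZR (n + 1))) in A2.
      replace (IZR (R0 + 1) - IZR P) with D in A1, A2 by (unfold D; lra).
      (* Interpolate the deviation between the neighbouring integers and add the deviation from the
         chord over the unit interval. *)
      assert (E : dev x = (IZR n + 1 - x) * dev (IZR n) + (x - IZR n) * dev (IZR (n + 1)) +
                 D * chord_dev g (IZR n) x (IZR n + 1)).
      { unfold dev, chord_dev, D. rewrite E1, plus_IZR. ring. }
      apply Rabs_le_iff in A1, A2, A3. apply Rabs_le_iff. rewrite E.
      set (M := K / 2 * D ^ 2) in *.
      assert (- ((IZR n + 1 - x) * M) <= (IZR n + 1 - x) * dev (IZR n) <=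
          (IZR n + 1 - x) * M) by (split; nra).
      assert (- ((x - IZR n) * M) <= (x - IZR n) * dev (IZR (n + 1)) <= (x - IZR n) * M)
          by (split; nra).
      assert (- (D * K) <= D * chord_dev g (IZR n) x (IZR n + 1) <= D * K) by (split; nra).
      assert (D * K <= K * D ^ 2) by nra.
      unfold M in *. lra. }
    assert (E : D * chord_dev g p q r = dev q * (r - p) - dev p * (r - q) - dev r * (q - p)).
    { unfold dev, chord_dev, D. rewrite E1. ring. }
    assert (B1 := Hdev p ltac:(lra)). assert (B2 := Hdev q ltac:(lra)).
    assert (B3 := Hdev r ltac:(lra)).
    apply Rabs_le_iff in B1, B2, B3. set (M := 3 / 2 * K * D ^ 2) in *.
    assert (- (M * (r - p)) <= dev q * (r - p) <= M * (r - p)) by (split; nra).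
    assert (- (M * (r - q)) <= dev p * (r - q) <= M * (r - q)) by (split; nra).
    assert (- (M * (q - p)) <= dev r * (q - p) <= M * (q - p)) by (split; nra).
    assert (Q : Rabs (D * chord_dev g p q r) <= 2 * M * (r - p)) by (apply Rabs_le_iff; lra).
    rewrite Rabs_mult, (Rabs_right D) in Q by lra.
    apply Rmult_le_reg_l with D; [lra|]. eapply Rle_trans; [exact Q|].
    unfold M. assert (0 <= K * D * (r - p)) by (apply Rmult_le_pos; nra). nra. }
  intros p q r Hq Hpr. destruct (Rle_dec p r) as [L|L].
  - rewrite Rabs_right in Hpr by lra. apply Pos; auto. split; nra.
  - rewrite Rabs_left in Hpr by lra. rewrite chord_dev_rev, Rabs_Ropp.
    replace ((r - p) ^ 2) with ((p - r) ^ 2) by ring. apply Pos; [lra|]. split; nra.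
Qed.

(** * Reduction to large quadruples *)

Lemma nearest_integer (x : R) : exists k : Z, Rabs (x - IZR k) <= / 2.
Proof.
  destruct (IZR_floor (x + / 2)) as (n & Hn). exists n. apply Rabs_le_iff. lra.
Qed.

(* Gauss reduction of the positive form e2^2 + f2^2: swapping after a reduction modulo
   the shorter vector halves it as long as it exceeds twice the determinant. *)
Lemma lattice_reduction (n : nat) : forall e1 e2 f1 f2, rdet e1 e2 f1 f2 <> 0 ->
  e2 ^ 2 + f2 ^ 2 <= 2 ^ n * (2 * Rabs (rdet e1 e2 f1 f2)) ->
  exists (a b c d : Z) x y x' y', det a b c d = 1%Z /\
    e1 = x * IZR a + y * IZR c /\ e2 = x * IZR b + y * IZR d /\
    f1 = x' * IZR a + y' * IZR c /\ f2 = x' * IZR b + y' * IZR d /\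
    rdet x y x' y' = rdet e1 e2 f1 f2 /\
    1 * (y ^ 2 + y' ^ 2) <= 2 * Rabs (rdet e1 e2 f1 f2).
Proof.
  assert (Done : forall e1 e2 f1 f2, e2 ^ 2 + f2 ^ 2 <= 2 * Rabs (rdet e1 e2 f1 f2) ->
    exists (a b c d : Z) x y x' y', det a b c d = 1%Z /\
    e1 = x * IZR a + y * IZR c /\ e2 = x * IZR b + y * IZR d /\
    f1 = x' * IZR a + y' * IZR c /\ f2 = x' * IZR b + y' * IZR d /\
    rdet x y x' y' = rdet e1 e2 f1 f2 /\
    1 * (y ^ 2 + y' ^ 2) <= 2 * Rabs (rdet e1 e2 f1 f2)).
  { intros e1 e2 f1 f2 H. exists 1%Z, 0%Z, 0%Z, 1%Z, e1, e2, f1, f2.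
    repeat split; auto; try ring. lra. }
  induction n as [|n IH]; intros e1 e2 f1 f2 HD H.
  - apply Done. simpl in H. lra.
  - destruct (Rle_dec (e2 ^ 2 + f2 ^ 2) (2 * Rabs (rdet e1 e2 f1 f2))) as [L|L]; [apply Done;
        auto|].
    set (D := rdet e1 e2 f1 f2) in *. set (N := e2 ^ 2 + f2 ^ 2) in *.
    assert (AD : 0 < Rabs D) by (apply Rabs_pos_lt; auto).
    destruct (nearest_integer ((e1 * e2 + f1 * f2) / N)) as (k & Hk).
    set (g1 := e1 - IZR k * e2). set (h1 := f1 - IZR k * f2).
    assert (EB : g1 * e2 + h1 * f2 = N * ((e1 * e2 + f1 * f2) / N - IZR k)).
    { unfold g1, h1. replace (N * _) with (e1 * e2 + f1 * f2 - N * IZR k) by (field; lra).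
      unfold N. ring. }
    (* Lagrange's identity in the lattice spanned by (e1, f1) and (e2, f2). Rounding bounds the
       inner product by N / 2, and |D| < N / 2 as long as the reduction is not finished; together
       this gives N / 2. *)
    assert (EL : (g1 ^ 2 + h1 ^ 2) * N = (g1 * e2 + h1 * f2) ^ 2 + D ^ 2).
    { unfold g1, h1, N, D, rdet. ring. }
    assert (HN : g1 ^ 2 + h1 ^ 2 <= N / 2).
    { apply Rmult_le_reg_r with N; [lra|]. rewrite EL, EB.
      set (z := (e1 * e2 + f1 * f2) / N - IZR k) in *.
      assert (z ^ 2 <= / 4). { rewrite <- (pow2_abs z). assert (0 <= Rabs z) by apply Rabs_pos.
      nra. }
      assert (D ^ 2 <= N ^ 2 / 4). { rewrite <- (pow2_abs D). nra. }
      assert (N ^ 2 * z ^ 2 <= N ^ 2 * / 4) by (apply Rmult_le_compat_l; [nra|auto]).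
      nra. }
    assert (ED : rdet (- e2) g1 (- f2) h1 = D) by (unfold g1, h1, D, rdet; ring).
    destruct (IH (- e2) g1 (- f2) h1) as (a & b & c & d & x & y & x' & y' & K1 & K2 & K3 & K4 &
        K5 & K6 & K7).
    + rewrite ED; auto.
    + rewrite ED. simpl pow in H |- *. simpl pow in HN. lra.
    + rewrite ED in K6, K7.
      (* The shear by [k] and the quarter turn are undone on the integer basis; the coordinates stay
         the same. *)
      exists (b - k * a)%Z, (- a)%Z, (d - k * c)%Z, (- c)%Z, x, y, x', y'.
      split; [transitivity (det a b c d); [unfold det; ring|auto]|].
      rewrite !minus_IZR, !opp_IZR, !mult_IZR.
      assert (e1 = g1 + IZR k * e2) by (unfold g1; ring).
      assert (f1 = h1 + IZR k * f2) by (unfold h1; ring).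
      assert (E2 : e2 = - (x * IZR a + y * IZR c)) by lra.
      assert (F2 : f2 = - (x' * IZR a + y' * IZR c)) by lra.
      repeat split; auto; try lra.
      * rewrite H0, K3, E2. ring.
      * rewrite H1, K5, F2. ring.
Qed.

Lemma pow2_unbounded (x : R) : exists n : nat, x <= 2 ^ n.
Proof.
  destruct (Pow_x_infinity 2 ltac:(rewrite Rabs_right; lra) x) as (n & Hn).
  exists n. specialize (Hn n (le_n n)). rewrite Rabs_right in Hn; [lra|].
  apply Rle_ge, pow_le; lra.
Qed.

(** In a reduced basis the quadruple satisfies the size condition with [delta = 1]. Growth gives
    local boundedness of the chart, the cone estimate its deviations on unit intervals, and the fan
    estimate its second differences at integers. The constant 81 is 9 from integers to chords times
    9 from chords to the defect. *)
Lemma parallelogram_bound_of_integer_charts (F : R -> R -> R) (K : R) : homogeneous2 F ->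
    0 <= K ->
  (forall x y, Rabs (F x y) <= 2 * K * (x ^ 2 + y ^ 2)) ->
  (forall a b c d, det a b c d = 1%Z -> forall s t, 0 <= s -> 0 <= t ->
    Rabs (F (s * IZR a + t * IZR c) (s * IZR b + t * IZR d) -
      (F (IZR a) (IZR b) * s ^ 2 + F (IZR c) (IZR d) * t ^ 2 +
       (F (IZR a) (IZR b) + F (IZR c) (IZR d) - F (IZR (a - c)) (IZR (b - d))) * (s * t)))
      <= K * (s ^ 2 + t ^ 2)) ->
  (forall a b c d, det a b c d = 1%Z -> forall m j, (0 <= j)%Z ->
    Rabs (parallelogram F (IZR (m * a + c)) (IZR (m * b + d)) (IZR (j * a)) (IZR (j * b))) <=
        K * IZR j) ->
  forall e1 e2 f1 f2, rdet e1 e2 f1 f2 <> 0 ->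
    Rabs (parallelogram F e1 e2 f1 f2) <= 81 * K * Rabs (rdet e1 e2 f1 f2).
Proof.
  intros HF K0 Hb Hcone Hfan e1 e2 f1 f2 HD.
  destruct (pow2_unbounded ((e2 ^ 2 + f2 ^ 2) / (2 * Rabs (rdet e1 e2 f1 f2)))) as (n & Hn).
  assert (AD : 0 < Rabs (rdet e1 e2 f1 f2)) by (apply Rabs_pos_lt; auto).
  apply Rle_div_l in Hn; [|lra].
  destruct (lattice_reduction n e1 e2 f1 f2 HD Hn) as (a & b & c & d & x & y & x' & y' & K1 &
      K2 & K3 & K4 & K5 & K6 & K7).
  set (L := F (IZR a) (IZR b)).
  set (G := fun x y => F (x * IZR a + y * IZR c) (x * IZR b + y * IZR d) - L * x ^ 2).
  assert (EP : parallelogram F e1 e2 f1 f2 = parallelogram G x y x' y').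
  { unfold parallelogram, G.
    replace ((x + x') * IZR a + (y + y') * IZR c) with (e1 + f1) by (rewrite K2, K4; ring).
    replace ((x + x') * IZR b + (y + y') * IZR d) with (e2 + f2) by (rewrite K3, K5; ring).
    replace ((x - x') * IZR a + (y - y') * IZR c) with (e1 - f1) by (rewrite K2, K4; ring).
    replace ((x - x') * IZR b + (y - y') * IZR d) with (e2 - f2) by (rewrite K3, K5; ring).
    rewrite <- K2, <- K3, <- K4, <- K5. ring. }
  rewrite EP. rewrite <- K6 in *. replace (81 * K) with (9 * (9 * K)) by ring.
  apply parallelogram_bound with 1; auto; try lra.
  - intros l u v. unfold G.
    replace (l * u * IZR a + l * v * IZR c) with (l * (u * IZR a + v * IZR c)) by ring.
    replace (l * u * IZR b + l * v * IZR d) with (l * (u * IZR b + v * IZR d)) by ring.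
    rewrite HF. ring.
  - unfold G, L. rewrite !Rmult_1_l, !Rmult_0_l, !Rplus_0_r. ring.
  - apply chord_bound_of_integers; auto.
    + intros p r. set (m := Rmax (Rabs p) (Rabs r)).
      set (A := Rabs (IZR a) + Rabs (IZR b)). set (C := Rabs (IZR c) + Rabs (IZR d)).
      exists (2 * K * (2 * (m * A + C) ^ 2) + Rabs L * m ^ 2). intros u Hu.
      assert (Hum : Rabs u <= m).
      { unfold m. destruct (Rle_dec 0 u).
        - eapply Rle_trans; [|apply Rmax_r]. rewrite !Rabs_right; lra.
        - eapply Rle_trans; [|apply Rmax_l]. rewrite !Rabs_left; lra. }
      assert (Hu0 := Rabs_pos u).
      assert (Pa := Rabs_pos (IZR a)). assert (Pb := Rabs_pos (IZR b)).
      assert (Pc := Rabs_pos (IZR c)). assert (Pd := Rabs_pos (IZR d)).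
      assert (Lin : forall v w, 0 <= Rabs v <= A -> 0 <= Rabs w <= C ->
          (u * v + 1 * w) ^ 2 <= (m * A + C) ^ 2).
      { intros v w Hv Hw. rewrite <- (pow2_abs (u * v + 1 * w)). apply pow_incr.
        split; [apply Rabs_pos|].
        eapply Rle_trans; [apply Rabs_triang|]. rewrite Rmult_1_l, Rabs_mult.
        apply Rplus_le_compat; [|lra].
        apply Rmult_le_compat; lra. }
      assert (L1 := Lin (IZR a) (IZR c) ltac:(unfold A; lra) ltac:(unfold C; lra)).
      assert (L2 := Lin (IZR b) (IZR d) ltac:(unfold A; lra) ltac:(unfold C; lra)).
      unfold G. eapply Rle_trans; [apply Rabs_triang|]. rewrite Rabs_Ropp, Rabs_mult.
      apply Rplus_le_compat.
      * eapply Rle_trans; [apply Hb|]. apply Rmult_le_compat_l; lra.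
      * apply Rmult_le_compat_l; [apply Rabs_pos|]. rewrite <- RPow_abs. apply pow_incr; auto.
    + intros m j Hj.
      replace (second_diff _ _ _) with (parallelogram F (IZR (m * a + c)) (IZR (m * b +
          d)) (IZR (j * a)) (IZR (j * b))).
      * apply Hfan; auto.
      * unfold second_diff, parallelogram, G. rewrite !plus_IZR, !mult_IZR, !Rmult_1_l, HF.
        replace (IZR m * IZR a + IZR c + IZR j * IZR a)
            with ((IZR m + IZR j) * IZR a + IZR c) by ring.
        replace (IZR m * IZR b + IZR d + IZR j * IZR b)
            with ((IZR m + IZR j) * IZR b + IZR d) by ring.
        replace (IZR m * IZR a + IZR c - IZR j * IZR a)
            with ((IZR m - IZR j) * IZR a + IZR c) by ring.
        replace (IZR m * IZR b + IZR d - IZR j * IZR b)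
            with ((IZR m - IZR j) * IZR b + IZR d) by ring.
        unfold L. ring.
    + intros k u Hu.
      (* The unit interval from k to k + 1 is the section of the cone over (k + 1) u + v and k u +
         v. The difference of these vectors is u, so the value [L] in the quadratic form cancels
         against the [L * x ^ 2] subtracted in [G]. *)
      assert (A := Hcone ((k + 1) * a + c)%Z ((k + 1) * b + d)%Z (k * a + c)%Z (k * b + d)%Z).
      assert (E : det ((k + 1) * a + c) ((k + 1) * b + d) (k * a + c) (k * b + d) = 1%Z)
        by (transitivity (det a b c d); [unfold det; ring|auto]).
      specialize (A E (u - IZR k) (IZR k + 1 - u) ltac:(lra) ltac:(lra)).
      replace ((k + 1) * a + c - (k * a + c))%Z with a in A by ring.
      replace ((k + 1) * b + d - (k * b + d))%Z with b in A by ring.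
      rewrite !plus_IZR, !mult_IZR, !plus_IZR in A.
      replace ((u - IZR k) * ((IZR k + 1) * IZR a + IZR c) + (IZR k + 1 - u) * (IZR k * IZR a +
          IZR c))
        with (u * IZR a + 1 * IZR c) in A by ring.
      replace ((u - IZR k) * ((IZR k + 1) * IZR b + IZR d) + (IZR k + 1 - u) * (IZR k * IZR b +
          IZR d))
        with (u * IZR b + 1 * IZR d) in A by ring.
      apply Rle_trans with (K * ((u - IZR k) ^ 2 + (IZR k + 1 - u) ^ 2)).
      * eapply Rle_trans; [|exact A]. apply Req_le. f_equal.
        unfold chord_dev, G. rewrite !Rmult_1_l. unfold L. ring.
      * assert ((u - IZR k) ^ 2 + (IZR k + 1 - u) ^ 2 <= 1) by nra. nra.
Qed.

Lemma topograph_zygmund (sg : Z -> Z -> Z -> Z -> R) (K : R) :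
  (forall a b c d, Rabs (sg a b c d) <= K) ->
  (forall a b c d, sg a b c d = sg c d a b) ->
  (forall a b c d, sg (- a)%Z (- b)%Z c d = sg a b c d) ->
  (forall a b c d, det a b c d = 1%Z -> forall m k,
     Rabs (average (fun n => sg a b (n * a + c)%Z (n * b + d)%Z) m k) <= K) ->
  (forall a b c d, det a b c d = 1%Z ->
     parallelogram (topograph sg) (IZR a) (IZR b) (IZR c) (IZR d) = sg a b c d) /\
  forall e1 e2 f1 f2, rdet e1 e2 f1 f2 <> 0 ->
    Rabs (parallelogram (topograph sg) e1 e2 f1 f2) <= 81 * K * Rabs (rdet e1 e2 f1 f2).
Proof.
  intros HK Hswap Hopp Havg.
  assert (HF := topograph_homogeneous2 sg K HK).
  assert (Hex := expansions_all sg K HK Hswap Hopp).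
  assert (Hpar : forall a b c d, det a b c d = 1%Z ->
     parallelogram (topograph sg) (IZR a) (IZR b) (IZR c) (IZR d) = sg a b c d).
  { intros a b c d H. destruct (Hex a b c d H) as (E & _).
    apply (expansion_defect sg K HK) in E.
    unfold parallelogram. rewrite <- !plus_IZR, <- !minus_IZR, E. ring. }
  split; auto. apply parallelogram_bound_of_integer_charts; auto.
  - eapply sg_K_pos; eauto.
  - apply topograph_bound; auto.
  - intros a b c d H s t Hs Ht. destruct (Hex a b c d H) as (E & _).
    rewrite (E s t Hs Ht).
    replace (_ - _) with (euclid_sum sg a b c d s t) by ring.
    apply euclid_sum_bound; auto.
  - intros a b c d H m j Hj.
    destruct (Z.eq_dec j 0) as [->|Hj0].
    + unfold parallelogram. rewrite !Z.mul_0_l, Rminus_0_r, !Rplus_0_r, Rminus_0_r.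
      rewrite (topograph_axis_l sg) by auto. 
      replace (_ - _) with 0 by ring. rewrite Rabs_R0. lra.
    (* The average of radius k corresponds to the step k + 1, so [j = 0] had to be treated apart. *)
    + destruct (Z_of_nat_complete (j - 1)) as (k & Hk); [lia|].
      assert (Ej : j = (Z.of_nat k + 1)%Z) by lia.
      set (G := fun n : Z => topograph sg (IZR (n * a + c)) (IZR (n * b + d))).
      assert (S := average_second_difference (fun n => sg a b (n * a + c)%Z (n * b + d)%Z) G
         (topograph sg (IZR a) (IZR b)) m k).
      assert (E : parallelogram (topograph sg) (IZR (m * a + c)) (IZR (m * b +
          d)) (IZR (j * a)) (IZR (j * b)) =
        (INR k + 1) * average (fun n => sg a b (n * a + c)%Z (n * b + d)%Z) m k).
      { rewrite S.
        - unfold parallelogram, G. rewrite <- !plus_IZR, <- !minus_IZR.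
          replace (m * a + c + j * a)%Z with ((m + Z.of_nat k + 1) * a + c)%Z
              by (rewrite Ej; ring).
          replace (m * b + d + j * b)%Z with ((m + Z.of_nat k + 1) * b + d)%Z
              by (rewrite Ej; ring).
          replace (m * a + c - j * a)%Z with ((m - Z.of_nat k - 1) * a + c)%Z
              by (rewrite Ej; ring).
          replace (m * b + d - j * b)%Z with ((m - Z.of_nat k - 1) * b + d)%Z
              by (rewrite Ej; ring).
          rewrite (mult_IZR j a), (mult_IZR j b), HF, Ej, (plus_IZR (Z.of_nat k)),
              <- INR_IZR_INZ. ring.
        - intros n. rewrite <- (Hpar a b (n * a + c)%Z (n * b + d)%Z)
              by (transitivity (det a b c d); [unfold det; ring|auto]).
          unfold parallelogram, G. rewrite <- !plus_IZR, <- !minus_IZR.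
          replace (a + (n * a + c))%Z with ((n + 1) * a + c)%Z by ring.
          replace (b + (n * b + d))%Z with ((n + 1) * b + d)%Z by ring.
          replace (a - (n * a + c))%Z with (- ((n - 1) * a + c))%Z by ring.
          replace (b - (n * b + d))%Z with (- ((n - 1) * b + d))%Z by ring.
          rewrite !opp_IZR, (topograph_opp sg K HK). ring. }
      rewrite E, Ej, plus_IZR, <- INR_IZR_INZ, Rabs_mult.
      assert (0 <= INR k) by apply pos_INR. rewrite (Rabs_right (INR k + 1)) by lra.
      rewrite Rmult_comm. apply Rmult_le_compat_r; [lra|]. apply Havg; auto.
Qed.

(** Compare [g y] with the chord from x to x + eta or x - eta: first [eta] is chosen so that the
    deviation, at most [K * eta], is small, then [del] so that the chord itself varies little. *)
Lemma chord_bound_continuous (g : R -> R) (K : R) : 0 <= K -> chord_bound 0 K g -> forall x,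
    continuous g x.
Proof.
  intros K0 HC x. apply continuity_pt_filterlim. intros eps Heps.
  set (eta := eps / (2 * (K + 1))).
  assert (Heta : 0 < eta) by (apply Rdiv_lt_0_compat; lra).
  assert (Keta : K * eta < eps / 2).
  { unfold eta. apply Rlt_le_trans with ((K + 1) * (eps / (2 * (K + 1)))).
    - apply Rmult_lt_compat_r; [auto|lra].
    - apply Req_le. field. lra. }
  set (B := Rabs (g (x + eta) - g x) + Rabs (g (x - eta) - g x)).
  assert (HB1 := Rabs_pos (g (x + eta) - g x)). assert (HB2 := Rabs_pos (g (x - eta) - g x)).
  set (del := Rmin eta (eta * eps / (2 * (B + 1)))).
  assert (B0 : 0 <= B) by (unfold B; lra).
  assert (P : 0 < eta * eps / (2 * (B + 1))) by (apply Rdiv_lt_0_compat; nra).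
  exists del. split; [apply Rmin_glb_lt; auto|].
  intros y (_ & Hy). simpl in *. unfold Rdist in *.
  assert (Hy1 : Rabs (y - x) < eta) by (eapply Rlt_le_trans; [exact Hy|apply Rmin_l]).
  assert (Hy2 : Rabs (y - x) < eta * eps / (2 * (B + 1)))
      by (eapply Rlt_le_trans; [exact Hy|apply Rmin_r]).
  apply Rlt_div_r in Hy2; [|lra].
  assert (Main : forall z, Rabs (z - x) = eta -> 0 <= (y - x) * (z - y) ->
      Rabs (g z - g x) <= B ->
     Rabs (g y - g x) < eps).
  { intros z Hz Hord HzB.
    assert (A := HC x y z Hord (Rabs_pos _)).
    assert (E : (g y - g x) * (z - x) = chord_dev g x y z + (g z - g x) * (y - x))
        by (unfold chord_dev; ring).
    apply (f_equal Rabs) in E. rewrite Rabs_mult, Hz in E.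
    assert (T := Rabs_triang (chord_dev g x y z) ((g z - g x) * (y - x))).
    rewrite <- E, Rabs_mult in T. rewrite <- (pow2_abs (z - x)), Hz in A.
    assert (Rabs (g z - g x) * Rabs (y - x) <= B * Rabs (y - x))
        by (apply Rmult_le_compat_r; [apply Rabs_pos|auto]).
    assert (0 <= Rabs (y - x)) by apply Rabs_pos.
    apply Rmult_lt_reg_r with eta; auto. nra. }
  destruct (Rle_dec x y) as [L|L].
  - rewrite Rabs_right in Hy1 by lra. apply (Main (x + eta)).
    + replace (x + eta - x) with eta by ring. apply Rabs_right; lra.
    + nra.
    + unfold B. lra.
  - rewrite Rabs_left in Hy1 by lra. apply (Main (x - eta)).
    + replace (x - eta - x) with (- eta) by ring. rewrite Rabs_Ropp. apply Rabs_right; lra.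
    + nra.
    + unfold B. lra.
Qed.

(** [F] vanishes on both axes, so second differences in the two charts are defects at [(x, 1)],
    [(t, 0)] and at [(1, x)], [(0, t)], with determinant of size t. Together with local boundedness
    they also give continuity. *)
Lemma line_zygmund_of_parallelogram (F : R -> R -> R) (K B : R) : homogeneous2 F ->
  F 1 0 = 0 -> F 0 1 = 0 -> 0 <= B -> 0 < K ->
  (forall x y, Rabs (F x y) <= B * (x ^ 2 + y ^ 2)) ->
  (forall e1 e2 f1 f2, rdet e1 e2 f1 f2 <> 0 ->
    Rabs (parallelogram F e1 e2 f1 f2) <= K * Rabs (rdet e1 e2 f1 f2)) ->
  line_zygmund (fun x => F x 1) /\
  is_lim (fun x => F x 1 / x ^ 2) p_infty 0 /\ is_lim (fun x => F x 1 / x ^ 2) m_infty 0.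
Proof.
  intros HF F10 F01 HB HK Hb Hp.
  assert (A1 : forall t, F t 0 = 0).
  { intros t. replace t with (t * 1) by ring. replace 0 with (t * 0) at 1 by ring.
    rewrite HF, F10. ring. }
  assert (A2 : forall t, F 0 t = 0).
  { intros t. replace t with (t * 1) by ring. replace 0 with (t * 0) at 1 by ring.
    rewrite HF, F01. ring. }
  assert (S1 : forall x t, 0 <= t -> Rabs (second_diff (fun x => F x 1) x t) <= K * t).
  { intros x t [Ht|<-].
    - assert (Q := Hp x 1 t 0). unfold rdet, parallelogram in Q. rewrite A1 in Q.
      replace (x * 0 - 1 * t) with (- t) in Q by ring.
      rewrite Rabs_Ropp, (Rabs_right t) in Q by lra.
      rewrite Rplus_0_r, Rminus_0_r in Q. unfold second_diff.
      replace (_ - _) with (F (x + t) 1 + F (x - t) 1 - 2 * F x 1 - 2 * 0) by ring. apply Q; lra.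
    - unfold second_diff. rewrite Rplus_0_r, Rminus_0_r.
      replace (_ - _) with 0 by ring. rewrite Rabs_R0. lra. }
  assert (S2 : forall x t, 0 <= t -> Rabs (second_diff (fun x => F 1 x) x t) <= K * t).
  { intros x t [Ht|<-].
    - assert (Q := Hp 1 x 0 t). unfold rdet, parallelogram in Q. rewrite A2 in Q.
      replace (1 * t - x * 0) with t in Q by ring. rewrite (Rabs_right t) in Q by lra.
      rewrite Rplus_0_r, Rminus_0_r in Q. unfold second_diff.
      replace (_ - _) with (F 1 (x + t) + F 1 (x - t) - 2 * F 1 x - 2 * 0) by ring. apply Q; lra.
    - unfold second_diff. rewrite Rplus_0_r, Rminus_0_r.
      replace (_ - _) with 0 by ring. rewrite Rabs_R0. lra. }
  assert (Bd : forall g : R -> R, (forall x, Rabs (g x) <= B * (x ^ 2 + 1)) ->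
     forall p r, exists M, forall x, p <= x <= r -> Rabs (g x) <= M).
  { intros g Hg p r. exists (B * (p ^ 2 + r ^ 2 + 1)). intros x Hx. eapply Rle_trans; [apply Hg|].
    apply Rmult_le_compat_l; auto. destruct (Rle_dec 0 x); nra. }
  assert (C1 : forall x, continuous (fun x => F x 1) x).
  { apply chord_bound_continuous with (K / 2); [lra|].
    apply chord_bound_of_second_diff; auto; [lra|].
    apply Bd. intros x. eapply Rle_trans; [apply Hb|]. apply Req_le; ring. }
  assert (C2 : forall x, continuous (fun x => F 1 x) x).
  { apply chord_bound_continuous with (K / 2); [lra|].
    apply chord_bound_of_second_diff; auto; [lra|].
    apply Bd. intros x. eapply Rle_trans; [apply Hb|]. apply Req_le; ring. }
  assert (Inv : forall x, x <> 0 -> F x 1 / x ^ 2 = F 1 (/ x)).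
  { intros x Hx. replace (F x 1) with (F (x * 1) (x * / x)) by (f_equal; field; auto).
    rewrite HF. field; auto. }
  assert (Lp : is_lim (fun x => F x 1 / x ^ 2) p_infty 0).
  { apply is_lim_ext_loc with (fun x => F 1 (/ x)).
    - exists 0. intros x Hx. symmetry. apply Inv. lra.
    - rewrite <- F10. apply (is_lim_comp (fun y => F 1 y) Rinv p_infty (F 1 0) 0).
      + apply (is_lim_continuity (fun y => F 1 y)). apply continuity_pt_filterlim, C2.
      + apply (is_lim_inv (fun x => x) p_infty p_infty); [apply is_lim_id|discriminate].
      + exists 0. intros x Hx E. injection E. apply Rinv_neq_0_compat; lra. }
  assert (Lm : is_lim (fun x => F x 1 / x ^ 2) m_infty 0).
  { apply is_lim_ext_loc with (fun x => F 1 (/ x)).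
    - exists 0. intros x Hx. symmetry. apply Inv. lra.
    - rewrite <- F10. apply (is_lim_comp (fun y => F 1 y) Rinv m_infty (F 1 0) 0).
      + apply (is_lim_continuity (fun y => F 1 y)). apply continuity_pt_filterlim, C2.
      + apply (is_lim_inv (fun x => x) m_infty m_infty); [apply is_lim_id|discriminate].
      + exists 0. intros x Hx E. injection E. apply Rinv_neq_0_compat; lra. }
  split; [|split; auto]. split.
  - split; auto. exists 0. auto.
  - exists (fun y => F 1 y). split; [|split; auto].
    + intros x Hx. rewrite <- HF. f_equal; field; auto.
    + exists K. split; [auto|]. split; intros x t _ Ht; [apply S1|apply S2]; lra.
Qed.

(** * Fields on the circle *)

Lemma B_real (x : R) : B (RtoC x) = ((1 - x ^ 2) / (1 + x ^ 2), 2 * x / (1 + x ^ 2)).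
Proof.
  unfold B, Cdiv, Cinv, Cmult, Cplus, Cminus, Copp, Ci, RtoC; simpl.
  apply C_eq; simpl; field; repeat split; nra.
Qed.

(* The difference quotient of B at real points is 2 i / ((1 - i t) (1 - i x)). *)
Lemma C_derive_B (x : R) :
  C_derive B (RtoC x) = (- 4 * x / (1 + x ^ 2) ^ 2, 2 * (1 - x ^ 2) / (1 + x ^ 2) ^ 2).
Proof.
  assert (Q : forall t, t <> x -> ((B (RtoC t) - B (RtoC x)) / (RtoC t - RtoC x))%C =
    (- 2 * (t + x) / ((1 + t ^ 2) * (1 + x ^ 2)), 2 * (1 - t * x) / ((1 + t ^ 2) * (1 + x ^ 2)))).
  { intros t Ht. rewrite !B_real.
    unfold Cdiv, Cinv, Cmult, Cplus, Cminus, Copp, RtoC; simpl.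
    assert (0 < (t - x) * (t - x)) by (apply Rsqr_pos_lt; lra).
    apply C_eq; simpl; field; repeat split; nra. }
  unfold C_derive, C_lim. change (fst (RtoC x)) with x. change (snd (RtoC x)) with 0. f_equal.
  - transitivity (real (Finite (- 2 * (x + x) / ((1 + x ^ 2) * (1 + x ^ 2))))); [f_equal;
        apply is_lim_unique|].
    +
      apply is_lim_ext_loc with (fun t => - 2 * (t + x) / ((1 + t ^ 2) * (1 + x ^ 2))).
      * exists (mkposreal 1 Rlt_0_1). intros t _ Ht. change (t, 0) with (RtoC t). rewrite Q; auto.
      * apply (is_lim_continuity (fun t => - 2 * (t + x) / ((1 + t ^ 2) * (1 + x ^ 2)))).
        apply continuity_pt_filterlim, (ex_derive_continuous (fun t => - 2 * (t + x) / ((1 +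
            t ^ 2) * (1 + x ^ 2)))).
        auto_derive. nra.
    + simpl. field. nra.
  - transitivity (real (Finite (2 * (1 - x * x) / ((1 + x ^ 2) * (1 + x ^ 2))))); [f_equal;
        apply is_lim_unique|].
    +
      apply is_lim_ext_loc with (fun t => 2 * (1 - t * x) / ((1 + t ^ 2) * (1 + x ^ 2))).
      * exists (mkposreal 1 Rlt_0_1). intros t _ Ht. change (t, 0) with (RtoC t). rewrite Q; auto.
      * apply (is_lim_continuity (fun t => 2 * (1 - t * x) / ((1 + t ^ 2) * (1 + x ^ 2)))).
        apply continuity_pt_filterlim, (ex_derive_continuous (fun t => 2 * (1 - t * x) / ((1 +
            t ^ 2) * (1 + x ^ 2)))).
        auto_derive. nra.
    + simpl. field. nra.
Qed.

Lemma is_lim_Rinv_infty (h : R -> R) (p : Rbar) : p = p_infty \/ p = m_infty ->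
  continuous h 0 -> is_lim (fun x => h (/ x)) p (h 0).
Proof.
  intros Hp Hh.
  apply (is_lim_comp h Rinv p (h 0) 0).
  - apply (is_lim_continuity h). apply continuity_pt_filterlim, Hh.
  - destruct Hp as [-> | ->].
    + apply (is_lim_inv (fun x => x) p_infty p_infty); [apply is_lim_id|discriminate].
    + apply (is_lim_inv (fun x => x) m_infty m_infty); [apply is_lim_id|discriminate].
  - destruct Hp as [-> | ->]; exists 0; intros x Hx E; injection E; apply Rinv_neq_0_compat; lra.
Qed.

(** The derivative of [B] is 2 i / (1 - i x)^2, asymptotic to -2 i / x^2. *)
Lemma pushforward_limits (W : R -> R) (L : R) (p : Rbar) : p = p_infty \/ p = m_infty ->
  is_lim (fun x => W x / x ^ 2) p L ->
  is_lim (fun x => fst (C_derive B (RtoC x) * RtoC (W x))%C) p 0 /\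
  is_lim (fun x => snd (C_derive B (RtoC x) * RtoC (W x))%C) p (- 2 * L).
Proof.
  intros Hp HL.
  assert (Away : Rbar_locally' p (fun x => x <> 0)).
  { destruct Hp as [-> | ->]; exists 0; intros; lra. }
  split.
  - apply is_lim_ext_loc with (fun x => W x / x ^ 2 * (fun y => - 4 * y / (1 + y ^ 2) ^ 2) (/ x)).
    + refine (filter_imp _ _ _ Away). intros x Hx. rewrite C_derive_B. simpl. field.
      repeat split; first [assumption|nra].
    + assert (H := is_lim_Rinv_infty (fun y => - 4 * y / (1 + y ^ 2) ^ 2) p Hp).
      assert (A := is_lim_mult _ _ p _ _ HL (H ltac:(apply (ex_derive_continuous (fun y => -
          4 * y / (1 + y ^ 2) ^ 2)); auto_derive; nra)) I).
      simpl Rbar_mult in A. replace (L * _) with 0 in A; [exact A|]. field.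
  - apply is_lim_ext_loc with (fun x => W x / x ^ 2 * (fun y => 2 * (y ^ 2 - 1) / (1 +
        y ^ 2) ^ 2) (/ x)).
    + refine (filter_imp _ _ _ Away). intros x Hx. rewrite C_derive_B. simpl. field.
      repeat split; first [assumption|nra].
    + assert (H := is_lim_Rinv_infty (fun y => 2 * (y ^ 2 - 1) / (1 + y ^ 2) ^ 2) p Hp).
      assert (A := is_lim_mult _ _ p _ _ HL (H ltac:(apply (ex_derive_continuous (fun y => 2 *
          (y ^ 2 - 1) / (1 + y ^ 2) ^ 2)); auto_derive; nra)) I).
      simpl Rbar_mult in A. replace (L * _) with (- 2 * L) in A; [exact A|]. field.
Qed.

Lemma filterlim_C (f : R -> C) (l : C) (p : Rbar) : p = p_infty \/ p = m_infty ->
  (filterlim f (Rbar_locally p) (locally l) <->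
   is_lim (fun x => fst (f x)) p (fst l) /\ is_lim (fun x => snd (f x)) p (snd l)).
Proof.
  intros Hp.
  assert (E : Rbar_locally' p = Rbar_locally p) by (destruct Hp as [-> | ->]; reflexivity).
  unfold is_lim. rewrite E. split.
  - intros H. split.
    + apply (filterlim_comp _ _ _ f fst _ (locally l)); auto. destruct l; apply continuous_fst.
    + apply (filterlim_comp _ _ _ f snd _ (locally l)); auto. destruct l; apply continuous_snd.
  - intros (H1 & H2). apply filterlim_locally. intros eps.
    apply (proj1 (filterlim_locally _ _)) with (eps := eps) in H1.
    apply (proj1 (filterlim_locally _ _)) with (eps := eps) in H2.
    assert (A := filter_and _ _ H1 H2). refine (filter_imp _ _ _ A). intros x (A1 & A2).
    split; auto.
Qed.

(* [y + i x], whose quotient by its conjugate is the point B (x / y). *)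
Definition spinor (x y : R) : C := (y, x).

Lemma B_ideal_frac (a b : Z) : (a <> 0 \/ b <> 0)%Z ->
  B_ideal (frac a b) = (spinor (IZR a) (IZR b) / Cconj (spinor (IZR a) (IZR b)))%C.
Proof.
  intros H. unfold frac. destruct Z.eq_dec as [->|Hb].
  - assert (Ha : IZR a <> 0) by (apply not_0_IZR; tauto).
    unfold spinor, Cconj, Cdiv, Cinv, Cmult; simpl. apply C_eq; simpl; field; nra.
  - apply not_0_IZR in Hb. simpl. rewrite B_real.
    unfold spinor, Cconj, Cdiv, Cinv, Cmult; simpl. 
    assert (0 < IZR b * IZR b) by (apply Rsqr_pos_lt; auto).
    apply C_eq; simpl; field; repeat split; nra.
Qed.

Lemma spinor_conj_nz (a b : Z) : (a <> 0 \/ b <> 0)%Z -> Cconj (spinor (IZR a) (IZR b)) <> 0%C.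
Proof.
  intros H E. injection E as E1 E2.
  destruct H as [H|H]; apply not_0_IZR in H; lra.
Qed.

(** The formula for [B_*] in homogeneous coordinates: 1 - i x is the conjugate spinor of (x, 1).
    Numerator and denominator have degree two, so the choice of representative is immaterial and
    infinity is an ordinary point. *)
Definition represents (F : R -> R -> R) (V : C -> C) : Prop :=
  forall a b : Z, (a <> 0 \/ b <> 0)%Z ->
    V (B_ideal (frac a b)) =
    (2 * Ci * RtoC (F (IZR a) (IZR b)) / Cconj (spinor (IZR a) (IZR b)) ^ 2)%C.

Lemma represents_pushforward (W : R -> R) (V : C -> C) (F : R -> R -> R) (L : R) :
  homogeneous2 F -> (forall x, F x 1 = W x) -> F 1 0 = L ->
  is_lim (fun x => W x / x ^ 2) p_infty L -> pushforward W V -> represents F V.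
Proof.
  intros HF FW FL HL (V1 & V2 & _) a b Hab. unfold frac. destruct Z.eq_dec as [->|Hb].
  - assert (Ha : IZR a <> 0) by (apply not_0_IZR; tauto).
    assert (E : V (B_ideal None) = (0, - 2 * L)).
    { apply filterlim_C in V2; [|auto]. destruct V2 as (A1 & A2).
      destruct (pushforward_limits W L p_infty) as (B1 & B2); auto.
      apply is_lim_unique in A1, A2, B1, B2. rewrite A1 in B1. rewrite A2 in B2.
      injection B1 as B1. injection B2 as B2. apply C_eq; auto. }
    rewrite E.
    replace (F (IZR a) (IZR 0)) with (IZR a ^ 2 * L).
    2: { rewrite <- FL, <- HF. f_equal; simpl; ring. }
    unfold spinor, Cconj, Cdiv, Cinv, Cmult, Cpow, Ci, RtoC, Cplus; simpl.
    apply C_eq; simpl; field; auto.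
  - apply not_0_IZR in Hb. simpl. rewrite V1, C_derive_B.
    rewrite (homogeneous2_slope F (IZR a) (IZR b)), FW by auto.
    assert (0 < IZR b * IZR b) by (apply Rsqr_pos_lt; auto).
    unfold spinor, Cconj, Cdiv, Cinv, Cmult, Cpow, Ci, RtoC, Cplus; simpl.
    apply C_eq; simpl; field; repeat split; nra.
Qed.

(* [Im z / (1 + Re z)] inverts B on the circle; at -1 the field is [0]. *)
Definition circle_field (W : R -> R) (z : C) : C :=
  if Req_EM_T (1 + Re z) 0 then 0%C
  else let x := Im z / (1 + Re z) in (C_derive B (RtoC x) * RtoC (W x))%C.

Lemma circle_field_B (W : R -> R) (x : R) :
  circle_field W (B (RtoC x)) = (C_derive B (RtoC x) * RtoC (W x))%C.
Proof.
  unfold circle_field.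
  assert (E1 : 1 + Re (B (RtoC x)) = 2 / (1 + x ^ 2)) by (rewrite B_real; simpl; field; nra).
  assert (E2 : Im (B (RtoC x)) = 2 * x / (1 + x ^ 2)) by (rewrite B_real; reflexivity).
  rewrite E1, E2.
  destruct Req_EM_T as [Z|_].
  - exfalso. revert Z. apply Rgt_not_eq, Rdiv_lt_0_compat; nra.
  - replace (2 * x / (1 + x ^ 2) / (2 / (1 + x ^ 2))) with x; [reflexivity|]. field. nra.
Qed.

Lemma circle_field_zygmund (W : R -> R) : line_zygmund W ->
  is_lim (fun x => W x / x ^ 2) p_infty 0 -> is_lim (fun x => W x / x ^ 2) m_infty 0 ->
  pushforward W (circle_field W) /\ circle_zygmund (circle_field W).
Proof.
  intros HW Lp Lm.
  assert (P : pushforward W (circle_field W)).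
  { assert (E : circle_field W (B_ideal None) = 0%C).
    { unfold circle_field. simpl. destruct Req_EM_T; [reflexivity|lra]. }
    split; [apply circle_field_B|]. rewrite E.
    split; apply filterlim_C; auto; simpl fst at 2; simpl snd at 2.
    - destruct (pushforward_limits W 0 p_infty) as (A1 & A2); auto.
      rewrite Rmult_0_r in A2. split; auto.
    - destruct (pushforward_limits W 0 m_infty) as (A1 & A2); auto.
      rewrite Rmult_0_r in A2. split; auto. }
  split; auto. split; [|exists W; auto].
  intros z Hz.
  assert (Hz2 : Re z ^ 2 + Im z ^ 2 = 1) by (rewrite <- Cmod2_alt, Hz; ring).
  destruct (Req_EM_T (1 + Re z) 0) as [Z|Z].
  - exists 0. unfold circle_field. destruct Req_EM_T; [|tauto]. ring.
  - set (x := Im z / (1 + Re z)).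
    assert (Ez : z = B (RtoC x)).
    { rewrite B_real. destruct z as [a b]. unfold x. simpl in *.
      assert (b * b = 1 - a * a) by lra.
      assert (0 < (1 + a) * (1 + a)) by (apply Rsqr_pos_lt; auto).
      assert ((1 + a) * (1 + a) + b * b <> 0) by nra.
      assert (D : 1 + (b / (1 + a)) ^ 2 = 2 / (1 + a)).
      { transitivity (((1 + a) * (1 + a) + b * b) / ((1 + a) * (1 + a))); [field; auto|].
        rewrite H. field; auto. }
      assert (D' : 1 - (b / (1 + a)) ^ 2 = 2 * a / (1 + a)).
      { transitivity (((1 + a) * (1 + a) - b * b) / ((1 + a) * (1 + a))); [field; auto|].
        rewrite H. field; auto. }
      simpl pow in D, D'. apply C_eq; simpl; rewrite D, ?D'; field; auto. }
    rewrite Ez, circle_field_B, C_derive_B, B_real. exists (2 * W x / (1 + x ^ 2)).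
    unfold Cmult, Ci, RtoC; apply C_eq; simpl; field; nra.
Qed.

(** * Shears of represented fields *)

Lemma spinor_pairing (a b c d : Z) :
  (spinor (IZR a) (IZR b) * Cconj (spinor (IZR c) (IZR d)) -
   spinor (IZR c) (IZR d) * Cconj (spinor (IZR a) (IZR b)) = 2 * Ci * RtoC (IZR (det a b c d)))%C.
Proof.
  unfold det. rewrite minus_IZR, !mult_IZR. apply C_eq; simpl; ring.
Qed.

(** By the pairing of spinors p - q equals 2 i det / (zp zq), and the factor 2 i cancels. *)
Lemma represents_quotient (F : R -> R -> R) (V : C -> C) (a b c d : Z) : represents F V ->
  unimodular a b c d ->
  let p := B_ideal (frac a b) in let q := B_ideal (frac c d) in
  let zp := Cconj (spinor (IZR a) (IZR b)) in let zq := Cconj (spinor (IZR c) (IZR d)) in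
  ((V p - V q) / (p - q) =
    (RtoC (F (IZR a) (IZR b)) * zq / zp - RtoC (F (IZR c) (IZR d)) *
        zp / zq) / RtoC (IZR (det a b c d)))%C.
Proof.
  intros HV U p q zp zq.
  assert (Na : (a <> 0 \/ b <> 0)%Z) by (unfold unimodular, det in U; lia).
  assert (Nc : (c <> 0 \/ d <> 0)%Z) by (unfold unimodular, det in U; lia).
  assert (Zp := spinor_conj_nz a b Na). assert (Zq := spinor_conj_nz c d Nc).
  fold zp in Zp. fold zq in Zq.
  unfold p, q. rewrite !HV, !B_ideal_frac by auto. fold zp zq.
  set (P := spinor (IZR a) (IZR b)). set (Q := spinor (IZR c) (IZR d)).
  assert (E := spinor_pairing a b c d). fold zp zq in E. fold P Q in E.
  assert (D : RtoC (IZR (det a b c d)) <> 0%C).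
  { intros Z. apply RtoC_inj in Z. apply eq_IZR in Z. unfold unimodular in U. lia. }
  assert (NI : (2 * Ci)%C <> 0%C).
  { intros Z. injection Z. intros; lra. }
  replace (P / zp - Q / zq)%C with ((P * zq - Q * zp) / (zp * zq))%C by (field; auto).
  rewrite E. field.
  repeat split; auto. intros Z. apply NI. rewrite Z. ring.
Qed.

(** Conjugate spinors are additive in the vector, so in the sum of the four quotients each value of
    [F] acquires an integer coefficient: (zu + zv) / (zu + zv) = 1 at u + v, and -2 zu / zu = -2 at
    u. *)
Lemma represents_shear (F : R -> R -> R) (V : C -> C) (a b c d : Z) :
  represents F V -> det a b c d = (-1)%Z ->
  let pa := B_ideal (frac (a - c) (b - d)) in let pb := B_ideal (frac a b) in
  let pc := B_ideal (frac (a + c) (b + d)) in let pd := B_ideal (frac c d) in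
  ((V pc - V pb) / (pc - pb) + (V pd - V pa) / (pd - pa)
    - (V pb - V pa) / (pb - pa) - (V pd - V pc) / (pd - pc))%C =
  RtoC (parallelogram F (IZR a) (IZR b) (IZR c) (IZR d)).
Proof.
  intros HV HD pa pb pc pd. unfold pa, pb, pc, pd. unfold det in HD.
  assert (D1 : det (a + c) (b + d) a b = 1%Z) by (unfold det; lia).
  assert (D2 : det c d (a - c) (b - d) = 1%Z) by (unfold det; lia).
  assert (D3 : det a b (a - c) (b - d) = 1%Z) by (unfold det; lia).
  assert (D4 : det c d (a + c) (b + d) = 1%Z) by (unfold det; lia).
  rewrite !(represents_quotient F V)
      by (auto; unfold unimodular; rewrite ?D1, ?D2, ?D3, ?D4; reflexivity).
  rewrite D1, D2, D3, D4.
  assert (Na : (a <> 0 \/ b <> 0)%Z) by lia. assert (Nc : (c <> 0 \/ d <> 0)%Z) by lia.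
  assert (Np : (a + c <> 0 \/ b + d <> 0)%Z) by (unfold det in D1; lia).
  assert (Nm : (a - c <> 0 \/ b - d <> 0)%Z) by (unfold det in D3; lia).
  assert (Zu := spinor_conj_nz a b Na). assert (Zv := spinor_conj_nz c d Nc).
  assert (Zp := spinor_conj_nz _ _ Np). assert (Zm := spinor_conj_nz _ _ Nm).
  assert (Ep : Cconj (spinor (IZR (a + c)) (IZR (b + d))) =
     (Cconj (spinor (IZR a) (IZR b)) + Cconj (spinor (IZR c) (IZR d)))%C).
  { rewrite !plus_IZR. apply C_eq; simpl; ring. }
  assert (Em : Cconj (spinor (IZR (a - c)) (IZR (b - d))) =
     (Cconj (spinor (IZR a) (IZR b)) - Cconj (spinor (IZR c) (IZR d)))%C).
  { rewrite !minus_IZR. apply C_eq; simpl; ring. }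
  rewrite Ep in *. rewrite Em in *.
  unfold parallelogram. rewrite <- !plus_IZR, <- !minus_IZR.
  set (u := Cconj (spinor (IZR a) (IZR b))) in *. set (v := Cconj (spinor (IZR c) (IZR d))) in *.
  rewrite !RtoC_minus, RtoC_plus, !RtoC_mult. field. auto.
Qed.

(** The signed area of a triangle inscribed in the circle is a positive multiple of the product of
    the three pairwise determinants. *)
Lemma ccw_sign (x1 y1 x2 y2 x3 y3 : Z) :
  (x1 <> 0 \/ y1 <> 0)%Z -> (x2 <> 0 \/ y2 <> 0)%Z -> (x3 <> 0 \/ y3 <> 0)%Z ->
  (ccw (B_ideal (frac x1 y1)) (B_ideal (frac x2 y2)) (B_ideal (frac x3 y3)) <->
   (0 < det x2 y2 x1 y1 * (det x3 y3 x2 y2 * det x3 y3 x1 y1))%Z).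
Proof.
  intros N1 N2 N3. unfold ccw. rewrite !B_ideal_frac by auto.
  assert (P : forall x y, (x <> 0 \/ y <> 0)%Z -> 0 < IZR x * IZR x + IZR y * IZR y).
  { intros x y [H|H]; apply not_0_IZR in H;
      [assert (0 < IZR x * IZR x) by (apply Rsqr_pos_lt; auto)|assert (0 < IZR y * IZR y)
          by (apply Rsqr_pos_lt; auto)]; nra. }
  assert (P1 := P _ _ N1). assert (P2 := P _ _ N2). assert (P3 := P _ _ N3).
  set (n := (IZR x1 * IZR x1 + IZR y1 * IZR y1) * ((IZR x2 * IZR x2 +
      IZR y2 * IZR y2) * (IZR x3 * IZR x3 + IZR y3 * IZR y3))).
  assert (Hn : 0 < n) by (unfold n; repeat apply Rmult_lt_0_compat; auto).
  assert (E : Im (Cconj (spinor (IZR x2) (IZR y2) / Cconj (spinor (IZR x2) (IZR y2)) -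
      spinor (IZR x1) (IZR y1) / Cconj (spinor (IZR x1) (IZR y1))) *
     (spinor (IZR x3) (IZR y3) / Cconj (spinor (IZR x3) (IZR y3)) -
         spinor (IZR x1) (IZR y1) / Cconj (spinor (IZR x1) (IZR y1))))%C =
     4 / n * IZR (det x2 y2 x1 y1 * (det x3 y3 x2 y2 * det x3 y3 x1 y1))).
  { unfold det. rewrite !mult_IZR, !minus_IZR, !mult_IZR. unfold n in *. clear N1 N2 N3 Hn.
    unfold spinor, Cconj, Cdiv, Cinv, Cmult, Cminus, Cplus, Copp; simpl. field.
    repeat split; nra. }
  rewrite E. split; intros H.
  - apply lt_IZR. apply Rmult_lt_reg_l with (4 / n); [apply Rdiv_lt_0_compat; lra|]. lra.
  - apply Rmult_lt_0_compat; [apply Rdiv_lt_0_compat; lra|]. apply IZR_lt; auto.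
Qed.

(** Cramer's rule expresses (m, n) in the basis (a, b), (c, d) with both coefficients equal to 1 or
    -1. *)
Lemma third_vertex (a b c d m n : Z) :
  unimodular a b c d -> unimodular a b m n -> unimodular c d m n ->
  frac m n = frac (a + c) (b + d) \/ frac m n = frac (a - c) (b - d).
Proof.
  unfold unimodular. intros H1 H2 H3.
  set (D := det a b c d) in *. set (X := det a b m n) in *. set (Y := det c d m n) in *.
  assert (E1 : (D * m = X * c - Y * a)%Z) by (unfold D, X, Y, det; ring).
  assert (E2 : (D * n = X * d - Y * b)%Z) by (unfold D, X, Y, det; ring).
  clearbody D X Y.
  assert (K1 : (D = 1 \/ D = -1)%Z) by lia. assert (K2 : (X = 1 \/ X = -1)%Z) by lia.
  assert (K3 : (Y = 1 \/ Y = -1)%Z) by lia.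
  assert (S : (m = a + c /\ n = b + d \/ m = - (a + c) /\ n = - (b + d) \/
     m = a - c /\ n = b - d \/ m = - (a - c) /\ n = - (b - d))%Z).
  { destruct K1, K2, K3; subst D X Y; lia. }
  destruct S as [[-> ->]|[[-> ->]|[[-> ->]|[-> ->]]]]; rewrite ?frac_opp; auto.
Qed.

Lemma ccw4_distinct (a b c d : C) : ccw4 a b c d -> a <> c.
Proof.
  intros [H _] E. unfold ccw in H. rewrite <- E in H.
  replace (Cconj (b - a) * (a - a))%C with (RtoC 0) in H by ring. simpl in H. lra.
Qed.

(** A configuration in the definition of the shear comes from a basis u, v with third vertices u - v
    and u + v; the counterclockwise order forces the determinant to be -1. Symmetry of the defect
    then restates the condition for determinant 1. *)
Lemma infinitesimal_shear_iff (F : R -> R -> R) (V : C -> C) (s : farey -> R) :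
  homogeneous2 F -> represents F V ->
  (infinitesimal_shear V s <->
   forall a b c d, det a b c d = 1%Z ->
     parallelogram F (IZR a) (IZR b) (IZR c) (IZR d) = edge_value s a b c d).
Proof.
  intros HF HV. split.
  - intros HS a b c d H. unfold det in H.
    (* The two vectors are exchanged to obtain the determinant -1 of a counterclockwise
       quadruple. *)
    assert (U : unimodular c d a b) by (unfold unimodular, det; lia).
    rewrite edge_value_swap, (edge_value_edge s c d a b U).
    rewrite <- parallelogram_swap by auto.
    apply RtoC_inj. rewrite <- (represents_shear F V c d a b HV) by (unfold det; lia).
    symmetry. apply HS.
    + apply edge_joins.
    + apply complementary_triangle_frac; unfold unimodular, det; lia.
    + apply complementary_triangle_frac; unfold unimodular, det; lia.
    + split; apply ccw_sign; try lia.
      * replace (det c d (c - a) (d - b)) with 1%Z by (unfold det; lia).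
        replace (det (c + a) (d + b) c d) with 1%Z by (unfold det; lia).
        replace (det (c + a) (d + b) (c - a) (d - b)) with 2%Z by (unfold det; lia). lia.
      * replace (det (c + a) (d + b) (c - a) (d - b)) with 2%Z by (unfold det; lia).
        replace (det a b (c + a) (d + b)) with 1%Z by (unfold det; lia).
        replace (det a b (c - a) (d - b)) with 1%Z by (unfold det; lia). lia.
  - intros HP e pa pb pc pd J T1 T2 HC.
    destruct (joins_inv _ _ _ J) as (a & b & c & d & U & -> & -> & ->).
    destruct (unimodular_gcd _ _ _ _ U) as (G1 & G2).
    destruct (complementary_triangle_sides _ _ _ T1) as (x & y & t & -> & Ey & Et & N1 & N2 & N3).
    destruct (complementary_triangle_sides _ _ _ T2) as (y' & x' & t' & Ey' & ->
        & Et' & M1 & M2 & M3).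
    apply B_ideal_inj in Ey, Et, Ey', Et'. subst y t y' t'.
    assert (Sym : forall x y, farey_neighbours x y -> farey_neighbours y x).
    { intros u v (p & q & r & w & Q1 & Q2 & -> & -> & Q). exists r, w, p, q.
      repeat split; auto. rewrite <- Q, <- Z.abs_opp. f_equal. ring. }
    destruct (neighbours_frac a b x G1 (Sym _ _ N1)) as (m & n & U1 & ->).
    destruct (neighbours_frac a b x' G1 M1) as (m' & n' & U2 & ->).
    apply neighbours_frac_frac in N3; [|auto|eapply unimodular_gcd; eauto].
    apply Sym, neighbours_frac_frac in M2; [|auto|eapply unimodular_gcd; eauto].
    assert (A1 := third_vertex a b c d m n U U1 N3).
    assert (A2 := third_vertex a b c d m' n' U U2 M2).
    assert (NE := ccw4_distinct _ _ _ _ HC).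
    rewrite <- edge_value_edge.
    assert (Main : forall c d, unimodular a b c d ->
      ccw4 (B_ideal (frac (a - c) (b - d))) (B_ideal (frac a b)) (B_ideal (frac (a + c) (b +
          d))) (B_ideal (frac c d)) ->
      RtoC (edge_value s a b c d) = 
      ((V (B_ideal (frac (a + c) (b + d))) - V (B_ideal (frac a b))) / (B_ideal (frac (a +
          c) (b + d)) - B_ideal (frac a b)) +
       (V (B_ideal (frac c d)) - V (B_ideal (frac (a - c) (b - d)))) / (B_ideal (frac c d) -
           B_ideal (frac (a - c) (b - d))) -
       (V (B_ideal (frac a b)) - V (B_ideal (frac (a - c) (b - d)))) / (B_ideal (frac a b) -
           B_ideal (frac (a - c) (b - d))) -
       (V (B_ideal (frac c d)) - V (B_ideal (frac (a + c) (b +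
           d)))) / (B_ideal (frac c d) - B_ideal (frac (a + c) (b + d))))%C).
    { clear - HF HV HP. intros c d U [HC _]. unfold unimodular in U.
      apply ccw_sign in HC; [|unfold det in U; lia|unfold det in U; lia|unfold det in U; lia].
      replace (det a b (a - c) (b - d)) with (- det a b c d)%Z in HC by (unfold det; ring).
      replace (det (a + c) (b + d) a b) with (- det a b c d)%Z in HC by (unfold det; ring).
      replace (det (a + c) (b + d) (a - c) (b - d))
          with (- 2 * det a b c d)%Z in HC by (unfold det; ring).
      assert (D : det a b c d = (-1)%Z).
      { set (D := det a b c d) in *. assert (K : (D = 1 \/ D = -1)%Z) by lia.
        destruct K as [K|K]; auto. rewrite K in HC. lia. }
      rewrite (represents_shear F V) by auto. f_equal.
      rewrite edge_value_swap, <- parallelogram_swap, HP; auto. unfold det in *. lia. }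
    (* The two triangles have different third vertices, so one is u + v and the other u - v;
       replacing v by -v exchanges the two assignments. *)
    destruct A1 as [A1|A1], A2 as [A2|A2]; try (rewrite A1, A2 in NE; tauto); rewrite A1, A2 in *.
    + rewrite <- (frac_opp c d), <- edge_value_opp_r in *.
      replace (a + c)%Z with (a - - c)%Z in * by ring.
      replace (b + d)%Z with (b - - d)%Z in * by ring.
      replace (frac (a - c) (b - d)) with (frac (a + - c) (b + - d)) in * by (f_equal; ring).
      apply Main; auto. unfold unimodular, det in *. lia.
    + apply Main; auto.
Qed.

(** * Zygmund fields and bounded fan averages *)

Theorem theorem2 (s : farey -> R) :
  (exists V : C -> C, circle_zygmund V /\ infinitesimal_shear V s) <->
  (exists K : R, 0 < K /\
     forall (p : C) (e : Z -> farey),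
       farey_vertex p -> fan_enumeration p e ->
       forall (m : Z) (k : nat), Rabs (fan_average s e m k) <= K).
Proof.
  split.
  - intros (V & (_ & W & HW & HP) & HS).
    assert (HW' := HW). destruct HW' as ((_ & L & HL & _) & _).
    destruct (line_zygmund_parallelogram W L HW HL) as (F & K & HF & FW & FL & K0 & HK).
    assert (HV := represents_pushforward W V F L HF FW FL HL HP).
    assert (Sh := proj1 (infinitesimal_shear_iff F V s HF HV) HS).
    exists K. split; auto. intros p e Hp He m k.
    destruct (fan_enumeration_inv p e Hp He) as (a & b & c & d & H & g & n0 & Hg & Ee).
    set (A := fun n : Z => edge_value s a b (n * a + c) (n * b + d)).
    set (G := fun n : Z => F (IZR (n * a + c)) (IZR (n * b + d))).
    change (fan_average s e m k) with (average (fun n => s (e n)) m k).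
    rewrite (average_ext _ A m (n0 + g * m) g); auto.
    2: { intros n. unfold A. rewrite Ee. unfold fan_edge.
         replace (n0 + g * m + g * n)%Z with (n0 + g * (m + n))%Z by ring.
         symmetry. apply edge_value_edge. }
    set (m' := (n0 + g * m)%Z).
    assert (HA : forall n, A n = G (n + 1)%Z + G (n - 1)%Z - 2 * G n - 2 * F (IZR a) (IZR b)).
    { intros n. unfold A. rewrite <- Sh by (transitivity (det a b c d); [unfold det; ring|auto]).
      rewrite <- parallelogram_swap by auto. unfold parallelogram, G.
      rewrite <- !plus_IZR, <- !minus_IZR.
      replace (n * a + c + a)%Z with ((n + 1) * a + c)%Z by ring.
      replace (n * b + d + b)%Z with ((n + 1) * b + d)%Z by ring.
      replace (n * a + c - a)%Z with ((n - 1) * a + c)%Z by ring.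
      replace (n * b + d - b)%Z with ((n - 1) * b + d)%Z by ring. reflexivity. }
    assert (S := average_second_difference A G _ m' k HA).
    assert (Hk : 0 < INR k + 1) by (assert (0 <= INR k) by apply pos_INR; lra).
    set (r := INR k + 1) in *.
    assert (EP : r * average A m' k =
      parallelogram F (IZR (m' * a + c)) (IZR (m' * b + d)) (r * IZR a) (r * IZR b)).
    { rewrite S. unfold parallelogram. rewrite HF. unfold G.
      assert (Er : r = IZR (Z.of_nat k + 1))
          by (unfold r; rewrite plus_IZR, <- INR_IZR_INZ; auto).
      rewrite Er, <- !mult_IZR, <- !plus_IZR, <- !minus_IZR.
      replace (m' * a + c + (Z.of_nat k + 1) * a)%Z
          with ((m' + Z.of_nat k + 1) * a + c)%Z by ring.
      replace (m' * b + d + (Z.of_nat k + 1) * b)%Z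
          with ((m' + Z.of_nat k + 1) * b + d)%Z by ring.
      replace (m' * a + c - (Z.of_nat k + 1) * a)%Z
          with ((m' - Z.of_nat k - 1) * a + c)%Z by ring.
      replace (m' * b + d - (Z.of_nat k + 1) * b)%Z
          with ((m' - Z.of_nat k - 1) * b + d)%Z by ring.
      ring. }
    assert (ED : rdet (IZR (m' * a + c)) (IZR (m' * b + d)) (r * IZR a) (r * IZR b) = - r).
    { transitivity (- r * IZR (det a b c d)); [|rewrite H; ring].
      unfold rdet, det. rewrite !plus_IZR, minus_IZR, !mult_IZR. ring. }
    assert (Q := HK (IZR (m' * a + c)) (IZR (m' * b + d)) (r * IZR a) (r * IZR b)).
    rewrite <- EP, ED, Rabs_mult, Rabs_Ropp, (Rabs_right r) in Q by lra.
    apply Rmult_le_reg_l with r; auto. rewrite (Rmult_comm r K). apply Q. lra.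
  - intros (K & K0 & HK).
    set (sg := edge_value s).
    assert (Havg : forall a b c d, det a b c d = 1%Z -> forall m k,
       Rabs (average (fun n => sg a b (n * a + c)%Z (n * b + d)%Z) m k) <= K).
    { intros a b c d H m k.
      rewrite (average_ext _ (fun n => s (fan_edge a b c d H n)) m m 1); auto.
      - apply (HK (B_ideal (frac a b)) (fan_edge a b c d H)).
        + apply basis_vertex with c d; auto.
        + apply fan_edge_enumeration.
      - intros n. rewrite Z.mul_1_l. apply edge_value_edge. }
    assert (Hsg : forall a b c d, Rabs (sg a b c d) <= K).
    (* The average of radius 0 is a single shear, so the fan condition contains the uniform bound
       that makes the Euclidean series converge. *)
    { assert (Pos : forall a b c d, det a b c d = 1%Z -> Rabs (sg a b c d) <= K).
      { intros a b c d H. assert (A := Havg a b c d H 0%Z 0%nat). unfold average in A.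
        rewrite sum_n_m_zero, Rplus_0_r in A by auto. exact A. }
      intros a b c d. destruct (Z.eq_dec (Z.abs (det a b c d)) 1) as [H|H].
      - destruct (Z.eq_dec (det a b c d) 1); [apply Pos; auto|].
        unfold sg. rewrite edge_value_swap. apply Pos. unfold det in *. lia.
      - unfold sg, edge_value. destruct Z.eq_dec; [tauto|]. rewrite Rabs_R0. lra. }
    assert (Hswap : forall a b c d, sg a b c d = sg c d a b) by apply edge_value_swap.
    assert (Hopp : forall a b c d, sg (- a)%Z (- b)%Z c d = sg a b c d) by apply edge_value_opp_l.
    destruct (topograph_zygmund sg K Hsg Hswap Hopp Havg) as (Hpar & HZ).
    set (F := topograph sg) in *.
    assert (HF : homogeneous2 F) by (apply (topograph_homogeneous2 sg K); auto).
    assert (F10 : F 1 0 = 0) by apply topograph_axis_l.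
    assert (F01 : F 0 1 = 0) by apply topograph_axis_r.
    destruct (line_zygmund_of_parallelogram F (81 * K) (2 * K)) as (HW & Lp & Lm); auto; try lra.
    { apply (topograph_bound sg K); auto. }
    destruct (circle_field_zygmund (fun x => F x 1) HW Lp Lm) as (HP & HCZ).
    exists (circle_field (fun x => F x 1)). split; auto.
    apply (infinitesimal_shear_iff F); auto.
    apply represents_pushforward with (fun x => F x 1) 0; auto.
Qed.
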